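(* Let $\gamma>1$ and $M>0$. There is a constant $C>0$, independent of $t$ and of the initial data, such that the following holds. Let $\rho^{in},\omega^{in},\theta^{in}\in H^1_xH^2_y(\mathbb{T}\times\mathbb{R})$ and $\alpha^{in}\in H^{-1/2}_xL^2_y(\mathbb{T}\times\mathbb{R})$ satisfy $$\int_{\mathbb{T}}\rho^{in}\,dx=\int_{\mathbb{T}}\omega^{in}\,dx=\int_{\mathbb{T}}\alpha^{in}\,dx=\int_{\mathbb{T}}\theta^{in}\,dx=0,$$ and let $(\rho,\alpha,\omega,\theta)$ be the solution, with initial data $(\rho^{in},\alpha^{in},\omega^{in},\theta^{in})$ at $t=0$, of the linear system on $\mathbb{T}\times\mathbb{R}$ $$\begin{cases}\partial_t\rho+y\partial_x\rho+\alpha=0,\\ \partial_t\alpha+y\partial_x\alpha+2\partial_x\big(\partial_y\Delta^{-1}\alpha+\partial_x\Delta^{-1}\omega\big)+\frac{1}{\gamma M^2}(\Delta\rho+\Delta\theta)=0,\\ \partial_t\omega+y\partial_x\omega-\alpha=0,\\ \partial_t\theta+y\partial_x\theta+(\gamma-1)\alpha=0.\end{cases}$$ Set $\mathbb{P}[\mathbf{v}]=(\mathbb{P}[\mathbf{v}]^x,\mathbb{P}[\mathbf{v}]^y)^T=\nabla^\perp\Delta^{-1}\omega=(-\partial_y\Delta^{-1}\omega,\ \partial_x\Delta^{-1}\omega)^T$ and $\mathbb{Q}[\mathbf{v}]=\nabla\Delta^{-1}\alpha$. Then for all $t\ge 0$: $$\begin{aligned}\|\mathbb{P}[\mathbf{v}]^x(t)\|_{L^2}\le{}&\frac{CM}{\langle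 t\rangle^{1/2}}\Big(\Big\|\frac{\rho^{in}+\theta^{in}}{\gamma M}\Big\|_{H^{-1/2}_xL^2_y}+\|\alpha^{in}\|_{H^{-1/2}_xH^{-1}_y}+\Big\|\frac{\rho^{in}+\theta^{in}+\gamma\omega^{in}}{\gamma}\Big\|_{H^{-1/2}_xH^{1/2}_y}\Big)\\&+\frac{C}{\langle t\rangle}\Big\|\frac{\rho^{in}+\theta^{in}+\gamma\omega^{in}}{\gamma}\Big\|_{H^{-1}_xH^1_y},\end{aligned}$$ $$\begin{aligned}\|\mathbb{P}[\mathbf{v}]^y(t)\|_{L^2}\le{}&\frac{CM}{\langle t\rangle^{3/2}}\Big(\Big\|\frac{\rho^{in}+\theta^{in}}{\gamma M}\Big\|_{H^{-1/2}_xH^1_y}+\|\alpha^{in}\|_{H^{-1/2}_xL^2_y}+\Big\|\frac{\rho^{in}+\theta^{in}+\gamma\omega^{in}}{\gamma}\Big\|_{H^{-1/2}_xH^{3/2}_y}\Big)\\&+\frac{C}{\langle t\rangle^2}\Big\|\frac{\rho^{in}+\theta^{in}+\gamma\omega^{in}}{\gamma}\Big\|_{H^{-1}_xH^2_y},\end{aligned}$$ and moreover $$\begin{aligned}&\|\mathbb{Q}[\mathbf{v}](t)\|_{L^2}+\frac{\gamma}{M}\|\rho(t)\|_{L^2}+\frac{\gamma}{M}\|\theta(t)\|_{L^2}\\&\quad\le C\langle t\rangle^{1/2}\Big((\gamma-1)\Big\|\frac{(\gamma-1)\rho^{in}-\theta^{in}}{M}\Big\|_{L^2}+\Big\|\frac{\rho^{in}+\theta^{in}}{\gamma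 M}\Big\|_{L^2}+\|\alpha^{in}\|_{H^{-1}}+\Big\|\frac{\rho^{in}+\theta^{in}+\gamma\omega^{in}}{\gamma}\Big\|_{H^{1/2}}\Big).\end{aligned}$$
   Context: The domain is $\mathbb{T}\times\mathbb{R}\ni(x,y)$ with $\mathbb{T}=\mathbb{R}/\mathbb{Z}$. The system is the linearization of the two-dimensional non-isentropic compressible Euler equations around the Couette flow (velocity $(y,0)^T$, density $1$, temperature $1$); $\rho$, $\theta$, $\mathbf{v}=(v^x,v^y)^T$ are the perturbations of density, temperature and velocity, $\alpha=\operatorname{div}\mathbf{v}$, $\omega=\nabla^\perp\cdot\mathbf{v}$ with $\nabla^\perp=(-\partial_y,\partial_x)^T$, and $\mathbf{v}=\mathbb{P}[\mathbf{v}]+\mathbb{Q}[\mathbf{v}]$ is the Helmholtz decomposition. Here $\gamma$ is the ratio of specific heats and $M$ is the Mach number. The constant $C$ may depend on $\gamma$ and $M$. Fourier transform: $\widehat f(k,\eta)=\frac{1}{2\pi}\iint_{\mathbb{T}\times\mathbb{R}}e^{-i(kx+\eta y)}f(x,y)\,dx\,dy$, where $k$ ranges over the frequencies dual to $\mathbb{T}$ ($k\in 2\pi\mathbb{Z}$ for $\mathbb{T}=\mathbb{R}/\mathbb{Z}$) and $\eta\in\mathbb{R}$ (extended to distributions as usual). $\Delta=\partial_{xx}+\partial_{yy}$, and $\Delta^{-1}$ is the Fourier multiplier with symbol $-1/(k^2+\eta^2)$, applied to functions with zero $x$-average (i.e. $\widehat f(0,\eta)=0$). The conditions $\int_{\mathbb{T}}f\,dx=0$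 mean zero $x$-average for every (a.e.) $y$, i.e. $\widehat f(0,\cdot)=0$. Notation: $\langle a\rangle=(1+a^2)^{1/2}$, $\langle k,\eta\rangle=(1+k^2+\eta^2)^{1/2}$; $\|f\|_{H^{s_1}_xH^{s_2}_y}^2=\sum_k\int\langle k\rangle^{2s_1}\langle\eta\rangle^{2s_2}|\widehat f(k,\eta)|^2\,d\eta$ (with $L^2_y=H^0_y$), and $\|f\|_{H^s}^2=\sum_k\int\langle k,\eta\rangle^{2s}|\widehat f(k,\eta)|^2\,d\eta$; $L^2=L^2(\mathbb{T}\times\mathbb{R})$. *)

(* Defs.v *)
From HB Require Import structures.
From mathcomp Require Import all_boot all_order all_algebra.
From mathcomp Require Import all_classical all_reals all_analysis.
From mathcomp.real_closed Require Import complex.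
Set Implicit Arguments.
Unset Strict Implicit.
Unset Printing Implicit Defensive.
Import Order.TTheory GRing.Theory Num.Theory.
Import numFieldNormedType.Exports.
Local Open Scope classical_set_scope.
Local Open Scope complex_scope.
Local Open Scope ring_scope.

(** A real tempered distribution [f] on T x R, T = R/Z, whose Fourier transform
    is a function is represented by that function: [f n eta] is the transform at
    the frequency (k, eta), k = 2 pi n, for the normalization
      (1/2pi) \iint e^{-i(kx + eta y)} f(x,y) dx dy.
    Every Sobolev space below consists of such distributions. *)
Definition spectrum (R : realType) := int -> R -> R[i].

Section Spectra.
Context {R : realType}.
Implicit Types (f : spectrum R) (n : int) (eta : R).

Definition wavenumber n : R := 2 * pi * n%:~R.

Definition jap (a : R) : R := Num.sqrt (1 + a ^+ 2).

Definition jap2 (a b : R) : R := Num.sqrt (1 + a ^+ 2 + b ^+ 2).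

Definition sqr_norm (z : R[i]) : R := complex.Re z ^+ 2 + complex.Im z ^+ 2.

(** The symmetry in the last clause says that the distribution is real. *)
Definition real_spectrum f : Prop :=
  [/\ forall n, measurable_fun setT (fun eta => complex.Re (f n eta)),
      forall n, measurable_fun setT (fun eta => complex.Im (f n eta))
    & forall n, {ae lebesgue_measure, forall eta : R,
        f (- n) (- eta) = conjc (f n eta)}].

(** Zero x-average. *)
Definition zero_mean f : Prop :=
  {ae lebesgue_measure, forall eta : R, f 0 eta = 0}.

Definition weighted_norm (w : int -> R -> R) f : \bar R :=
  sqrte (\esum_(n in [set: int])
    \int[lebesgue_measure]_eta (w n eta * sqr_norm (f n eta))%:E)%E.

Definition Hxy_norm (s1 s2 : R) : spectrum R -> \bar R :=
  weighted_norm (fun n eta =>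
    (jap (wavenumber n) `^ (2 * s1)) * (jap eta `^ (2 * s2))).

Definition H_norm (s : R) : spectrum R -> \bar R :=
  weighted_norm (fun n eta => jap2 (wavenumber n) eta `^ (2 * s)).

Definition L2_norm : spectrum R -> \bar R := weighted_norm (fun _ _ => 1).

Definition L2_norm_vec (f g : spectrum R) : \bar R :=
  sqrte (L2_norm f ^+ 2 + L2_norm g ^+ 2)%E.

Definition in_Hxy (s1 s2 : R) f : Prop :=
  real_spectrum f /\ (Hxy_norm s1 s2 f < +oo)%E.

Definition ddx f : spectrum R :=
  fun n eta => Complex 0 (wavenumber n) * f n eta.

Definition ddy f : spectrum R :=
  fun n eta => Complex 0 eta * f n eta.

(** Only meaningful on spectra satisfying [zero_mean]. *)
Definition inv_lap f : spectrum R :=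
  fun n eta => - ((wavenumber n ^+ 2 + eta ^+ 2)^-1)%:C * f n eta.

End Spectra.

Section Distributions.
Context {R : realType}.

Definition partial_x (phi : R -> R -> R) : R -> R -> R :=
  fun x y => derive1 (phi ^~ y) x.

Definition partial_y (phi : R -> R -> R) : R -> R -> R :=
  fun x y => derive1 (phi x) y.

(** Iterated partial derivative along a word: [true] for d/dx, [false] for
    d/dy. *)
Definition partials (w : seq bool) (phi : R -> R -> R) : R -> R -> R :=
  foldr (fun b psi => if b then partial_x psi else partial_y psi) phi w.

(** Schwartz functions on T x R.  Joint continuity of the derivatives need not
    be required: it follows from the boundedness of those of the next order. *)
Definition schwartz (phi : R -> R -> R) : Prop :=
  [/\ forall x y, phi (x + 1) y = phi x y,
      forall w x y, derivable (partials w phi ^~ y) x 1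
                 /\ derivable (partials w phi x) y 1
    & forall w (j : nat), exists K, forall x y,
        `|y ^+ j * partials w phi x y| <= K].

Definition fourier (phi : R -> R -> R) : spectrum R := fun n eta =>
  ((2 * pi)^-1)%:C * Complex
    (\int[lebesgue_measure]_(x in `[0, 1])
       \int[lebesgue_measure]_y (cos (wavenumber n * x + eta * y) * phi x y))
    (- \int[lebesgue_measure]_(x in `[0, 1])
       \int[lebesgue_measure]_y (sin (wavenumber n * x + eta * y) * phi x y)).

(** Only the values at [schwartz] functions matter. *)
Definition distr := (R -> R -> R) -> R.

(** Action of [f] on test functions.  By Parseval's identity for the
    normalization of [fourier],
      \iint f phi dx dy = 2 pi \sum_k \int fhat(k,eta) conj(phihat(k,eta)) deta,
    which is real for a [real_spectrum]; the sum over the integers is the limit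
    of its symmetric partial sums. *)
Definition dist (f : spectrum R) : distr := fun phi =>
  2 * pi * limn (fun N : nat => \sum_(i < N.*2.+1)
    \int[lebesgue_measure]_eta
      complex.Re (f (i%:Z - N%:Z) eta *
                  conjc (fourier phi (i%:Z - N%:Z) eta))).

Definition dist_dx (T : distr) : distr :=
  fun phi => - T (partial_x phi).

Definition dist_dy (T : distr) : distr :=
  fun phi => - T (partial_y phi).

Definition dist_lap (T : distr) : distr :=
  dist_dx (dist_dx T) + dist_dy (dist_dy T).

Definition dist_muly (T : distr) : distr :=
  fun phi => T (fun x y => y * phi x y).

(** Time-dependent distributions whose Fourier transform is a function, bounded
    in some Sobolev space, of arbitrarily negative order, on every bounded time
    interval.  Values at negative times are irrelevant. *)
Definition evolution (u : R -> spectrum R) : Prop :=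
  [/\ forall n, measurable_fun ([set t : R | 0 <= t] `*` [set: R])
        (fun p : R * R => complex.Re (u p.1 n p.2)),
      forall n, measurable_fun ([set t : R | 0 <= t] `*` [set: R])
        (fun p : R * R => complex.Im (u p.1 n p.2)),
      forall t, 0 <= t -> real_spectrum (u t)
    & forall T, 0 <= T -> exists s K : R, forall t, 0 <= t <= T ->
        (H_norm s (u t) <= K%:E)%E].

(** du/dt + G = 0 for t > 0 and u continuous at t = 0, in the sense of
    distributions on T x R. *)
Definition evolves (u : R -> spectrum R) (G : R -> distr) : Prop :=
  forall phi, schwartz phi ->
    (dist (u s) phi @[s --> 0^'+] --> dist (u 0) phi) /\
    (forall t : R, 0 < t ->
       is_derive t 1 (fun s => dist (u s) phi) (- G t phi)).

(** The zero x-average of alpha and omega is what makes the terms with the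
    inverse Laplacian meaningful. *)
Record couette_solution (gamma M : R)
    (rho_in alpha_in omega_in theta_in : spectrum R)
    (rho alpha omega theta : R -> spectrum R) : Prop := CouetteSolution {
  sol_class : [/\ evolution rho, evolution alpha, evolution omega
                & evolution theta];
  sol_mean : forall t, 0 <= t -> zero_mean (alpha t) /\ zero_mean (omega t);
  sol_init : [/\ rho 0 = rho_in, alpha 0 = alpha_in, omega 0 = omega_in
               & theta 0 = theta_in];
  sol_rho : evolves rho (fun t =>
    dist_muly (dist_dx (dist (rho t))) + dist (alpha t));
  sol_alpha : evolves alpha (fun t =>
    dist_muly (dist_dx (dist (alpha t)))
    + 2 *: dist_dx (dist_dy (dist (inv_lap (alpha t)))
                    + dist_dx (dist (inv_lap (omega t))))
    + (gamma * M ^+ 2)^-1 *: (dist_lap (dist (rho t))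
                              + dist_lap (dist (theta t))));
  sol_omega : evolves omega (fun t =>
    dist_muly (dist_dx (dist (omega t))) - dist (alpha t));
  sol_theta : evolves theta (fun t =>
    dist_muly (dist_dx (dist (theta t)))
    + (gamma - 1) *: dist (alpha t))
}.

(** P[v] = (- d_y, d_x) Lap^-1 omega  and  Q[v] = (d_x, d_y) Lap^-1 alpha. *)
Definition Pv_x (omega : spectrum R) : spectrum R := - ddy (inv_lap omega).
Definition Pv_y (omega : spectrum R) : spectrum R := ddx (inv_lap omega).
Definition Qv_x (alpha : spectrum R) : spectrum R := ddx (inv_lap alpha).
Definition Qv_y (alpha : spectrum R) : spectrum R := ddy (inv_lap alpha).

End Distributions.

(* Main.v *)
Require Import Defs.
From HB Require Import structures.
From mathcomp Require Import all_boot all_order all_algebra.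
From mathcomp Require Import all_classical all_reals all_analysis.
From mathcomp.real_closed Require Import complex.
From mathcomp Require Import measurable_realfun zify ring lra.
Import Order.TTheory GRing.Theory Num.Theory.
Import numFieldNormedType.Exports.
Local Open Scope classical_set_scope.
Local Open Scope complex_scope.
Local Open Scope ring_scope.
Set Implicit Arguments.
Unset Strict Implicit.
Unset Printing Implicit Defensive.

(** In Fourier variables the transport term [y d_x] moves the frequency along the
characteristics [eta - k t], where [k] is the wavenumber of the mode.  On a
characteristic with [k != 0] the system is a linear ODE in time.  Put
[s = t - eta / k]; the symbol of minus the Laplacian is then [k^2 (1 + s^2)].
The entropy [((gamma - 1) rho - theta) / M] and
[Xi = (rho + theta + gamma omega) / gamma] do not move.  Since
[omega = Xi - M P] for the pressure [P = (rho + theta) / (gamma M)], what is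
left is an oscillator for [P] and [A = alpha] forced by the constant [Xi]:

  P' = - A / M,
  A' = 2 s / (1 + s^2) A - 2 / (1 + s^2) (Xi - M P) + k^2 (1 + s^2) / M P.

Its adiabatic invariant suggests that [(1 + s^2)^(-1/4) P] and
[(1 + s^2)^(-3/4) A / k] stay bounded.  The sum of their squares with
[Xi^2 / k^2] has a derivative of relative size [1 / |s|], which is not
integrable, but a small cross term in [P A] cancels it to leading order.  The
corrected energy [E] satisfies [E' <= K E / (1 + s^2)], and [K atan s] is
bounded: this is [acoustic_estimate].  The constant does not depend on the
frequency, nor on the critical time [eta / k] at which the shear unwinds the
wave.

The weights in [E] are powers of the bracket of [t - eta / k].  Peetre's
inequality compares it with the brackets of [t] and of [eta / k].  A power of
[t] comes out, and the bracket of [eta / k], which is at most the bracket of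
[eta], becomes derivatives on the data: this is [bound_Pvx], [bound_Pvy] and
[bound_Q].  The velocities are [omega] and [alpha] divided by the square root
of the symbol, or by more of it for the second component of [P[v]].  It remains
to integrate in [eta], undo the translation by [k t], sum over [k], and take
square roots.  The zero mode contributes nothing: it vanishes for [alpha] and
[omega] by definition of a solution and is frozen at zero for [rho] and [theta]
([zero_mode_frozen]).

A solution is given only in the sense of distributions, so the ODE has to be
extracted from it.  The test functions are plane waves in [x] times Gaussian
wave packets in [y], times a polynomial; the equations and the Fourier
transform act on them by explicit algebra ([dist_gtest]).  They turn the system
into transport equations tested against Gaussians in [eta]
([evolves_transport]).  A Gaussian whose centre follows a characteristic gives
Duhamel's formula after pairing ([weak_duhamel]); as Gaussians separate
functions ([gauss_uniqueness]), the formula holds for almost every [eta], at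
each time ([duhamel_ae]).  Fubini's theorem exchanges the two quantifiers, and
on almost every characteristic the primitives of the sources are genuine
solutions of the ODE ([acoustic_characteristics]). *)

(** * Measurable real functions *)

Lemma measurable_EFinT d (T : measurableType d) (R : realType) (D : set T) (f : T -> R) :
  measurable_fun D f -> measurable_fun D (fun x => (f x)%:E).
Proof. by move=> mf; exact/measurable_EFinP. Qed.

Lemma integrable_measurable d (T : measurableType d) (R : realType)
    (mu : {measure set T -> \bar R}) (D : set T) (f : T -> R) :
  mu.-integrable D (EFin \o f) -> measurable_fun D f.
Proof. by move=> /measurable_int/measurable_EFinP. Qed.

(** * Rules of differentiation *)

Section DerivativeRules.
Context {R : realType}.
Implicit Types (f g : R -> R) (x df dg : R).

(** The rules are stated on explicit functions of a variable, the form in which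
    [deriv_tac] meets them. *)
Lemma der_cst (c x : R) : is_derive x (1:R) (fun _ : R => c) 0.
Proof. exact: is_derive_cst. Qed.

Lemma der_id (x : R) : is_derive x (1:R) (fun y : R => y) 1.
Proof. exact: is_derive_id. Qed.

Lemma der_add f g x df dg : is_derive x (1:R) f df -> is_derive x (1:R) g dg ->
  is_derive x (1:R) (fun y => f y + g y) (df + dg).
Proof. exact: is_deriveD. Qed.

Lemma der_opp f x df : is_derive x (1:R) f df -> is_derive x (1:R) (fun y => - f y) (- df).
Proof. exact: is_deriveN. Qed.

Lemma der_mul f g x df dg : is_derive x (1:R) f df -> is_derive x (1:R) g dg ->
  is_derive x (1:R) (fun y => f y * g y) (f x * dg + g x * df).
Proof. exact: is_deriveM. Qed.

Lemma der_exp n f x df : is_derive x (1:R) f df ->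
  is_derive x (1:R) (fun y => f y ^+ n) ((n%:R * f x ^+ n.-1) * df).
Proof.
move=> hf; have := @is_deriveX _ _ f n x 1 df hf.
by rewrite (_ : f ^+ n = (fun y => f y ^+ n))//; apply/funext => y; rewrite fctE.
Qed.

Lemma der_comp f g x a b : is_derive (g x) (1:R) f a -> is_derive x (1:R) g b ->
  is_derive x (1:R) (fun y => f (g y)) (a * b).
Proof. move=> hf hg; exact: (is_derive1_comp hf hg). Qed.

Lemma der_inv f x df : f x != 0 -> is_derive x (1:R) f df ->
  is_derive x (1:R) (fun y => (f y)^-1) (- (f x) ^- 2 * df).
Proof. by move=> f0 hf; exact: is_deriveV. Qed.

Lemma der_poly (p : {poly R}) x : is_derive x (1:R) (fun y => p.[y]) (p^`()).[x].
Proof. exact: is_derive_poly. Qed.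

Lemma der_continuous f (f' : R -> R) :
  (forall x, is_derive x (1:R) f (f' x)) -> continuous f.
Proof.
move=> df x; apply: differentiable_continuous; apply/derivable1_diffP.
exact: (@ex_derive _ _ _ _ _ _ _ (df x)).
Qed.

End DerivativeRules.

(** The shape of the function drives the rules; derivatives of opaque functions
    are taken from the context, and what is left is the identity of slopes. *)
Ltac deriv_tac :=
 lazymatch goal with
 | |- is_derive _ _ (fun _ => ?c) _ => exact: der_cst
 | |- is_derive _ _ (fun y => y) _ => exact: der_id
 | |- is_derive _ _ (fun y => @?f y + @?g y) _ =>
     eapply (@der_add _ f g); deriv_tac
 | |- is_derive _ _ (fun y => - @?f y) _ => eapply (@der_opp _ f); deriv_tac
 | |- is_derive _ _ (fun y => @?f y * @?g y) _ =>
     eapply (@der_mul _ f g); deriv_tac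
 | |- is_derive _ _ (fun y => (@?f y) ^+ ?n) _ => eapply (@der_exp _ n f); deriv_tac
 | |- is_derive _ _ (fun y => cos (@?f y)) _ =>
     eapply (@der_comp _ cos f); [exact: is_derive_cos|deriv_tac]
 | |- is_derive _ _ (fun y => sin (@?f y)) _ =>
     eapply (@der_comp _ sin f); [exact: is_derive_sin|deriv_tac]
 | |- is_derive _ _ (fun y => expR (@?f y)) _ =>
     eapply (@der_comp _ expR f); [exact: is_derive_expR|deriv_tac]
 | |- is_derive _ _ (fun y => atan (@?f y)) _ =>
     eapply (@der_comp _ atan f); [exact: is_derive1_atan|deriv_tac]
 | |- is_derive _ _ (fun y => ?p.[y]) _ => exact: der_poly
 | |- _ => first [eassumption|idtac]
 end.
Ltac deriv := eapply is_derive_eq; [deriv_tac|].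

(** * Invariance of Lebesgue measure under translation and reflection *)

Section LebesgueInvariance.
Context {R : realType}.
Local Notation mu := (@lebesgue_measure R).

(** Typed on the measurable copy of the line, so that the pushforward of the
    measure by it makes sense. *)
Definition affine_shift (b : R) : measurableTypeR R -> measurableTypeR R :=
  fun x => x + b.
Definition reflection : measurableTypeR R -> measurableTypeR R := fun x => - x.

Lemma measurable_affine_shift b : measurable_fun setT (affine_shift b).
Proof. by apply: measurable_funD. Qed.

Lemma measurable_reflection : measurable_fun setT reflection.
Proof. exact: measurable_funN. Qed.

HB.instance Definition _ b := isMeasurableFun.Build _ _ _ _ (affine_shift b) (measurable_affine_shift b).
HB.instance Definition _ := isMeasurableFun.Build _ _ _ _ reflection measurable_reflection.

Lemma lebesgue_measure_shift b (A : set R) : measurable A ->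
  mu (affine_shift b @^-1` A) = mu A.
Proof.
move=> mA.
have mphi := measurable_affine_shift b.
rewrite -/(pushforward mu (affine_shift b) A).
apply/esym.
apply: (@lebesgue_measure_unique _ (pushforward mu (affine_shift b))) => //.
move=> _ [[x y] _ <-].
transitivity (mu `]x - b, y - b]%classic); last first.
  rewrite /= /pushforward; congr (mu _); apply/seteqP; split => z /=;
   by rewrite !in_itv/= /affine_shift ltrBlDr lerBrDr.
rewrite !lebesgue_measure_itv/= !lte_fin ltrD2r; case: ifP => // _.
by rewrite -!EFinD; congr EFin; ring.
Qed.

Lemma lebesgue_measure_reflection (A : set R) : measurable A ->
  mu (reflection @^-1` A) = mu A.
Proof.
move=> mA.
have mphi := measurable_reflection.
rewrite -/(pushforward mu reflection A).
apply/esym.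
apply: (@lebesgue_measure_unique _ (pushforward mu reflection)) => //.
move=> _ [[x y] _ <-].
transitivity (mu `[- y, - x[%classic); last first.
  rewrite /= /pushforward; congr (mu _); apply/seteqP; split => z /=;
   by rewrite !in_itv/= /reflection ltrNr lerNl andbC.
rewrite !lebesgue_measure_itv/= !lte_fin ltrN2; case: ifP => // _.
by rewrite -!EFinD; congr EFin; ring.
Qed.

Lemma ge0_integral_shift b (f : R -> \bar R) : measurable_fun setT f ->
  (forall x, 0 <= f x)%E ->
  (\int[mu]_x f (x + b)%R = \int[mu]_x f x)%E.
Proof.
move=> mf f0.
transitivity (\int[pushforward mu (affine_shift b)]_x f x)%E.
  by rewrite ge0_integral_pushforward// => *; exact: f0.
by apply: eq_measure_integral => A mA _; exact: (lebesgue_measure_shift b).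
Qed.

Lemma ge0_integral_reflection (f : R -> \bar R) : measurable_fun setT f ->
  (forall x, 0 <= f x)%E ->
  (\int[mu]_x f (- x)%R = \int[mu]_x f x)%E.
Proof.
move=> mf f0.
transitivity (\int[pushforward mu reflection]_x f x)%E.
  by rewrite ge0_integral_pushforward// => *; exact: f0.
by apply: eq_measure_integral => A mA _; exact: (lebesgue_measure_reflection).
Qed.

Lemma Rintegral_shift b (f : R -> R) : measurable_fun setT f ->
  \int[mu]_x f (x + b) = \int[mu]_x f x.
Proof.
move=> mf; rewrite /Rintegral; congr fine.
have {}mf : measurable_fun setT (EFin \o f) by exact/measurable_EFinP.
rewrite integralE [RHS]integralE; congr (_ - _)%E.
  have mp' := measurable_funepos mf.
  by rewrite -[RHS](ge0_integral_shift b)//; apply: eq_integral => x _; rewrite !funeposE.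
have mp := measurable_funeneg mf.
by rewrite -[RHS](ge0_integral_shift b)//; apply: eq_integral => x _; rewrite !funenegE.
Qed.

Lemma Rintegral_reflection (f : R -> R) : measurable_fun setT f ->
  \int[mu]_x f (- x) = \int[mu]_x f x.
Proof.
move=> mf; rewrite /Rintegral; congr fine.
have {}mf : measurable_fun setT (EFin \o f) by exact/measurable_EFinP.
rewrite integralE [RHS]integralE; congr (_ - _)%E.
  have mp' := measurable_funepos mf.
  by rewrite -[RHS](ge0_integral_reflection)//; apply: eq_integral => x _; rewrite !funeposE.
have mp := measurable_funeneg mf.
by rewrite -[RHS](ge0_integral_reflection)//; apply: eq_integral => x _; rewrite !funenegE.
Qed.

Lemma integrable_shift b (f : R -> R) : mu.-integrable setT (EFin \o f) ->
  mu.-integrable setT (EFin \o (fun x => f (x + b))).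
Proof.
move=> /integrableP[/measurable_EFinP mf fi]; apply/integrableP; split.
  by apply/measurable_EFinP; apply: (measurableT_comp mf (measurable_affine_shift b)).
rewrite /= (@ge0_integral_shift b (fun x => `|(f x)%:E|%E))//.
by apply: measurableT_comp => //; exact/measurable_EFinP.
Qed.

Lemma integrable_reflection (f : R -> R) : mu.-integrable setT (EFin \o f) ->
  mu.-integrable setT (EFin \o (fun x => f (- x))).
Proof.
move=> /integrableP[/measurable_EFinP mf fi]; apply/integrableP; split.
  by apply/measurable_EFinP; apply: (measurableT_comp mf measurable_reflection).
rewrite /= (@ge0_integral_reflection (fun x => `|(f x)%:E|%E))//.
by apply: measurableT_comp => //; exact/measurable_EFinP.
Qed.

Lemma ae_reflection (P : R -> Prop) : {ae mu, forall x, P x} ->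
  {ae mu, forall x, P (- x)}.
Proof.
move=> [A [mA A0 PA]]; exists (reflection @^-1` A); split.
- by rewrite -[X in measurable X]setTI; exact: measurable_reflection.
- by rewrite -A0; exact: lebesgue_measure_reflection.
- by move=> x /= Px; apply: PA.
Qed.

Lemma ae_imp (P Q : R -> Prop) : (forall x, P x -> Q x) ->
  {ae mu, forall x, P x} -> {ae mu, forall x, Q x}.
Proof. by move=> h; apply: (@filterS _ (almost_everywhere mu)). Qed.

Lemma ae_and (P Q : R -> Prop) : {ae mu, forall x, P x} -> {ae mu, forall x, Q x} ->
  {ae mu, forall x, P x /\ Q x}.
Proof. exact: (@filterI _ (almost_everywhere mu)). Qed.

Lemma ae_true (P : R -> Prop) : (forall x, P x) -> {ae mu, forall x, P x}.
Proof. by move=> h; apply: (@filterE _ (almost_everywhere mu)). Qed.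

End LebesgueInvariance.

(** * Integrable real functions *)

Section RealIntegrable.
Context d (T : measurableType d) (R : realType) (mu : {measure set T -> \bar R}).
Variables (D : set T) (mD : measurable D).
Implicit Types f g : T -> R.

(** The forms on real-valued functions, which unification finds under [EFin]. *)
Lemma integrable_addr f g : mu.-integrable D (EFin \o f) -> mu.-integrable D (EFin \o g) ->
  mu.-integrable D (EFin \o (fun x => f x + g x)).
Proof. by move=> hf hg; exact: integrableD hf hg. Qed.

Lemma integrable_subr f g : mu.-integrable D (EFin \o f) -> mu.-integrable D (EFin \o g) ->
  mu.-integrable D (EFin \o (fun x => f x - g x)).
Proof. by move=> hf hg; exact: integrableB hf hg. Qed.

Lemma integrable_scaler c f : mu.-integrable D (EFin \o f) ->
  mu.-integrable D (EFin \o (fun x => c * f x)).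
Proof. by move=> hf; exact: integrableZl hf. Qed.

Lemma integrable_dominated f g : measurable_fun D f ->
  (forall x, D x -> `|f x| <= g x) -> mu.-integrable D (EFin \o g) ->
  mu.-integrable D (EFin \o f).
Proof.
move=> mf fg ig; apply: le_integrable ig => //; first exact: measurable_EFinT.
move=> x Dx; rewrite lee_fin; apply: (le_trans (fg x Dx)); exact: ler_norm.
Qed.

Lemma EFin_Rintegral f : mu.-integrable D (EFin \o f) ->
  ((\int[mu]_(x in D) f x)%R)%:E = (\int[mu]_(x in D) (f x)%:E)%E.
Proof. by move=> hf; rewrite /Rintegral fineK//; exact: integrable_fin_num. Qed.

Lemma integrable_ae_eq f g : measurable_fun D f -> mu.-integrable D (EFin \o g) ->
  {ae mu, forall x, D x -> f x = g x} ->
  mu.-integrable D (EFin \o f) /\ \int[mu]_(x in D) f x = \int[mu]_(x in D) g x.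
Proof.
move=> mf ig fg.
have mf' := measurable_EFinT mf; have mg' := measurable_int _ ig.
have eq1 : (\int[mu]_(x in D) (f x)%:E = \int[mu]_(x in D) (g x)%:E)%E.
  by apply: ae_eq_integral => //; apply: filterS fg => x /= h Dx; rewrite h.
split; last by rewrite /Rintegral eq1.
apply/integrableP; split => //.
have /integrableP[_] := ig; congr (_ < _)%E.
apply: ae_eq_integral => //; [exact: measurableT_comp|exact: measurableT_comp|].
by apply: filterS fg => x /= h Dx; rewrite h.
Qed.

End RealIntegrable.

(** Real integrals with parameter are differences of two nonnegative ones, to
    which Tonelli's theorem applies without integrability. *)
Lemma measurable_Rintegral_param d1 d2 (T1 : measurableType d1) (T2 : measurableType d2)
    (R : realType) (m2 : {sigma_finite_measure set T2 -> \bar R}) (f : T1 * T2 -> R) :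
  measurable_fun setT f -> measurable_fun setT (fun x => \int[m2]_y f (x, y)).
Proof.
move=> mf; have mf' := measurable_EFinT mf.
rewrite /Rintegral; apply: measurableT_comp; first exact: fine_measurable.
rewrite (_ : (fun x => _) = (fun x => \int[m2]_y (EFin \o f)^\+ (x, y) - \int[m2]_y (EFin \o f)^\- (x, y))%E).
  apply: emeasurable_funB.
  - by apply: measurable_fun_fubini_tonelli_F => //; exact: measurable_funepos.
  - by apply: measurable_fun_fubini_tonelli_F => //; exact: measurable_funeneg.
apply/funext => x; rewrite integralE; congr (_ - _)%E; apply: eq_integral => y _.
  by rewrite !funeposE.
by rewrite !funenegE.
Qed.

(** * Square-integrability with a polynomial weight *)

Section Weighted.
Context {R : realType}.
Local Notation mu := (@lebesgue_measure R).
Implicit Types (f g q : R -> R).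

Lemma integral_oneDsqrV : (\int[mu]_x ((1 + x ^+ 2)^-1)%:E = (pi)%:E)%E.
Proof.
rewrite (@ge0_symfun_integralT _ (fun x => (1 + x ^+ 2)^-1)).
- by rewrite -set_itvcy integral0y_oneDsqr -EFinM; congr EFin; field.
- by move=> x; rewrite invr_ge0 addr_ge0// sqr_ge0.
- exact: continuous_oneDsqrV.
- by move=> x /=; rewrite sqrrN.
Qed.

Lemma measurable_oneDsqrV : measurable_fun [set: R] (fun x : R => (1 + x ^+ 2)^-1).
Proof. apply: continuous_measurable_fun; exact: continuous_oneDsqrV. Qed.

Lemma integrable_oneDsqrV : mu.-integrable setT (EFin \o (fun x : R => (1 + x ^+ 2)^-1)).
Proof.
apply/integrableP; split; first exact: measurable_EFinT measurable_oneDsqrV.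
under eq_integral do rewrite /= ger0_norm ?invr_ge0 ?addr_ge0 ?sqr_ge0//.
by rewrite integral_oneDsqrV ltry.
Qed.

(** Square of a negative-order norm in frequency: every Sobolev spectrum has a
    finite one on each mode, for [N] large. *)
Definition wnorm (N : nat) f : \bar R :=
  (\int[mu]_x (f x ^+ 2 / (1 + x ^+ 2) ^+ N)%:E)%E.

Lemma sqrD1_gt0 (x : R) : 0 < 1 + x ^+ 2.
Proof. by rewrite ltr_pwDl// sqr_ge0. Qed.

Lemma sqrD1_ge1 (x : R) : 1 <= 1 + x ^+ 2.
Proof. by rewrite lerDl sqr_ge0. Qed.

Lemma measurable_wnorm N f : measurable_fun setT f ->
  measurable_fun setT (fun x => (f x ^+ 2 / (1 + x ^+ 2) ^+ N)).
Proof.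
move=> mf; apply: measurable_funM; first exact: measurable_funX.
rewrite (_ : (fun x => _) = (fun x : R => ((1 + x ^+ 2)^-1) ^+ N)); last first.
  by apply/funext => x; rewrite exprVn.
by apply: measurable_funX; exact: measurable_oneDsqrV.
Qed.

Lemma wnorm_ge0_term N f x : 0 <= f x ^+ 2 / (1 + x ^+ 2) ^+ N.
Proof. by rewrite divr_ge0 ?sqr_ge0// exprn_ge0// ltW// sqrD1_gt0. Qed.

(** Young's inequality [|f| <= f^2 + 1]; the two terms are integrable because
    the decay of [q] exceeds the weight by one power. *)
Lemma pairing_termwise N f q D (x : R) :
  `|q x| <= D / (1 + x ^+ 2) ^+ N.+1 ->
  `|f x * q x| <= D * (f x ^+ 2 / (1 + x ^+ 2) ^+ N + (1 + x ^+ 2)^-1).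
Proof.
move=> hq.
have w0 := sqrD1_gt0 x; have w1 := sqrD1_ge1 x.
set w := 1 + x ^+ 2 in w0 w1 hq *.
have wN0 : 0 < w ^+ N by rewrite exprn_gt0.
have wN1 : 1 <= w ^+ N by rewrite exprn_ege1.
have D0 : 0 <= D.
  have := le_trans (normr_ge0 _) hq.
  by rewrite ler_pdivlMr ?mul0r// exprn_gt0.
rewrite normrM; apply: (le_trans (ler_wpM2l (normr_ge0 _) hq)).
rewrite mulrCA ler_wpM2l//.
have h : `|f x| <= f x ^+ 2 + 1.
  rewrite -[X in _ <= X + 1]real_normK ?num_real//.
  by have := sqr_ge0 (`|f x| - 1); have := normr_ge0 (f x); nra.
apply: (@le_trans _ _ ((f x ^+ 2 + 1) / w ^+ N.+1)).
  by rewrite ler_wpM2r// invr_ge0 exprn_ge0// ltW.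
rewrite mulrDl mul1r lerD//.
  rewrite ler_wpM2l ?sqr_ge0// lef_pV2 ?posrE ?exprn_gt0//.
  by rewrite exprS ler_peMl// ltW.
by rewrite lef_pV2 ?posrE ?exprn_gt0// exprS ler_peMr// ltW.
Qed.

Lemma wnorm_pairing_abs N f q D K : measurable_fun setT f -> measurable_fun setT q ->
  (forall x, `|q x| <= D / (1 + x ^+ 2) ^+ N.+1) ->
  (wnorm N f <= K%:E)%E ->
  (\int[mu]_x `|(f x * q x)%:E| <= (D * (K + pi))%:E)%E.
Proof.
move=> mf mq hq hK.
have D0 : 0 <= D.
  have := le_trans (normr_ge0 _) (hq 0).
  by rewrite ler_pdivlMr ?mul0r// exprn_gt0// sqrD1_gt0.
have mfq : measurable_fun setT (fun x => f x * q x) by apply: measurable_funM.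
have mw := measurable_wnorm N mf.
apply: (@le_trans _ _ (\int[mu]_x (D%:E * ((f x ^+ 2 / (1 + x ^+ 2) ^+ N)%:E + ((1 + x ^+ 2)^-1)%:E)))%E).
  apply: ge0_le_integral => //.
  - by apply: measurableT_comp => //; exact: measurable_EFinT.
  - apply: measurable_funeM; apply: emeasurable_funD; apply: measurable_EFinT => //.
    exact: measurable_oneDsqrV.
  - move=> x _; rewrite abse_EFin -EFinD -EFinM lee_fin.
    exact: pairing_termwise.
rewrite ge0_integralZl//; last 2 first.
  - apply: emeasurable_funD; apply: measurable_EFinT => //.
    exact: measurable_oneDsqrV.
  - move=> x _; rewrite -EFinD lee_fin addr_ge0 ?wnorm_ge0_term//.
    by rewrite invr_ge0 ltW// sqrD1_gt0.
rewrite EFinM lee_wpmul2l ?lee_fin//.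
rewrite ge0_integralD//; last 4 first.
  - by move=> x _; rewrite lee_fin wnorm_ge0_term.
  - exact: measurable_EFinT.
  - by move=> x _; rewrite lee_fin invr_ge0 ltW// sqrD1_gt0.
  - apply: measurable_EFinT; exact: measurable_oneDsqrV.
rewrite integral_oneDsqrV (_ : (K + pi)%:E = K%:E + pi%:E)%E//.
exact: leeD2r.
Qed.

(** The duality between polynomially weighted L2 functions and rapidly decreasing
    ones.  The bound is affine in [K] because it comes from Young's inequality. *)
Lemma wnorm_pairing N f q D K : measurable_fun setT f -> measurable_fun setT q ->
  (forall x, `|q x| <= D / (1 + x ^+ 2) ^+ N.+1) ->
  (wnorm N f <= K%:E)%E ->
  mu.-integrable setT (EFin \o (fun x => f x * q x)) /\
  `|\int[mu]_x (f x * q x)| <= D * (K + pi).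
Proof.
move=> mf mq hq hK; have hint := wnorm_pairing_abs mf mq hq hK.
have ifq : mu.-integrable setT (EFin \o (fun x => f x * q x)).
  apply/integrableP; split; first by apply: measurable_EFinT; exact: measurable_funM.
  exact: le_lt_trans hint (ltry _).
split => //; rewrite -lee_fin; apply: le_trans hint.
by rewrite EFin_normr_Rintegral//; exact: le_abse_integral (measurable_int _ ifq).
Qed.

Lemma wnormM N j f g c : measurable_fun setT f -> measurable_fun setT g ->
  (forall x, g x ^+ 2 <= c * (1 + x ^+ 2) ^+ j) -> 0 <= c ->
  (wnorm (N + j) (fun x => g x * f x)%R <= c%:E * wnorm N f)%E.
Proof.
move=> mf mg hg c0; rewrite /wnorm -ge0_integralZl//; last 2 first.
- apply: measurable_EFinT; exact: measurable_wnorm.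
- by move=> x _; rewrite lee_fin wnorm_ge0_term.
apply: ge0_le_integral => //.
- by move=> x _; rewrite lee_fin (wnorm_ge0_term (N+j) (fun x => g x * f x)).
- by apply: measurable_EFinT; apply: measurable_wnorm; exact: measurable_funM.
- apply: measurable_funeM; apply: measurable_EFinT; exact: measurable_wnorm.
- move=> x _; rewrite -EFinM lee_fin.
have w0 := sqrD1_gt0 x.
rewrite ler_pdivrMr ?exprn_gt0// exprMn exprD.
rewrite (_ : c * _ * _ = (c * (1 + x ^+ 2) ^+ j) * f x ^+ 2); last first.
  by field; rewrite expf_neq0// gt_eqF.
by rewrite ler_wpM2r// sqr_ge0.
Qed.

Lemma wnormD N f g : measurable_fun setT f -> measurable_fun setT g ->
  (wnorm N (fun x => f x + g x)%R <= 2%:E * (wnorm N f + wnorm N g))%E.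
Proof.
move=> mf mg; rewrite /wnorm -ge0_integralD//; last 4 first.
- by move=> x _; rewrite lee_fin wnorm_ge0_term.
- apply: measurable_EFinT; exact: measurable_wnorm.
- by move=> x _; rewrite lee_fin wnorm_ge0_term.
- apply: measurable_EFinT; exact: measurable_wnorm.
have mfg : measurable_fun setT (fun x => (f x ^+ 2 / (1 + x ^+ 2) ^+ N)%:E + (g x ^+ 2 / (1 + x ^+ 2) ^+ N)%:E)%E.
  by apply: emeasurable_funD; apply: measurable_EFinT; exact: measurable_wnorm.
rewrite -ge0_integralZl//; last first.
  by move=> x _; rewrite -EFinD lee_fin addr_ge0// wnorm_ge0_term.
apply: ge0_le_integral => //.
- by move=> x _; rewrite lee_fin (wnorm_ge0_term N (fun x => f x + g x)).
- by apply: measurable_EFinT; apply: measurable_wnorm; exact: measurable_funD.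
- exact: measurable_funeM.
- move=> x _; rewrite -EFinD -EFinM lee_fin.
rewrite -mulrDl mulrA ler_wpM2r ?invr_ge0 ?exprn_ge0 ?addr_ge0 ?sqr_ge0//.
by have := sqr_ge0 (f x - g x); nra.
Qed.

Lemma le_wnorm N N' f : (N <= N')%N -> measurable_fun setT f ->
  (wnorm N' f <= wnorm N f)%E.
Proof.
move=> NN mf; apply: ge0_le_integral => //.
- by move=> x _; rewrite lee_fin wnorm_ge0_term.
- apply: measurable_EFinT; exact: measurable_wnorm.
- apply: measurable_EFinT; exact: measurable_wnorm.
- move=> x _; rewrite lee_fin ler_wpM2l ?sqr_ge0// lef_pV2 ?posrE ?exprn_gt0 ?sqrD1_gt0//.
  by rewrite ler_weXn2l// sqrD1_ge1.
Qed.

End Weighted.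

(** * Decay of Gaussians and integration by parts *)

Section GaussBounds.
Context {R : realType}.
Local Notation mu := (@lebesgue_measure R).

(** [1 + e y^2 <= exp (e y^2)] raised to the power [m], with [e = c / m]. *)
Lemma gauss_decay (c : R) (m : nat) : 0 < c ->
  exists2 D : R, 0 <= D & forall y, expR (- (c * y ^+ 2)) <= D / (1 + y ^+ 2) ^+ m.
Proof.
move=> c0.
case: m => [|m].
  exists 1 => // y; rewrite expr0 divr1 -expR0 ler_expR oppr_le0 mulr_ge0// ?sqr_ge0//.
  exact: ltW.
pose e := c / m.+1%:R.
have e0 : 0 < e by rewrite divr_gt0.
pose K := 1 + e^-1.
have K0 : 0 <= K by rewrite addr_ge0// invr_ge0 ltW.
exists (K ^+ m.+1); first by rewrite exprn_ge0.
move=> y.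
have w0 := sqrD1_gt0 y.
rewrite ler_pdivlMr ?exprn_gt0// mulrC expRN ler_pdivrMr ?expR_gt0//.
have -> : c * y ^+ 2 = (e * y ^+ 2) *+ m.+1.
  by rewrite -mulr_natr /e [RHS]mulrAC divfK ?pnatr_eq0.
rewrite -mulr_natl expRM_natl -exprMn; apply: lerXn2r.
- by rewrite nnegrE ltW.
- by rewrite nnegrE mulr_ge0// expR_ge0.
apply: (@le_trans _ _ (K * (1 + e * y ^+ 2))).
  rewrite /K mulrDr mulr1 lerD//.
    by rewrite lerDl invr_ge0 ltW.
  have -> : (1 + e^-1) * (e * y ^+ 2) = e * y ^+ 2 + y ^+ 2 by field; rewrite gt_eqF.
  by rewrite lerDr mulr_ge0 ?sqr_ge0// ltW.
by rewrite ler_wpM2l// expR_ge1Dx.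
Qed.

Lemma poly_growth (p : {poly R}) :
  exists2 D : R, 0 <= D & exists m : nat, forall y, `|p.[y]| <= D * (1 + y ^+ 2) ^+ m.
Proof.
elim/poly_ind: p => [|p c [D D0 [m hm]]].
  by exists 0 => //; exists 0%N => y; rewrite horner0 normr0 mul0r.
exists (D + `|c|); first by rewrite addr_ge0.
exists m.+1 => y; rewrite hornerMXaddC.
have w1 := sqrD1_ge1 y.
apply: (le_trans (ler_normD _ _)); rewrite mulrDl; apply: lerD; last first.
  by rewrite ler_peMr// exprn_ege1.
rewrite normrM exprSr mulrA; apply: ler_pM => //.
by rewrite -[X in _ <= 1 + X]real_normK ?num_real//; have := sqr_ge0 (`|y| - 1); nra.
Qed.

Lemma poly_gauss_decay (p : {poly R}) (c : R) (N : nat) : 0 < c ->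
  exists2 D : R, 0 <= D &
    forall y, `|p.[y] * expR (- (c * y ^+ 2))| <= D / (1 + y ^+ 2) ^+ N.
Proof.
move=> c0; have [D D0 [m hm]] := poly_growth p.
have [E E0 hE] := gauss_decay (m + N) c0.
exists (D * E); first by rewrite mulr_ge0.
move=> y; rewrite normrM (ger0_norm (expR_ge0 _)).
have w0 := sqrD1_gt0 y.
apply: (le_trans (ler_pM (normr_ge0 _) (expR_ge0 _) (hm y) (hE y))).
rewrite exprD le_eqVlt; apply/orP; left; apply/eqP; field.
by rewrite !expf_neq0// gt_eqF.
Qed.

Lemma integrable_decay (f : R -> R) (D : R) : measurable_fun setT f ->
  (forall y, `|f y| <= D / (1 + y ^+ 2)) -> mu.-integrable setT (EFin \o f).
Proof.
move=> mf hf.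
apply: (@le_integrable _ _ _ mu setT measurableT _ (fun y => (D%:E * (EFin \o (fun y : R => ((1 + y ^+ 2)^-1)%R)) y)%E)).
- exact: measurable_EFinT.
- move=> y _; rewrite /= lee_fin.
  by apply: (le_trans (hf y)); exact: ler_norm.
- exact: integrableZl integrable_oneDsqrV.
Qed.

Lemma peetre_unit (h y : R) : `|h| <= 1 -> (1 + (y + h) ^+ 2)^-1 <= 3 / (1 + y ^+ 2).
Proof.
move=> h1; rewrite ler_pdivlMr ?sqrD1_gt0// mulrC ler_pdivrMr ?sqrD1_gt0//.
have : h ^+ 2 <= 1 by rewrite -real_normK ?num_real// expr_le1.
by have := sqr_ge0 (y + 2 * h); nra.
Qed.

(** Differentiation under the integral sign on a unit neighbourhood, stated with
    [is_derive] on both sides. *)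
Lemma derive_Rintegral (f f' : R -> R -> R) (g : R -> R) (a : R) :
  (forall h y : R, is_derive h (1:R) (f ^~ y) (f' h y)) ->
  (forall h, mu.-integrable setT (EFin \o f h)) ->
  mu.-integrable setT (EFin \o g) ->
  (forall h y, `|h - a| <= 1 -> `|f' h y| <= g y) ->
  is_derive a (1:R) (fun h => \int[mu]_y f h y) (\int[mu]_y f' a y).
Proof.
move=> df fi gi fg.
have df1 h y : partial1of2 f h y = f' h y.
  by rewrite /partial1of2 derive1E; apply: (@derive_val _ _ _ _ _ _ _ (df h y)).
have Ia : [set` `]a - 1, a + 1[ ] a.
  by rewrite /= in_itv/= ltrBlDr ltrDl ltr01.
have dom : forall x y, [set` `]a - 1, a + 1[ ] x -> [set: R] y -> `|partial1of2 f x y| <= g y.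
  move=> x y /= xI _; rewrite df1 fg// ler_norml.
  by move: xI; rewrite in_itv/= => /andP[? ?]; apply/andP; split; lra.
have g0 y : 0 <= g y by apply: le_trans (fg a y _) => //; rewrite subrr normr0.
have der : forall x y, [set` `]a - 1, a + 1[ ] x -> [set: R] y -> derivable (f ^~ y) x 1.
  by move=> x y _ _; exact: (@ex_derive _ _ _ _ _ _ _ (df x y)).
have fi' x : [set` `]a - 1, a + 1[ ] x -> mu.-integrable setT (EFin \o f x) by [].
apply: DeriveDef.
  exact: (@derivable_under_integral _ _ _ _ _ _ measurableT _ _ _ Ia fi' der g g0 gi dom).
rewrite -derive1E (@differentiation_under_integral _ _ _ _ _ _ measurableT _ _ _ Ia fi' der g g0 gi dom).
by apply: eq_Rintegral => y _; rewrite df1.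
Qed.

(** Translation invariance makes [h |-> \int F (y + h)] constant, and [\int F']
    is its derivative. *)
Lemma Rintegral_derivative (F F' : R -> R) (D : R) :
  (forall y : R, is_derive y (1:R) F (F' y)) ->
  (forall y, `|F y| <= D / (1 + y ^+ 2)) ->
  (forall y, `|F' y| <= D / (1 + y ^+ 2)) ->
  \int[mu]_y F' y = 0.
Proof.
move=> dF bF bF'.
have D0 : 0 <= D.
  by have := le_trans (normr_ge0 _) (bF 0); rewrite pmulr_lge0// invr_gt0 sqrD1_gt0.
have cF : continuous F.
  move=> x; apply: differentiable_continuous; apply/derivable1_diffP.
  exact: (@ex_derive _ _ _ _ _ _ _ (dF x)).
have mF : measurable_fun setT F by exact: continuous_measurable_fun.
have iF : mu.-integrable setT (EFin \o F) by exact: integrable_decay bF.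
pose f (h y : R) := F (y + h).
have df h y : is_derive h (1:R) (f ^~ y) (F' (y + h)).
  rewrite /f; eapply is_derive_eq; first eapply (@der_comp _ F (fun h => y + h)).
  - exact: dF.
  - deriv_tac.
  - by rewrite add0r mulr1.
have bF'' h y : `|h - 0| <= 1 -> `|F' (y + h)| <= D * (3 / (1 + y ^+ 2)).
  rewrite subr0 => h1; apply: (le_trans (bF' _)); rewrite ler_wpM2l//.
  exact: peetre_unit.
have gi : mu.-integrable setT (EFin \o (fun y : R => D * (3 / (1 + y ^+ 2)))).
  apply: (@integrable_decay _ (D * 3)).
    do 2 apply: measurable_funM => //; exact: measurable_oneDsqrV.
  move=> y; rewrite mulrA ger0_norm// !mulr_ge0// invr_ge0 ltW//.
  exact: sqrD1_gt0.
have := @derive_Rintegral f (fun h y => F' (y + h)) _ 0 df (fun h => integrable_shift h iF) gi bF''.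
rewrite (_ : (fun h => _) = fun=> \int[mu]_y F y); last first.
  by apply/funext => h; rewrite Rintegral_shift.
move=> /(@derive_val _ _ _ _ _ _ _); rewrite derive_cst => /esym.
by under eq_Rintegral do rewrite addr0.
Qed.

End GaussBounds.

(** * Cosine and sine transforms of polynomials times a Gaussian *)

Section GaussTransform.
Context {R : realType}.
Local Notation mu := (@lebesgue_measure R).
Variable a : R.
Hypothesis a0 : 0 < a.
Implicit Types (p q : {poly R}).

Definition gauss (y : R) := expR (- (a * y ^+ 2)).

Lemma is_derive_gauss y : is_derive y (1:R) gauss (- (2 * a * y) * gauss y).
Proof.
rewrite /gauss; deriv => /=.
by ring.
Qed.

Lemma continuous_trig (f : R -> R) (z b : R) p : continuous f ->
  continuous (fun y => f (z * y + b) * p.[y] * gauss y).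
Proof.
move=> cf x; apply: cvgM; first apply: cvgM.
- apply: (@continuous_comp _ _ _ (fun y => z * y + b) f); last exact: cf.
  by apply: cvgD; [apply: cvgMl_tmp; exact: cvg_id|exact: cvg_cst].
- exact: continuous_horner.
- exact: der_continuous is_derive_gauss x.
Qed.

Lemma trig_decay (f : R -> R) (z b : R) p N : (forall x, `|f x| <= 1) ->
  exists2 D, 0 <= D & forall y, `|f (z * y + b) * p.[y] * gauss y| <= D / (1 + y ^+ 2) ^+ N.
Proof.
move=> f1; have [D D0 h] := poly_gauss_decay p N a0; exists D => // y.
rewrite -mulrA normrM; apply: le_trans (h y).
by rewrite -[leRHS]mul1r ler_wpM2r.
Qed.

Lemma trig_integrable (f : R -> R) (z b : R) p : continuous f -> (forall x, `|f x| <= 1) ->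
  mu.-integrable setT (EFin \o (fun y => f (z * y + b) * p.[y] * gauss y)).
Proof.
move=> cf f1; have [D D0 h] := @trig_decay f z b p 1 f1.
apply: (@integrable_decay _ _ D); last by move=> y; have := h y; rewrite expr1.
by apply: continuous_measurable_fun; exact: continuous_trig.
Qed.

Definition cos_transform p (z : R) := \int[mu]_y (cos (z * y) * p.[y] * gauss y).
Definition sin_transform p (z : R) := \int[mu]_y (sin (z * y) * p.[y] * gauss y).

Lemma cos_integrable p z : mu.-integrable setT (EFin \o (fun y => cos (z * y) * p.[y] * gauss y)).
Proof.
have := @trig_integrable cos z 0 p (@continuous_cos R) (@cos_max R).
by under eq_fun do rewrite addr0.
Qed.

Lemma sin_integrable p z : mu.-integrable setT (EFin \o (fun y => sin (z * y) * p.[y] * gauss y)).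
Proof.
have := @trig_integrable sin z 0 p (@continuous_sin R) (@sin_max R).
by under eq_fun do rewrite addr0.
Qed.

(** [(p g)' = gauss_deriv p g] for the Gaussian [g (y) = exp (- a y^2)]. *)
Definition gauss_deriv p : {poly R} := p^`() - (2 * a)%:P * 'X * p.

Lemma cos_transform_linear p q (c d z : R) :
  cos_transform (c *: p + d *: q) z = c * cos_transform p z + d * cos_transform q z.
Proof.
rewrite /cos_transform -!RintegralZl//; [|exact: cos_integrable..].
rewrite -RintegralD//.
- by apply: eq_Rintegral => y _; rewrite hornerD !hornerZ; ring.
- exact: integrableZl (cos_integrable p z).
- exact: integrableZl (cos_integrable q z).
Qed.

Lemma sin_transform_linear p q (c d z : R) :
  sin_transform (c *: p + d *: q) z = c * sin_transform p z + d * sin_transform q z.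
Proof.
rewrite /sin_transform -!RintegralZl//; [|exact: sin_integrable..].
rewrite -RintegralD//.
- by apply: eq_Rintegral => y _; rewrite hornerD !hornerZ; ring.
- exact: integrableZl (sin_integrable p z).
- exact: integrableZl (sin_integrable q z).
Qed.

Lemma cos_transformZ p (c z : R) : cos_transform (c *: p) z = c * cos_transform p z.
Proof. by have := cos_transform_linear p 0 c 0 z; rewrite scaler0 addr0 mul0r addr0. Qed.

Lemma sin_transformZ p (c z : R) : sin_transform (c *: p) z = c * sin_transform p z.
Proof. by have := sin_transform_linear p 0 c 0 z; rewrite scaler0 addr0 mul0r addr0. Qed.

(** Integration by parts; together with [sin_transform_deriv] it says that
    [d/dy] becomes multiplication by the frequency. *)
Lemma cos_transform_deriv p z :
  cos_transform (gauss_deriv p) z = z * sin_transform p z.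
Proof.
have [D1 D10 h1] := @trig_decay cos z 0 p 1 (@cos_max R).
have [D2 D20 h2] := @trig_decay cos z 0 (gauss_deriv p) 1 (@cos_max R).
have [D3 D30 h3] := @trig_decay sin z 0 p 1 (@sin_max R).
pose D := D1 + (D2 + `|z| * D3).
have w0 (y : R) : 0 <= (1 + y ^+ 2)^-1 by rewrite invr_ge0 ltW// sqrD1_gt0.
have bF y : `|cos (z * y) * p.[y] * gauss y| <= D / (1 + y ^+ 2).
  have := h1 y; rewrite expr1 addr0 => /le_trans; apply.
  by rewrite ler_wpM2r// lerDl addr_ge0// mulr_ge0.
pose F' y := cos (z * y) * (gauss_deriv p).[y] * gauss y - z * (sin (z * y) * p.[y] * gauss y).
have bF' y : `|F' y| <= D / (1 + y ^+ 2).
  apply: (le_trans (ler_normB _ _)).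
  have := h2 y; have := h3 y; rewrite !expr1 !addr0 => h3y h2y.
  apply: (@le_trans _ _ ((D2 + `|z| * D3) / (1 + y ^+ 2))).
    by rewrite mulrDl; apply: lerD => //; rewrite normrM -[leRHS]mulrA ler_wpM2l.
  by rewrite ler_wpM2r// lerDr.
have dF (y : R) : is_derive y (1:R) (fun y => cos (z * y) * p.[y] * gauss y) (F' y).
  have dg := is_derive_gauss.
  deriv; first exact: is_derive_gauss.
  by rewrite /F' /gauss_deriv !hornerE /=; ring.
have := Rintegral_derivative dF bF bF'.
rewrite /F' RintegralB//; last 2 first.
- exact: cos_integrable.
- exact: integrableZl (sin_integrable p z).
rewrite RintegralZl//; last exact: sin_integrable.
by move/eqP; rewrite subr_eq0 => /eqP.
Qed.

Lemma sin_transform_deriv p z :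
  sin_transform (gauss_deriv p) z = - (z * cos_transform p z).
Proof.
have [D1 D10 h1] := @trig_decay sin z 0 p 1 (@sin_max R).
have [D2 D20 h2] := @trig_decay sin z 0 (gauss_deriv p) 1 (@sin_max R).
have [D3 D30 h3] := @trig_decay cos z 0 p 1 (@cos_max R).
pose D := D1 + (D2 + `|z| * D3).
have w0 (y : R) : 0 <= (1 + y ^+ 2)^-1 by rewrite invr_ge0 ltW// sqrD1_gt0.
have bF y : `|sin (z * y) * p.[y] * gauss y| <= D / (1 + y ^+ 2).
  have := h1 y; rewrite expr1 addr0 => /le_trans; apply.
  by rewrite ler_wpM2r// lerDl addr_ge0// mulr_ge0.
pose F' y := sin (z * y) * (gauss_deriv p).[y] * gauss y + z * (cos (z * y) * p.[y] * gauss y).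
have bF' y : `|F' y| <= D / (1 + y ^+ 2).
  apply: (le_trans (ler_normD _ _)).
  have := h2 y; have := h3 y; rewrite !expr1 !addr0 => h3y h2y.
  apply: (@le_trans _ _ ((D2 + `|z| * D3) / (1 + y ^+ 2))).
    by rewrite mulrDl; apply: lerD => //; rewrite normrM -[leRHS]mulrA ler_wpM2l.
  by rewrite ler_wpM2r// lerDr.
have dF (y : R) : is_derive y (1:R) (fun y => sin (z * y) * p.[y] * gauss y) (F' y).
  deriv; first exact: is_derive_gauss.
  by rewrite /F' /gauss_deriv !hornerE /=; ring.
have := Rintegral_derivative dF bF bF'.
rewrite /F' RintegralD//; last 2 first.
- exact: sin_integrable.
- exact: integrableZl (cos_integrable p z).
rewrite RintegralZl//; last exact: cos_integrable.
by move/eqP; rewrite addr_eq0 => /eqP.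
Qed.

Lemma sin_transform1 z : sin_transform 1 z = 0.
Proof.
have : sin_transform 1 z = - sin_transform 1 z.
  rewrite {1}/sin_transform -Rintegral_reflection; last first.
    exact: integrable_measurable (sin_integrable 1 z).
  rewrite -[RHS]mulN1r /sin_transform -RintegralZl//; last exact: sin_integrable.
  by apply: eq_Rintegral => y _; rewrite /gauss sqrrN mulrN sinN !hornerC; ring.
by move=> h; lra.
Qed.

Lemma gauss_deriv1 : gauss_deriv 1 = - (2 * a) *: 'X.
Proof. by rewrite /gauss_deriv derivC mulr1 sub0r scaleNr mul_polyC. Qed.

Lemma cos_transformX z : cos_transform 'X z = 0.
Proof.
have := cos_transform_deriv 1 z.
rewrite gauss_deriv1 cos_transformZ sin_transform1 mulr0 => /eqP.
by rewrite mulf_eq0 oppr_eq0 mulf_eq0 pnatr_eq0 (gt_eqF a0)/= => /eqP.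
Qed.

(** Up to the factor [- 2 a], ['X] is the Gaussian derivative of [1].  This
    spares computing the transform of [y exp (- a y^2)] directly. *)
Lemma sin_transformX z : sin_transform 'X z = z / (2 * a) * cos_transform 1 z.
Proof.
have := sin_transform_deriv 1 z.
rewrite gauss_deriv1 sin_transformZ mulNr => /oppr_inj h.
apply: (@mulfI _ (2 * a)); first by rewrite mulf_neq0 ?gt_eqF.
by rewrite h; field; rewrite gt_eqF.
Qed.

Lemma is_derive_cos_transform p z :
  is_derive z (1:R) (cos_transform p) (- sin_transform ('X * p) z).
Proof.
have one1 : forall x : R, `|(fun=> 1) x : R| <= 1 by move=> x; rewrite normr1.
have [D D0 h] := @trig_decay (fun=> 1) 0 0 ('X * p) 1 one1.
have gi : mu.-integrable setT (EFin \o (fun y => D / (1 + y ^+ 2))).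
  apply: (@integrable_decay _ _ D).
    by apply: measurable_funM => //; exact: measurable_oneDsqrV.
  move=> y; rewrite ger0_norm// mulr_ge0// invr_ge0 ltW//.
  exact: sqrD1_gt0.
pose f z y := cos (z * y) * p.[y] * gauss y.
pose f' z y := - (sin (z * y) * ('X * p).[y] * gauss y).
have df (u y : R) : is_derive u (1:R) (f ^~ y) (f' u y).
  by rewrite /f; deriv; rewrite /f' !hornerE /=; ring.
have := @derive_Rintegral _ f f' _ z df (cos_integrable p) gi _.
have -> : \int[mu]_y f' z y = - sin_transform ('X * p) z.
  rewrite -[RHS]mulN1r /sin_transform -RintegralZl//; last exact: sin_integrable.
  by apply: eq_Rintegral => y _; rewrite mulN1r.
apply => u y _; rewrite normrN.
have := h y; rewrite expr1 mul1r; apply: le_trans.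
rewrite -mulrA normrM -[leRHS]mul1r ler_wpM2r//.
exact: sin_max.
Qed.

Lemma is_derive_sin_transform p z :
  is_derive z (1:R) (sin_transform p) (cos_transform ('X * p) z).
Proof.
have one1 : forall x : R, `|(fun=> 1) x : R| <= 1 by move=> x; rewrite normr1.
have [D D0 h] := @trig_decay (fun=> 1) 0 0 ('X * p) 1 one1.
have gi : mu.-integrable setT (EFin \o (fun y => D / (1 + y ^+ 2))).
  apply: (@integrable_decay _ _ D).
    by apply: measurable_funM => //; exact: measurable_oneDsqrV.
  move=> y; rewrite ger0_norm// mulr_ge0// invr_ge0 ltW//.
  exact: sqrD1_gt0.
pose f z y := sin (z * y) * p.[y] * gauss y.
pose f' z y := cos (z * y) * ('X * p).[y] * gauss y.
have df (u y : R) : is_derive u (1:R) (f ^~ y) (f' u y).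
  by rewrite /f; deriv; rewrite /f' !hornerE /=; ring.
apply: (@derive_Rintegral _ f f' _ z df (sin_integrable p) gi _) => u y _.
have := h y; rewrite expr1 mul1r; apply: le_trans.
rewrite /f' -mulrA normrM -[leRHS]mul1r ler_wpM2r//.
exact: cos_max.
Qed.

Lemma continuous_cos_transform p : continuous (cos_transform p).
Proof. exact: der_continuous (is_derive_cos_transform p). Qed.

Lemma continuous_sin_transform p : continuous (sin_transform p).
Proof. exact: der_continuous (is_derive_sin_transform p). Qed.

(** The transform [g] of the Gaussian solves [g' = - z / (2 a) g], so its
    product with [exp (z^2 / (4 a))] is constant. *)
Lemma cos_transform1 z : cos_transform 1 z = cos_transform 1 0 * expR (- (z ^+ 2 / (4 * a))).
Proof.
pose H z := cos_transform 1 z * expR (z ^+ 2 * (4 * a)^-1).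
have dH (u : R) : is_derive u (1:R) H 0.
  have d1 := is_derive_cos_transform 1 u.
  rewrite mulr1 sin_transformX in d1; rewrite /H.
  deriv.
  rewrite /=; field; by rewrite gt_eqF.
have := is_derive_0_is_cst z 0 dH.
rewrite /H expr0n mul0r expR0 mulr1 => <-.
by rewrite expRN mulfK// gt_eqF// expR_gt0.
Qed.

Lemma cos_transform1_gt0 : 0 < cos_transform 1 0.
Proof.
have ei : mu.-integrable setT (EFin \o gauss).
  have := cos_integrable 1 0; congr (mu.-integrable _ _).
  by apply/funext => y /=; rewrite mul0r cos0 hornerC !mul1r.
have mg : measurable_fun setT (EFin \o gauss) by exact: measurable_int ei.
suff : (0 < \int[mu]_y (gauss y)%:E)%E.
  rewrite /cos_transform; under eq_Rintegral => y _ do rewrite mul0r cos0 hornerC !mul1r.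
  rewrite /Rintegral => h; rewrite fine_gt0// h/=.
  by have := integrable_lty measurableT ei.
apply: (@lt_le_trans _ _ (\int[mu]_(y in `[(0:R)%R, (1:R)%R]) (gauss y)%:E)%E); last first.
  by apply: ge0_subset_integral => // y _; rewrite lee_fin expR_ge0.
apply: (@lt_le_trans _ _ (\int[mu]_(y in `[(0:R)%R, (1:R)%R]) (expR (- a)%R)%:E)%E).
  rewrite integral_cst//= lebesgue_measure_itv/= lte_fin ltr01 oppr0 adde0 mule1.
  by rewrite lte_fin expR_gt0.
apply: ge0_le_integral => //.
- exact: measurable_funS mg.
- move=> y /=; rewrite in_itv/= => /andP[y0 y1]; rewrite lee_fin ler_expR lerN2.
  by rewrite -[leRHS]mulr1 ler_wpM2l ?(ltW a0)// expr_le1.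
Qed.

End GaussTransform.

(** * Gaussian wave packets on the cylinder *)

Section TestFunctions.
Context {R : realType}.
Local Notation mu := (@lebesgue_measure R).
Variables (a k b : R).
Hypothesis a0 : 0 < a.
Local Notation gauss := (gauss a).
Implicit Types (p q : {poly R}).

Let hornE := (hornerZ, hornerD, hornerN, hornerM, hornerX, hornerC, hornerXn).

(** A class of real test functions stable under [d/dx], [d/dy] and multiplication
    by [y], each acting linearly on the pair of polynomials. *)
Definition gtest p q (x y : R) : R :=
  (cos (k * x + b * y) * p.[y] + sin (k * x + b * y) * q.[y]) * gauss y.

Lemma is_derive_gtest_x p q x y :
  is_derive x (1:R) ((gtest p q) ^~ y) (gtest (k *: q) (- k *: p) x y).
Proof.
rewrite /gtest; deriv; rewrite !hornE /=. ring.
Qed.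

Lemma is_derive_gtest_y p q x y :
  is_derive y (1:R) (gtest p q x)
    (gtest (gauss_deriv a p + b *: q) (gauss_deriv a q - b *: p) x y).
Proof.
have dg := is_derive_gauss a y.
rewrite /gtest; deriv; rewrite /gauss_deriv !hornE /=; ring.
Qed.

Lemma partial_x_gtest p q : partial_x (gtest p q) = gtest (k *: q) (- k *: p).
Proof.
apply/funext => x; apply/funext => y; rewrite /partial_x derive1E.
exact: (@derive_val _ _ _ _ _ _ _ (is_derive_gtest_x p q x y)).
Qed.

Lemma partial_y_gtest p q : partial_y (gtest p q) =
  gtest (gauss_deriv a p + b *: q) (gauss_deriv a q - b *: p).
Proof.
apply/funext => x; apply/funext => y; rewrite /partial_y derive1E.
exact: (@derive_val _ _ _ _ _ _ _ (is_derive_gtest_y p q x y)).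
Qed.

Lemma muly_gtest p q : (fun x y => y * gtest p q x y) = gtest ('X * p) ('X * q).
Proof.
by apply/funext => x; apply/funext => y; rewrite /gtest !hornE; ring.
Qed.

Lemma partials_gtest w p q : exists p' q', partials w (gtest p q) = gtest p' q'.
Proof.
elim: w => [|[] w [p' [q' IH]]] /=; first by exists p, q.
- by rewrite IH partial_x_gtest; eexists; eexists.
- by rewrite IH partial_y_gtest; eexists; eexists.
Qed.

(** Periodicity in [x], hence [k] in the lattice of wavenumbers, is what makes a
    wave packet a function on the cylinder. *)
Lemma trig_period (m : int) (x : R) :
  (cos (x + 2 * pi * m%:~R) = cos x) * (sin (x + 2 * pi * m%:~R) = sin x).
Proof.
have nat_case (n : nat) (y : R) : (cos (y + 2 * pi * n%:R) = cos y) * (sin (y + 2 * pi * n%:R) = sin y).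
  elim: n y => [|n IH] y; first by rewrite mulr0 addr0.
  have -> : y + 2 * pi * n.+1%:R = (y + 2 * pi * n%:R) + pi *+ 2.
    by rewrite -natr1 -mulr_natr; ring.
  by rewrite cosD2pi sinD2pi; exact: IH.
case: m => n; first exact: nat_case.
have := nat_case n.+1 (x + 2 * pi * (Negz n)%:~R).
have -> : x + 2 * pi * (Negz n)%:~R + 2 * pi * n.+1%:R = x.
  by rewrite NegzE mulrNz; ring.
by move=> [-> ->].
Qed.

Lemma schwartz_gtest (n0 : int) p q : k = wavenumber n0 -> schwartz (gtest p q).
Proof.
move=> kn0; split.
- move=> x y; rewrite /gtest.
  have -> : k * (x + 1) + b * y = k * x + b * y + 2 * pi * n0%:~R.
    by rewrite kn0 /wavenumber; ring.
  by rewrite !trig_period.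
- move=> w x y; have [p' [q' ->]] := partials_gtest w p q; split.
  + exact: (@ex_derive _ _ _ _ _ _ _ (is_derive_gtest_x p' q' x y)).
  + exact: (@ex_derive _ _ _ _ _ _ _ (is_derive_gtest_y p' q' x y)).
- move=> w j; have [p' [q' ->]] := partials_gtest w p q.
  have [D1 D10 h1] := poly_gauss_decay ('X^j * p') 0 a0.
  have [D2 D20 h2] := poly_gauss_decay ('X^j * q') 0 a0.
  exists (D1 + D2) => x y.
  have -> : y ^+ j * gtest p' q' x y =
    cos (k * x + b * y) * (('X^j * p').[y] * expR (- (a * y ^+ 2))) +
    sin (k * x + b * y) * (('X^j * q').[y] * expR (- (a * y ^+ 2))).
    by rewrite /gtest /gauss !hornE; ring.
  have := h1 y; have := h2 y; rewrite !expr0 !divr1 => h2y h1y.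
  apply: (le_trans (ler_normD _ _)); apply: lerD; rewrite normrM.
    by rewrite -[leRHS]mul1r; apply: ler_pM => //; exact: cos_max.
  by rewrite -[leRHS]mul1r; apply: ler_pM => //; exact: sin_max.
Qed.

(** The transform of [gtest p q] at frequency [b + z] is, up to a constant,
    [htest_c p q z - i htest_s p q z]. *)
Definition htest_c p q z : R := cos_transform a p z - sin_transform a q z.
Definition htest_s p q z : R := cos_transform a q z + sin_transform a p z.

(** [d/dx] and [d/dy] act on the transform as multiplication by [i k] and by
    [i (z + b)], on real and imaginary parts. *)
Lemma htest_c_dx p q z : htest_c (k *: q) (- k *: p) z = k * htest_s p q z.
Proof. by rewrite /htest_c /htest_s cos_transformZ// sin_transformZ//; ring. Qed.

Lemma htest_s_dx p q z : htest_s (k *: q) (- k *: p) z = - (k * htest_c p q z).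
Proof. by rewrite /htest_c /htest_s cos_transformZ// sin_transformZ//; ring. Qed.

Lemma htest_c_dy p q z :
  htest_c (gauss_deriv a p + b *: q) (gauss_deriv a q - b *: p) z = (z + b) * htest_s p q z.
Proof.
rewrite /htest_c /htest_s -[gauss_deriv a p]scale1r -[gauss_deriv a q]scale1r -scaleNr.
rewrite cos_transform_linear// sin_transform_linear// cos_transform_deriv// sin_transform_deriv//.
ring.
Qed.

Lemma htest_s_dy p q z :
  htest_s (gauss_deriv a p + b *: q) (gauss_deriv a q - b *: p) z = - ((z + b) * htest_c p q z).
Proof.
rewrite /htest_c /htest_s -[gauss_deriv a p]scale1r -[gauss_deriv a q]scale1r -scaleNr.
rewrite cos_transform_linear// sin_transform_linear// cos_transform_deriv// sin_transform_deriv//.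
ring.
Qed.

Lemma inner_c p q (u z : R) :
  \int[mu]_y ((cos (u + z * y) * p.[y] - sin (u + z * y) * q.[y]) * gauss y)
  = cos u * htest_c p q z - sin u * htest_s p q z.
Proof.
have ci := cos_integrable a0; have si := sin_integrable a0.
transitivity (\int[mu]_y ((cos u * (cos (z * y) * p.[y] * gauss y) - sin u * (sin (z * y) * p.[y] * gauss y))
  - (sin u * (cos (z * y) * q.[y] * gauss y) + cos u * (sin (z * y) * q.[y] * gauss y)))).
  by apply: eq_Rintegral => y _; rewrite cosD sinD; ring.
rewrite RintegralB//; last 2 first.
- apply: (@integrableB _ _ _ mu setT measurableT (fun y => (cos u * (cos (z * y) * p.[y] * gauss y))%:E) (fun y => (sin u * (sin (z * y) * p.[y] * gauss y))%:E)).
  + exact: integrableZl (ci p z).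
  + exact: integrableZl (si p z).
- apply: (@integrableD _ _ _ mu setT measurableT (fun y => (sin u * (cos (z * y) * q.[y] * gauss y))%:E) (fun y => (cos u * (sin (z * y) * q.[y] * gauss y))%:E)).
  + exact: integrableZl (ci q z).
  + exact: integrableZl (si q z).
rewrite RintegralB//; last 2 first.
- exact: integrableZl (ci p z).
- exact: integrableZl (si p z).
rewrite RintegralD//; last 2 first.
- exact: integrableZl (ci q z).
- exact: integrableZl (si q z).
rewrite !RintegralZl//.
by rewrite /htest_c /htest_s /cos_transform /sin_transform; ring.
Qed.

Lemma inner_integrable p q (u z : R) :
  mu.-integrable setT (EFin \o (fun y => (cos (u + z * y) * p.[y] - sin (u + z * y) * q.[y]) * gauss y)).
Proof.
have hp := @trig_integrable _ a a0 cos z u p (@continuous_cos R) (@cos_max R).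
have hq := @trig_integrable _ a a0 sin z u q (@continuous_sin R) (@sin_max R).
have := integrableB measurableT hp hq; congr (mu.-integrable _ _).
apply/funext => y /=; rewrite -EFinB; congr EFin.
by rewrite [z * y + u]addrC; ring.
Qed.

Lemma integral_period_trig (m : int) (A B : R) :
  \int[mu]_(x in `[0, 1]) (A * cos (2 * pi * m%:~R * x) - B * sin (2 * pi * m%:~R * x))
  = (m == 0)%:R * A.
Proof.
have [->|m0] := eqVneq m 0.
  rewrite mul1r; under eq_Rintegral => x _ do rewrite mulr0 mul0r cos0 sin0 mulr0 subr0 mulr1.
  by rewrite Rintegral_cst//= lebesgue_measure_itv/= lte_fin ltr01 oppr0 adde0 mulr1.
rewrite mul0r.
set w := 2 * pi * m%:~R.
have w0 : w != 0 by rewrite !mulf_neq0 ?intr_eq0// gt_eqF// pi_gt0.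
pose F x := (A * sin (w * x) + B * cos (w * x)) / w.
have dF (x : R) : is_derive x (1:R) F (A * cos (w * x) - B * sin (w * x)).
  by rewrite /F; deriv; rewrite /=; field.
have cf : continuous (fun x => A * cos (w * x) - B * sin (w * x)).
  apply: (@der_continuous _ _ (fun x => - A * w * sin (w * x) - B * w * cos (w * x))) => x.
  by deriv; rewrite /=; ring.
rewrite /Rintegral (@continuous_FTC2 _ _ F)//.
- rewrite /F /= !mulr0 mulr1.
  have [hc hs] := trig_period m 0.
  by rewrite add0r -/w in hc hs; rewrite hc hs subrr.
- exact: continuous_subspaceT.
- split.
  + by move=> x _; exact: (@ex_derive _ _ _ _ _ _ _ (dF x)).
  + exact/cvg_at_right_filter/(der_continuous dF).
  + exact/cvg_at_left_filter/(der_continuous dF).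
- by move=> x _; rewrite derive1E; exact: (@derive_val _ _ _ _ _ _ _ (dF x)).
Qed.

Lemma trig_period_integrable (A B w1 w2 : R) :
  mu.-integrable `[0, 1] (EFin \o (fun x => A * cos (w1 * x) - B * sin (w2 * x))).
Proof.
have df (x : R) : is_derive x (1:R) (fun x => A * cos (w1 * x) - B * sin (w2 * x))
    (- A * w1 * sin (w1 * x) - B * w2 * cos (w2 * x)).
  by deriv; rewrite /=; ring.
apply: continuous_compact_integrable; first exact: segment_compact.
by apply: continuous_subspaceT; exact: der_continuous df.
Qed.

(** A real plane wave carries the two frequencies [n0] and [- n0].  The mixed
    trigonometric products split into sums, and the integral over a period in
    [x] selects [n = n0] in one of them and [n = - n0] in the other. *)
Lemma fourier_gtest (n0 : int) p q (n : int) (eta : R) : k = wavenumber n0 ->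
  fourier (gtest p q) n eta = ((2 * pi)^-1)%:C * Complex
    (2^-1 * ((n == n0)%:R * htest_c p q (eta - b)
             + (n == - n0)%:R * htest_c p q (- eta - b)))
    (- (2^-1 * ((n == n0)%:R * htest_s p q (eta - b)
                - (n == - n0)%:R * htest_s p q (- eta - b)))).
Proof.
move=> kn0.
pose w := (wavenumber n : R).
have mw1 (x : R) : (w - k) * x = 2 * pi * (n - n0)%:~R * x.
  by rewrite /w kn0 /wavenumber rmorphB/=; ring.
have mw2 (x : R) : (- w - k) * x = 2 * pi * (- n - n0)%:~R * x.
  by rewrite /w kn0 /wavenumber rmorphB rmorphN/=; ring.
have d2 : (- n - n0 == 0) = (n == - n0) by rewrite -opprD oppr_eq0 addr_eq0.
have ic := inner_integrable p q.
have ics : forall u z, mu.-integrable setT (EFin \o (fun y => (cos (u + z * y) * q.[y] - sin (u + z * y) * (- p).[y]) * gauss y)).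
  by move=> u z; exact: inner_integrable.
rewrite /fourier; congr (_ * Complex _ _).
- transitivity (\int[mu]_(x in `[0, 1])
    ((2^-1 * htest_c p q (eta - b) * cos (2 * pi * (n - n0)%:~R * x) - 2^-1 * htest_s p q (eta - b) * sin (2 * pi * (n - n0)%:~R * x))
    + (2^-1 * htest_c p q (- eta - b) * cos (2 * pi * (- n - n0)%:~R * x) - 2^-1 * htest_s p q (- eta - b) * sin (2 * pi * (- n - n0)%:~R * x)))).
    apply: eq_Rintegral => x _.
    transitivity (2^-1 * (\int[mu]_y ((cos ((w - k) * x + (eta - b) * y) * p.[y] - sin ((w - k) * x + (eta - b) * y) * q.[y]) * gauss y)
      + \int[mu]_y ((cos ((- w - k) * x + (- eta - b) * y) * p.[y] - sin ((- w - k) * x + (- eta - b) * y) * q.[y]) * gauss y))).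
      rewrite -RintegralD//.
      rewrite -RintegralZl//; last exact: integrable_addr.
      apply: eq_Rintegral => y _; rewrite /gtest -/w.
      have -> : (w - k) * x + (eta - b) * y = (w * x + eta * y) - (k * x + b * y) by ring.
      have -> : (- w - k) * x + (- eta - b) * y = - ((w * x + eta * y) + (k * x + b * y)) by ring.
      move: (w * x + eta * y) (k * x + b * y) => A B.
      by rewrite cosN sinN cosB sinB cosD sinD; field.
    by rewrite !inner_c !mw1 !mw2; ring.
  rewrite RintegralD//; [|exact: trig_period_integrable..].
  by rewrite !integral_period_trig subr_eq0 d2; ring.
- congr (- _).
  transitivity (\int[mu]_(x in `[0, 1])
    ((2^-1 * htest_s p q (eta - b) * cos (2 * pi * (n - n0)%:~R * x) - (- 2^-1) * htest_c p q (eta - b) * sin (2 * pi * (n - n0)%:~R * x))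
    + ((- 2^-1) * htest_s p q (- eta - b) * cos (2 * pi * (- n - n0)%:~R * x) - 2^-1 * htest_c p q (- eta - b) * sin (2 * pi * (- n - n0)%:~R * x)))).
    apply: eq_Rintegral => x _.
    transitivity (2^-1 * (\int[mu]_y ((cos ((w - k) * x + (eta - b) * y) * q.[y] - sin ((w - k) * x + (eta - b) * y) * (- p).[y]) * gauss y)
      + (-1) * \int[mu]_y ((cos ((- w - k) * x + (- eta - b) * y) * q.[y] - sin ((- w - k) * x + (- eta - b) * y) * (- p).[y]) * gauss y))).
      rewrite -[-1 * _]RintegralZl//.
      rewrite -RintegralD//; last exact: integrable_scaler.
      rewrite -RintegralZl//; last by apply: integrable_addr => //; exact: integrable_scaler.
      apply: eq_Rintegral => y _; rewrite /gtest -/w !hornE.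
      have -> : (w - k) * x + (eta - b) * y = (w * x + eta * y) - (k * x + b * y) by ring.
      have -> : (- w - k) * x + (- eta - b) * y = - ((w * x + eta * y) + (k * x + b * y)) by ring.
      move: (w * x + eta * y) (k * x + b * y) => A B.
      by rewrite cosN sinN cosB sinB cosD sinD; field.
    have -> : - p = -1 *: p by rewrite scaleN1r.
    rewrite !inner_c /htest_c /htest_s cos_transformZ// cos_transformZ// sin_transformZ// sin_transformZ// !mw1 !mw2.
    ring.
  rewrite RintegralD//; [|exact: trig_period_integrable..].
  by rewrite !integral_period_trig subr_eq0 d2; ring.
Qed.

Lemma continuous_htest_c p q : continuous (htest_c p q).
Proof.
by move=> x; apply: cvgB; [exact: continuous_cos_transform|exact: continuous_sin_transform].
Qed.

Lemma continuous_htest_s p q : continuous (htest_s p q).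
Proof.
by move=> x; apply: cvgD; [exact: continuous_cos_transform|exact: continuous_sin_transform].
Qed.

End TestFunctions.

(** * Action of a spectrum on a wave packet *)

Section Pairing.
Context {R : realType}.
Local Notation mu := (@lebesgue_measure R).
Variables (a b : R) (n0 : int).
Hypothesis a0 : 0 < a.
Local Notation k := (wavenumber n0 : R).
Implicit Types (p q : {poly R}).

Lemma sum_delta_symmetric (n : int) (N : nat) : (`|n| <= N%:Z)%R ->
  \sum_(i < N.*2.+1) ((i%:Z - N%:Z == n)%:R : R) = 1.
Proof.
move=> nN.
have h1 : (0 <= n + N%:Z)%R by move: nN; rewrite ler_norml => /andP[h _]; lia.
have [m mE] : exists m : nat, n + N%:Z = m%:Z by exists (absz (n + N%:Z)); rewrite gez0_abs.
have mN : (m < N.*2.+1)%N by move: nN; rewrite ler_norml => /andP[_ h]; lia.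
rewrite (bigD1 (Ordinal mN))//= -mE addrK eqxx big1 ?addr0// => i.
rewrite -val_eqE/= => im; case: eqP => // h; exfalso; move/eqP: im; apply.
by apply/eqP; rewrite -eqz_nat -mE -h subrK.
Qed.

Lemma Re_mul_conj (z : R[i]) (c X Y : R) :
  complex.Re (z * conjc (c%:C * Complex X Y)) = c * (complex.Re z * X + complex.Im z * Y).
Proof. by case: z => re im /=; ring. Qed.

(** Real part of the spectrum times the conjugate transform of the packet, at the
    single mode [n0]. *)
Definition pairing_integrand (f : spectrum R) p q (eta : R) : R :=
  complex.Re (f n0 eta) * htest_c a p q (eta - b) - complex.Im (f n0 eta) * htest_s a p q (eta - b).

(** Only the modes [n0] and [- n0] meet the packet, so the symmetric partial sums
    are eventually constant.  The two contributions agree because the spectrum is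
    that of a real distribution. *)
Lemma dist_gtest (f : spectrum R) p q : real_spectrum f ->
  mu.-integrable setT (EFin \o pairing_integrand f p q) ->
  dist f (gtest a k b p q) = \int[mu]_eta pairing_integrand f p q eta.
Proof.
move=> [mre mim sym] iL.
pose L := pairing_integrand f p q.
pose L' (eta : R) := complex.Re (f (- n0) eta) * htest_c a p q (- eta - b) + complex.Im (f (- n0) eta) * htest_s a p q (- eta - b).
have mshift (g : R -> R) : continuous g -> measurable_fun setT (fun eta : R => g (- eta - b)).
  move=> cg; apply: continuous_measurable_fun => x.
  apply: (@continuous_comp _ _ _ (fun eta => - eta - b) g); last exact: cg.
  by apply: cvgB; [apply: cvgN; exact: cvg_id|exact: cvg_cst].
have mL' : measurable_fun setT L'.
  apply: measurable_funD; apply: measurable_funM => //; apply: mshift.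
  - exact: continuous_htest_c.
  - exact: continuous_htest_s.
have aeL : {ae mu, forall eta, L' eta = L (- eta)}.
  have := ae_reflection (sym n0); apply: ae_imp => eta.
  rewrite opprK /L' /L /pairing_integrand => ->.
  by case: (f n0 (- eta)) => re im /=; ring.
have iLr : mu.-integrable setT (EFin \o (fun eta => L (- eta))) by exact: integrable_reflection.
have iL' : mu.-integrable setT (EFin \o L').
  apply/integrableP; split; first exact: measurable_EFinT.
  rewrite (@ae_eq_integral _ _ _ mu setT (fun x => `|(L (- x))%:E|%E))//.
  - by move/integrableP : iLr => [].
  - by apply: measurableT_comp => //; exact: measurable_EFinT.
  - by apply: measurableT_comp => //; exact: measurable_int iLr.
  - by move: aeL; apply: ae_imp => eta /= -> .
have intL' : \int[mu]_eta L' eta = \int[mu]_eta L eta.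
  rewrite -(Rintegral_reflection (integrable_measurable iL)) /Rintegral; congr fine.
  apply: ae_eq_integral => //.
  - exact: measurable_EFinT.
  - exact: measurable_int iLr.
  - by move: aeL; apply: ae_imp => eta /= ->.
have term (n : int) : \int[mu]_eta complex.Re (f n eta * conjc (fourier (gtest a k b p q) n eta)) =
  ((n == n0)%:R + (n == - n0)%:R) * ((4 * pi)^-1 * \int[mu]_eta L eta).
  transitivity (\int[mu]_eta ((n == n0)%:R * (4 * pi)^-1 * L eta + (n == - n0)%:R * (4 * pi)^-1 * L' eta)).
    have pi0 : (pi : R) != 0 by rewrite gt_eqF ?pi_gt0.
    apply: eq_Rintegral => eta _; rewrite (@fourier_gtest R a _ b a0 n0 p q n eta erefl).
    have [E1|E1] := eqVneq n n0; have [E2|E2] := eqVneq n (- n0);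
      rewrite ?mul1r ?mul0r ?addr0 ?add0r ?subr0 ?sub0r /L /L' /pairing_integrand ?E1 -?E2 ?E1.
    1-4: by rewrite Re_mul_conj; move: (pi : R) pi0 => P P0; field.
  rewrite RintegralD//; last 2 first.
  - exact: integrableZl iL.
  - exact: integrableZl iL'.
  rewrite !RintegralZl// intL'; ring.
rewrite /dist.
have -> : limn (fun N : nat => \sum_(i < N.*2.+1)
   \int[mu]_eta complex.Re (f (i%:Z - N%:Z) eta * conjc (fourier (gtest a k b p q) (i%:Z - N%:Z) eta)))
  = (2 * pi)^-1 * \int[mu]_eta L eta.
  apply/cvg_lim => //; apply: cvg_near_cst.
  (* from this rank on, both n0 and - n0 occur in the symmetric sum *)
  exists `|n0|%N => // N /= n0N.
  under eq_bigr do rewrite term.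
  have n0N' : (`|n0| <= N%:Z)%R by rewrite -abszE lez_nat.
  rewrite -mulr_suml big_split/= !sum_delta_symmetric ?normrN//.
  have pi0 : (pi : R) != 0 by rewrite gt_eqF ?pi_gt0.
  by move: (pi : R) pi0 => P P0; field.
by rewrite mulrA mulfV ?mul1r// mulf_neq0// gt_eqF// pi_gt0.
Qed.

End Pairing.

(** * Dominated convergence for real integrals *)

Section RealDominated.
Context d (T : measurableType d) (R : realType) (mu : {measure set T -> \bar R}).
Variables (D : set T) (mD : measurable D).

Lemma Rdominated_cvg (f_ : nat -> T -> R) (f g : T -> R) :
  (forall n, measurable_fun D (f_ n)) -> measurable_fun D f ->
  {ae mu, forall x, D x -> f_ ^~ x @ \oo --> f x} ->
  mu.-integrable D (EFin \o g) ->
  (forall n x, D x -> `|f_ n x| <= g x) ->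
  mu.-integrable D (EFin \o f) /\
  (fun n => \int[mu]_(x in D) f_ n x) @ \oo --> \int[mu]_(x in D) f x.
Proof.
move=> mf_ mf cf ig fg.
have cf' : {ae mu, forall x, D x -> (fun n => (f_ n x)%:E) @ \oo --> (f x)%:E}.
  apply: filterS cf => x h Dx; apply: cvg_EFin; first exact: nearW.
  exact: h.
have fg' : {ae mu, forall x n, D x -> (`|(f_ n x)%:E| <= (g x)%:E)%E}.
  by apply: (@filterE _ (almost_everywhere mu)) => x n Dx; rewrite /= lee_fin; exact: fg.
have [i1 _ i3] := @dominated_convergence _ _ _ mu D mD (fun n x => (f_ n x)%:E)
  (fun x => (f x)%:E) (fun x => (g x)%:E) (fun n => measurable_EFinT (mf_ n)) (measurable_EFinT mf)
  cf' ig fg'.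
split; first exact: i1.
rewrite /Rintegral; apply: (@fine_cvg _ _ _ _ (fun n => \int[mu]_(x in D) (f_ n x)%:E)%E).
rewrite fineK//; exact: integrable_fin_num.
Qed.
End RealDominated.

(** * Gaussians separate functions *)

Section Uniqueness.
Context {R : realType}.
Local Notation mu := (@lebesgue_measure R).

Lemma is_derive_gaussian (c b x : R) :
  is_derive x (1:R) (fun x => expR (- (c * (x - b) ^+ 2)))
    (- (2 * c * (x - b)) * expR (- (c * (x - b) ^+ 2))).
Proof. by deriv; rewrite /=; ring. Qed.

Lemma measurable_gaussian (c b : R) :
  measurable_fun setT (fun x : R => expR (- (c * (x - b) ^+ 2))).
Proof. exact: continuous_measurable_fun (der_continuous (is_derive_gaussian c b)). Qed.

(** Averaging narrow Gaussians over their centres in [x, z] gives, by an affine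
    change of variable, a smoothed indicator of [x, z]. *)
Lemma gauss_kernel_cdf (N x z eta : R) : 0 < N -> x <= z ->
  \int[mu]_(b in `[x, z]) (N * expR (- (N ^+ 2 * (eta - b) ^+ 2))) =
  \int[mu]_(r in `[N * (x - eta), N * (z - eta)]) gauss_fun r.
Proof.
move=> N0 xz.
pose F b := N * (b - eta).
have dF (b : R) : is_derive b (1:R) F N by rewrite /F; deriv; rewrite /=; ring.
have F'E : derive1 F = fun=> N.
  by apply/funext => b; rewrite derive1E; exact: (@derive_val _ _ _ _ _ _ _ (dF b)).
have cF := der_continuous dF.
rewrite /Rintegral; congr fine; rewrite -/(F x) -/(F z).
rewrite (@integration_by_substitution_increasing _ F)//.
- apply: eq_integral => b _; rewrite F'E /= /F /gauss_fun; congr EFin.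
  rewrite -[RHS]/(expR (- (N * (b - eta)) ^+ 2) * N) mulrC; congr (expR _ * _); ring.
- by move=> u v _ _ uv; rewrite /F ltr_pM2l// ltrD2r.
- by rewrite F'E => b _; exact: cvg_cst.
- by rewrite F'E; exact: is_cvg_cst.
- by rewrite F'E; exact: is_cvg_cst.
- split.
  + by move=> b _; exact: (@ex_derive _ _ _ _ _ _ _ (dF b)).
  + exact/cvg_at_right_filter/cF.
  + exact/cvg_at_left_filter/cF.
- apply: continuous_subspaceT; exact: continuous_gauss_fun.
Qed.

Lemma gaussian_weight_le (u c b eta : R) : 0 <= c ->
  `|u * expR (- (c * (eta - b) ^+ 2))| <= `|u|.
Proof.
move=> c0; rewrite normrM -[leRHS]mulr1 ler_wpM2l// ger0_norm ?expR_ge0//.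
by rewrite -expR0 ler_expR oppr_le0 mulr_ge0// sqr_ge0.
Qed.

Definition gcdf (n : nat) (x z eta : R) : R :=
  \int[mu]_(r in `[n.+1%:R * (x - eta), n.+1%:R * (z - eta)]) gauss_fun r.

Lemma Rintegral_gauss : \int[mu]_r gauss_fun r = Num.sqrt pi.
Proof. by rewrite /Rintegral integralT_gauss. Qed.

Lemma gcdf_bound n x z eta : `|gcdf n x z eta| <= Num.sqrt pi.
Proof.
rewrite ger0_norm; last by apply: Rintegral_ge0 => r _; exact: gauss_fun_ge0.
rewrite -lee_fin -integralT_gauss /gcdf /Rintegral fineK; last first.
  apply: integrable_fin_num => //.
  by apply: integrableS integrableT_gauss.
by apply: ge0_subset_integral => //;
  [apply: measurable_EFinT; exact: measurable_gauss_fun|move=> r _; rewrite lee_fin gauss_fun_ge0].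
Qed.

(** The interval of integration grows to the whole line when [eta] is inside
    [x, z] and leaves every bounded set when it is outside. *)
Lemma gcdf_cvg (x z eta : R) : eta != x -> eta != z -> x <= z ->
  (fun n => gcdf n x z eta) @ \oo --> Num.sqrt pi * (\1_(`[x, z]%classic) eta : R).
Proof.
move=> ex ez xz.
pose I n : set R := `[n.+1%:R * (x - eta), n.+1%:R * (z - eta)]%classic.
have -> : (fun n => gcdf n x z eta) = (fun n => \int[mu]_r (gauss_fun \_ (I n)) r).
  by apply/funext => n; rewrite /gcdf Rintegral_mkcond.
pose L : R := \1_(`[x, z]%classic) eta.
have -> : Num.sqrt pi * L = \int[mu]_r (L * gauss_fun r).
  by rewrite RintegralZl ?Rintegral_gauss 1?mulrC//; exact: integrableT_gauss.
have [] // := @Rdominated_cvg _ _ _ mu setT measurableT (fun n => gauss_fun \_ (I n))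
  (fun r => L * gauss_fun r) gauss_fun.
- move=> n; apply/(measurable_restrictT _ _).1; first exact: measurable_itv.
  by apply: (measurable_funS measurableT) => //; exact: measurable_gauss_fun.
- by apply: measurable_funM => //; exact: measurable_gauss_fun.
- apply: ae_true => r _; rewrite /L indicE.
  have big (e : R) : 0 < e -> \forall n \near \oo, `|r| < n.+1%:R * e.
    move=> e0; near=> n.
    rewrite -ltr_pdivrMr//; apply: (@lt_trans _ _ n%:R); last by rewrite ltr_nat.
    by near: n; exact: nbhs_infty_gtr.
  have [exz|] := boolP (eta \in `[x, z]%classic).
    have /andP[h1 h2] : (x < eta) && (eta < z).
      by move: exz; rewrite inE/= in_itv/= !lt_neqAle eq_sym ex ez => ->.
    rewrite mul1r; apply: cvg_near_cst.
    have e1 : 0 < eta - x by rewrite subr_gt0.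
    have e2 : 0 < z - eta by rewrite subr_gt0.
    near=> n; rewrite patchE ifT// inE /I/= in_itv/=.
    have : `|r| < n.+1%:R * (eta - x) by near: n; exact: big.
    have : `|r| < n.+1%:R * (z - eta) by near: n; exact: big.
    rewrite !ltr_norml => /andP[_ r2] /andP[r1 _]; apply/andP; split; last exact: ltW.
    by apply: ltW; move: r1; congr (_ < _); ring.
  rewrite mul0r notin_setE/= in_itv/= => /negP; rewrite negb_and -!ltNge => exz.
  apply: cvg_near_cst; case/orP: exz => h.
  - have e1 : 0 < x - eta by rewrite subr_gt0.
    near=> n; rewrite patchE ifF//; apply/negbTE; rewrite notin_setE /I/= in_itv/=.
    have : `|r| < n.+1%:R * (x - eta) by near: n; exact: big.
    by rewrite ltr_norml => /andP[_ rl]; apply/negP; rewrite negb_and -!ltNge rl.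
  - have e1 : 0 < eta - z by rewrite subr_gt0.
    near=> n; rewrite patchE ifF//; apply/negbTE; rewrite notin_setE /I/= in_itv/=.
    have : `|r| < n.+1%:R * (eta - z) by near: n; exact: big.
    rewrite ltr_norml => /andP[rl _]; apply/negP; rewrite negb_and -!ltNge; apply/orP; right.
    by move: rl; congr (_ < _); ring.
- exact: integrableT_gauss.
- move=> n r _; rewrite patchE; case: ifP => _; rewrite ?normr0 ?gauss_fun_ge0//.
  by rewrite ger0_norm// gauss_fun_ge0.
Unshelve. all: by end_near.
Qed.

(** The smoothed indicator is an average of Gaussians: Fubini's theorem transfers
    the orthogonality. *)
Lemma gcdf_pairing (f : R -> R) n (x z : R) : x <= z ->
  mu.-integrable setT (EFin \o f) ->
  (forall c b, 0 < c -> \int[mu]_eta (f eta * expR (- (c * (eta - b) ^+ 2))) = 0) ->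
  mu.-integrable setT (EFin \o (fun eta => f eta * gcdf n x z eta)) /\
  \int[mu]_eta (f eta * gcdf n x z eta) = 0.
Proof.
move=> xz fi f0.
pose N : R := n.+1%:R.
have N0 : 0 < N by [].
pose I : set R := `[x, z]%classic.
pose h (p : R * R) : R := \1_I p.1 * N * (f p.2 * expR (- (N ^+ 2 * (p.2 - p.1) ^+ 2))).
have mf := integrable_measurable fi.
have mI : measurable_fun setT (\1_I : R -> R) by apply: measurable_indic; exact: measurable_itv.
have mh : measurable_fun setT h.
  apply: measurable_funM.
    by apply: measurable_funM => //; exact: (measurableT_comp mI measurable_fst).
  apply: measurable_funM; first exact: measurableT_comp.
  apply: measurableT_comp => //; apply: measurableT_comp => //.
  by apply: measurable_funM => //; apply: measurable_funX; exact: measurable_funB.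
have intf : mu.-integrable setT (EFin \o (fun y => `|f y|)) by exact: integrable_norm.
have hi : (mu \x mu)%E.-integrable setT (EFin \o h).
  apply/integrable12ltyP; first exact: measurable_EFinT.
  apply: (@le_lt_trans _ _ (\int[mu]_b ((\1_I b * N)%:E * \int[mu]_y `|(f y)%:E|))%E).
    apply: ge0_le_integral => //.
    - by move=> b _; apply: integral_ge0.
    - apply: (@measurable_fun_fubini_tonelli_F _ _ _ _ _ mu (fun p => `|(h p)%:E|%E)) => //.
      by apply: measurableT_comp => //; exact: measurable_EFinT.
    - apply: emeasurable_funM => //; apply: measurable_EFinT.
      by apply: measurable_funM => //; exact: measurable_indic.
    - move=> b _.
      have bN0 : 0 <= \1_I b * N by rewrite mulr_ge0// ltW.
      rewrite -ge0_integralZl//; last first.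
        by apply: measurableT_comp => //; exact: measurable_EFinT.
      apply: ge0_le_integral => //.
      + apply: measurableT_comp => //; apply: measurable_EFinT.
        exact: (measurableT_comp mh (pair1_measurable b)).
      + by apply: measurable_funeM; apply: measurableT_comp => //; exact: measurable_EFinT.
      + move=> y _; rewrite !abse_EFin -EFinM lee_fin /h/= normrM ger0_norm//.
        by rewrite ler_wpM2l// gaussian_weight_le// sqr_ge0.
  rewrite ge0_integralZr//; last 3 first.
  - by apply: measurable_EFinT; apply: measurable_funM => //; exact: measurable_indic.
  - by move=> b _; rewrite lee_fin mulr_ge0// ltW.
  - exact: integral_ge0.
  under eq_integral do rewrite EFinM muleC.
  rewrite ge0_integralZl//; last 2 first.
  - by apply: measurable_EFinT; exact: mI.
  - by rewrite lee_fin ltW.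
  have mII : measurable I by exact: measurable_itv.
  rewrite integral_indic// setIT /I /= lebesgue_measure_itv/=.
  have /integrableP[_ flt] := fi.
  rewrite lte_mul_pinfty ?mule_ge0//.
  - by rewrite lee_fin ltW.
  - by case: ifP => // _; rewrite -EFinB lee_fin subr_ge0.
  - by case: ifP => _; rewrite ?mule0// -EFinB -EFinM.
have Fub := @Fubini _ _ _ _ _ mu mu (EFin \o h) hi.
have inner eta : (\int[mu]_b (h (b, eta))%:E)%E = (f eta * gcdf n x z eta)%:E.
  rewrite -[gcdf n x z eta](gauss_kernel_cdf eta N0 xz) /Rintegral.
  have cg : continuous (fun b : R => N * expR (- (N ^+ 2 * (eta - b) ^+ 2))).
    pose g' (b : R) := N * (expR (- (N ^+ 2 * (eta - b) ^+ 2)) * (N ^+ 2 * (2 * (eta - b)))).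
    by apply: (@der_continuous _ _ g') => b; rewrite /g'; deriv; rewrite /=; ring.
  have gi : mu.-integrable I (EFin \o (fun b : R => N * expR (- (N ^+ 2 * (eta - b) ^+ 2)))).
    apply: continuous_compact_integrable; first exact: segment_compact.
    exact: continuous_subspaceT.
  rewrite EFinM fineK; last exact: integrable_fin_num.
  rewrite -(integralZl _ gi (f eta)); last exact: measurable_itv.
  rewrite [in RHS]integral_mkcond.
  apply: eq_integral => b _; rewrite /h/= patchE indicE; case: ifP => _.
    by rewrite mul1r -EFinM; congr EFin; ring.
  by rewrite !mul0r.
have inner0 b : (\int[mu]_eta (h (b, eta))%:E)%E = 0%E.
  under eq_integral do rewrite /h/= EFinM.
  have ig : mu.-integrable setT (EFin \o (fun eta => f eta * expR (- (N ^+ 2 * (eta - b) ^+ 2)))).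
    apply: (@integrable_dominated _ _ _ mu setT measurableT _ (fun y => `|f y|)); last exact: intf.
    - apply: measurable_funM; first exact: mf.
      exact: measurable_gaussian.
    - by move=> eta _; exact: gaussian_weight_le (sqr_ge0 N).
  rewrite (integralZl measurableT ig).
  rewrite /= -(EFin_Rintegral measurableT ig) f0; first by rewrite mule0.
  by rewrite exprn_gt0.
have mG : measurable_fun setT (fun eta => f eta * gcdf n x z eta).
  apply/measurable_EFinP; move: (measurable_fubini_G hi).
  by congr (measurable_fun _ _); apply/funext => eta; rewrite /fubini_G /= -inner.
split.
  apply: (@integrable_dominated _ _ _ mu setT measurableT _ (fun y => Num.sqrt pi * `|f y|)).
  - exact: mG.
  - move=> eta _; rewrite normrM mulrC; apply: ler_wpM2r; first exact: normr_ge0.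
    exact: gcdf_bound.
  - exact: (integrable_scaler measurableT _ intf).
rewrite /Rintegral; under eq_integral do rewrite -inner.
rewrite -[X in fine X]Fub/=; under eq_integral do rewrite inner0.
by rewrite integral0.
Qed.

Lemma integral_itv_eq0 (f : R -> R) (x z : R) : x <= z ->
  mu.-integrable setT (EFin \o f) ->
  (forall c b, 0 < c -> \int[mu]_eta (f eta * expR (- (c * (eta - b) ^+ 2))) = 0) ->
  \int[mu]_(eta in `[x, z]) f eta = 0.
Proof.
move=> xz fi f0.
have pairing n := gcdf_pairing n xz fi f0.
have mf := integrable_measurable fi.
have mI : measurable_fun setT (\1_(`[x, z]%classic) : R -> R) by apply: measurable_indic; exact: measurable_itv.
have [] := @Rdominated_cvg _ _ _ mu setT measurableT (fun n eta => f eta * gcdf n x z eta)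
  (fun eta => f eta * (Num.sqrt pi * \1_(`[x, z]%classic) eta)) (fun eta => Num.sqrt pi * `|f eta|).
- by move=> n; exact: integrable_measurable (pairing n).1.
- by do 2 apply: measurable_funM => //.
- have : mu [set x; z] = 0%E by apply: countable_lebesgue_measure0; apply: finite_set_countable; exact: finite_set2.
  move=> xz0; exists [set x; z]; split => //; first by apply: measurableU; exact: measurable_set1.
  move=> eta /=; apply: contra_notP => /not_orP[ex ez] _.
  by apply: cvgMl_tmp; apply: gcdf_cvg => //; apply/eqP.
- by apply: integrable_scaler => //; exact: integrable_norm.
- move=> n eta _; rewrite normrM mulrC ler_wpM2r//; exact: gcdf_bound.
move=> _; under eq_fun do rewrite (pairing _).2.
move=> /cvg_lim; rewrite lim_cst// => /(_ (@Rhausdorff R)).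
have -> : \int[mu]_eta (f eta * (Num.sqrt pi * \1_(`[x, z]%classic) eta)) =
   Num.sqrt pi * \int[mu]_(eta in `[x, z]) f eta.
  rewrite [in RHS]Rintegral_mkcond -RintegralZl//.
    apply: eq_Rintegral => eta _; rewrite patchE indicE; case: ifP => _; rewrite ?mulr1 1?mulrC//.
    by rewrite /= /point /= !mulr0 mul0r.
  rewrite -restrict_EFin; apply/(integrable_mkcond _ _).1; first exact: measurable_itv.
  by apply: integrableS fi.
move=> /esym/eqP; rewrite mulf_eq0 gt_eqF ?sqrtr_gt0 ?pi_gt0//= => /eqP.
by [].
Qed.

(** A function whose integral over every interval vanishes is zero at each of its
    Lebesgue points. *)
Lemma L1_gauss_uniqueness (f : R -> R) :
  mu.-integrable setT (EFin \o f) ->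
  (forall c b, 0 < c -> \int[mu]_eta (f eta * expR (- (c * (eta - b) ^+ 2))) = 0) ->
  {ae mu, forall eta, f eta = 0}.
Proof.
move=> fi f0.
have := lebesgue_differentiation (open_integrable_locally openT fi).
apply: ae_imp => eta pt.
have e1 : eta < eta + 1 by rewrite ltrDl.
have ax : (BLeft (eta - 1)%R < BRight eta)%E by rewrite lte_fin ltrBlDr ltrDl.
have fS : mu.-integrable [set` Interval (BLeft (eta - 1)) (BRight (eta + 1))] (EFin \o f).
  by apply: integrableS fi.
have [_ <-] := FTC1_lebesgue_pt e1 fS ax pt.
rewrite (_ : (fun y => _) = cst 0); first by rewrite derive1_cst.
apply/funext => y; have [h|h] := leP (eta - 1) y; first exact: integral_itv_eq0.
by rewrite set_itv_ge ?Rintegral_set0// bnd_simp -ltNge.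
Qed.

(** A product of Gaussians is a Gaussian, so multiplying by one fixed Gaussian
    reduces to the integrable case. *)
Lemma gauss_uniqueness (f : R -> R) :
  (forall c b, 0 < c -> mu.-integrable setT (EFin \o (fun eta => f eta * expR (- (c * (eta - b) ^+ 2))))) ->
  (forall c b, 0 < c -> \int[mu]_eta (f eta * expR (- (c * (eta - b) ^+ 2))) = 0) ->
  {ae mu, forall eta, f eta = 0}.
Proof.
move=> fi f0.
pose g eta := f eta * expR (- (1 * (eta - 0) ^+ 2)).
have gi : mu.-integrable setT (EFin \o g) by exact: fi.
suff : {ae mu, forall eta, g eta = 0}.
  apply: ae_imp => eta /eqP; rewrite mulf_eq0 => /orP[/eqP//|].
  by rewrite gt_eqF// expR_gt0.
apply: L1_gauss_uniqueness => // c b c0.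
have c1 : 0 < c + 1 by rewrite addr_gt0.
pose K := expR (- (c / (c + 1) * b ^+ 2)).
transitivity (\int[mu]_eta (K * (f eta * expR (- ((c + 1) * (eta - c / (c + 1) * b) ^+ 2))))).
  apply: eq_Rintegral => eta _; rewrite /g /K -mulrA -expRD [RHS]mulrCA -expRD.
  by congr (_ * expR _); field; rewrite gt_eqF.
by rewrite RintegralZl ?f0 ?mulr0//; exact: fi.
Qed.

End Uniqueness.

(** * Functions with a bounded derivative *)

Section BoundedDerivative.
Context {R : realType}.
Local Notation mu := (@lebesgue_measure R).

Lemma is_derive_seq (f : R -> R) (x d : R) (t : nat -> R) :
  is_derive x (1:R) f d -> (forall n, t n != 0) -> t @ \oo --> 0 ->
  (fun n => (t n)^-1 * (f (t n + x) - f x)) @ \oo --> d.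
Proof.
move=> [fd <-] t0 tcvg.
have /cvg_ex[/= l hl] := fd.
have -> : 'D_1 f x = l by apply/cvg_lim => //; exact: hl.
move: hl => /cvgr_dnbhsP/(_ t (conj t0 tcvg)).
rewrite (_ : (fun n => (t n)^-1 *: _) = (fun n => (t n)^-1 * (f (t n + x) - f x)))//.
by apply/funext => n; rewrite scaler1.
Qed.

(** The slope [E t] with which [B] is compared may move with [t]; its continuity
    at [s] allows it to be replaced by [E s]. *)
Lemma is_derive_expansion (B E : R -> R) (s C e : R) : 0 < e -> B s = 0 ->
  {for s, continuous E} ->
  (forall t, `|t - s| < e -> `|B t - (t - s) * E t| <= C * (t - s) ^+ 2) ->
  is_derive s (1:R) B (E s).
Proof.
move=> e0 Bs cE hB.
have C0 : 0 <= C.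
  have h := hB (s + e / 2); have -> : C = (C * (s + e / 2 - s) ^+ 2) / (e / 2) ^+ 2 by field; rewrite gt_eqF.
  rewrite divr_ge0 ?sqr_ge0//; apply: le_trans (h _) => //.
  rewrite addrAC subrr add0r gtr0_norm ?divr_gt0//; lra.
have key : h^-1 *: (B (h *: 1 + s) - B s) @[h --> 0^'] --> E s.
  rewrite Bs; apply/cvgrPdist_le => eps eps0.
  have cE' : E (h + s) @[h --> 0] --> E s.
    have : h + s @[h --> 0] --> s.
      by rewrite -[X in _ --> X]add0r; apply: cvgD; [exact: cvg_id|exact: cvg_cst].
    by move=> hs; apply: (cvg_comp _ _ hs); exact: cE.
  have eps2 : 0 < eps / 2 by rewrite divr_gt0.
  move/cvgrPdist_le : cE' => /(_ _ eps2) cE'.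
  have C1 : 0 < C + 1 by rewrite ltr_wpDl.
  near=> h.
  have h0 : h != 0 by near: h; exact: nbhs_dnbhs_neq.
  have hE : `|E s - E (h + s)| <= eps / 2 by near: h; apply: nbhs_dnbhs; exact: cE'.
  have he : `|h| < e by near: h; exact: dnbhs0_lt.
  have hC : `|h| < eps / 2 / (C + 1) by near: h; apply: dnbhs0_lt; rewrite !divr_gt0.
  have := hB (h + s); rewrite addrK => /(_ he) hh.
  rewrite subr0 /GRing.scale/= mulr1.
  have -> : E s - h^-1 * B (h + s) = (E s - E (h + s)) - h^-1 * (B (h + s) - h * E (h + s)) by field.
  apply: (le_trans (ler_normB _ _)); rewrite normrM normfV.
  have : `|h|^-1 * `|B (h + s) - h * E (h + s)| <= eps / 2; last by lra.
  rewrite ler_pdivrMl ?normr_gt0//; apply: (le_trans hh).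
  rewrite -real_normK ?num_real// expr2 mulrA mulrC; apply: ler_wpM2l => //.
  move: hC; rewrite ltr_pdivlMr// => /ltW; apply: le_trans.
  by rewrite mulrC; apply: ler_wpM2l => //; rewrite lerDl.
apply: DeriveDef; first by apply/cvg_ex; exists (E s).
by apply/cvg_lim => //; exact: key.
Unshelve. all: by end_near.
Qed.

Section FTC.
Variables (f m : R -> R) (T T1 C : R).
Hypothesis T0 : 0 < T.
Hypothesis TT1 : T < T1.
Hypothesis f0 : f s @[s --> 0^'+] --> f 0.
Hypothesis df : forall s, 0 < s -> s <= T1 -> is_derive s (1:R) f (m s).
Hypothesis mC : forall s, 0 < s -> s <= T1 -> `|m s| <= C.

(* f is extended by constants outside [0, T1], so that difference quotients are
   defined on the whole line. *)
Let clamp (s : R) := Num.min (Num.max s 0) T1.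
Let F s := f (clamp s).

Let T10 : 0 < T1. Proof. exact: lt_trans TT1. Qed.

Let C0 : 0 <= C. Proof. by apply: le_trans (mC T0 (ltW TT1)). Qed.

Let f_lipschitz (s t : R) : 0 <= s -> s <= t -> t <= T1 -> `|f t - f s| <= C * (t - s).
Proof.
move=> s0; rewrite le_eqVlt => /predU1P[->|st] tT; first by rewrite !subrr normr0 mulr0.
have d (x : R) : x \in `]s, t[ -> is_derive x (1:R) f (m x).
  by rewrite in_itv/= => /andP[sx xt]; apply: df; [exact: le_lt_trans sx|exact: le_trans (ltW xt) tT].
have df' x : 0 < x -> x <= T1 -> {for x, continuous f}.
  move=> x0 xT; apply: differentiable_continuous; apply/derivable1_diffP.
  exact: (@ex_derive _ _ _ _ _ _ _ (df x0 xT)).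
have c : {within `[s, t], continuous f}.
  apply/continuous_within_itvP => //; split.
  - move=> x; rewrite in_itv/= => /andP[sx xt].
    by apply: df'; [exact: le_lt_trans sx|exact: le_trans (ltW xt) tT].
  - move: s0; rewrite le_eqVlt => /predU1P[<-//|s0].
    by apply: cvg_at_right_filter; apply: df' => //; exact: le_trans (ltW st) tT.
  - by apply: cvg_at_left_filter; apply: df' => //; exact: le_lt_trans st.
have [x xst ->] := MVT st d c.
rewrite normrM (gtr0_norm (_ : 0 < t - s)) ?subr_gt0//.
rewrite ler_wpM2r ?subr_ge0 ?(ltW st)//.
move: xst; rewrite in_itv/= => /andP[sx xt].
by apply: mC; [exact: le_lt_trans sx|exact: le_trans (ltW xt) tT].
Qed.

Let clampE s : 0 <= s -> s <= T1 -> clamp s = s.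
Proof. by move=> s0 sT; rewrite /clamp max_l// min_l. Qed.

Let F_lipschitz (s t : R) : `|F t - F s| <= C * `|t - s|.
Proof.
wlog st : s t / s <= t.
  move=> h; have [/h//|/ltW/h] := leP s t.
  by rewrite distrC (distrC s).
have h1 : 0 <= clamp s by rewrite /clamp le_min (ltW T10) le_max lexx orbT.
have h2 : clamp t <= T1 by rewrite /clamp ge_min lexx orbT.
have h3 : clamp s <= clamp t.
  rewrite /clamp; apply: le_min2 => //; exact: le_max2.
apply: (le_trans (f_lipschitz h1 h3 h2)); rewrite ler_wpM2l//.
rewrite ger0_norm ?subr_ge0// /clamp.
by case: (leP s 0) => ?; case: (leP t 0) => ?; rewrite ?(min_l (ltW T10)); case: (leP s T1) => ?; case: (leP t T1) => ?; lra.
Qed.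

Let cF : continuous F.
Proof.
move=> x; apply/cvgrPdist_le => eps eps0; near=> t.
apply: (le_trans (F_lipschitz _ _)).
have : `|x - t| < eps / (C + 1).
  by near: t; apply: cvgr_dist_lt; [exact: cvg_id|rewrite divr_gt0// ltr_wpDl].
rewrite ltr_pdivlMr ?ltr_wpDl// mulrDr mulr1 [C * _]mulrC => /ltW; apply: le_trans.
by rewrite lerDl.
Unshelve. all: by end_near.
Qed.

(** The primitive of F turns the integrals of its difference quotients
    into difference quotients of that primitive. *)
Let G x := \int[mu]_(s in `[-1, x]) F s.

Let dG (x : R) : -1 < x -> is_derive x (1:R) G (F x).
Proof.
move=> x1.
have xu : x < x + 1 by rewrite ltrDl.
have i1 : mu.-integrable `[-1, x + 1] (EFin \o F).
  apply: continuous_compact_integrable; first exact: segment_compact.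
  exact: continuous_subspaceT.
have ax : (BLeft (-1)%R < BRight x)%E by rewrite lte_fin.
have [d e] := continuous_FTC1 xu i1 ax (@cF x).
by apply: DeriveDef; [exact: d|rewrite -derive1E; exact: e].
Qed.

(** The derivative [m] is bounded but may fail to be continuous or known to be
    integrable.  As a limit of difference quotients it is measurable, the
    quotients are bounded by the Lipschitz constant, and dominated convergence
    applies to their integrals, which are difference quotients of a primitive. *)
Lemma ftc_bounded_derivative :
  mu.-integrable `]0, T[ (EFin \o m) /\
  \int[mu]_(s in `]0, T[) m s = f T - f 0.
Proof.
pose t n : R := n.+1%:R^-1.
have t0 n : 0 < t n by rewrite invr_gt0.
have tn0 n : t n != 0 by rewrite gt_eqF.
have tcvg : t @ \oo --> 0 by exact: cvg_harmonic.
pose q n s := (t n)^-1 * (F (t n + s) - F s).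
have cq n : continuous (q n).
  move=> x; apply: cvgMl_tmp; apply: cvgB; last exact: cF.
  apply: (@continuous_comp _ _ _ (fun s => t n + s) F); last exact: cF.
  by apply: cvgD; [exact: cvg_cst|exact: cvg_id].
pose H n s := (t n)^-1 * (G (t n + s) - G s).
have dH n (s : R) : -1 < s -> is_derive s (1:R) (H n) (q n s).
  move=> s1.
  have d1 : is_derive (t n + s) (1:R) G (F (t n + s)).
    by apply: dG; apply: (lt_trans s1); rewrite ltrDr.
  have d2 := dG s1.
  have d3 : is_derive s (1:R) (fun s => t n + s) 1 by deriv; rewrite add0r.
  have d4 := der_comp d1 d3.
  rewrite /H; eapply is_derive_eq.
    eapply der_mul; first exact: der_cst.
    eapply der_add; first exact: d4.
    eapply der_opp; exact: d2.
  by rewrite /q mulr1 mulr0 addr0.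
have intq n : \int[mu]_(s in `[0, T]) q n s = H n T - H n 0.
  rewrite /Rintegral (@continuous_FTC2 _ (q n) (H n))//.
  - exact: continuous_subspaceT.
  - have dd (x : R) : 0 <= x -> {for x, continuous (H n)}.
      move=> x0; apply: differentiable_continuous; apply/derivable1_diffP.
      by apply: (@ex_derive _ _ _ _ _ _ _ (dH n x _)); rewrite (lt_le_trans _ x0).
    split.
    + move=> x; rewrite in_itv/= => /andP[x0 _].
      by apply: (@ex_derive _ _ _ _ _ _ _ (dH n x _)); rewrite (lt_trans _ x0).
    + by apply: cvg_at_right_filter; exact: dd.
    + by apply: cvg_at_left_filter; apply: dd; exact: ltW.
  - move=> x; rewrite in_itv/= => /andP[x0 _]; rewrite derive1E.
    by apply: (@derive_val _ _ _ _ _ _ _ (dH n x _)); rewrite (lt_trans _ x0).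
have cvg1 : (fun n => \int[mu]_(s in `]0, T[) q n s) @ \oo --> f T - f 0.
  have -> : (fun n => \int[mu]_(s in `]0, T[) q n s) = (fun n => H n T - H n 0).
    apply/funext => n; rewrite -intq /Rintegral; congr fine.
    apply/esym/integral_itv_bndoo.
    by apply: measurable_EFinT; apply: (measurable_funS measurableT) => //; exact: continuous_measurable_fun.
  have -> : f T - f 0 = F T - F 0 by rewrite /F (clampE (ltW T0) (ltW TT1)) (clampE (lexx 0) (ltW T10)).
  apply: cvgB; apply: is_derive_seq => //; apply: dG => //.
  exact: lt_trans T0.
have cvgm s : 0 < s -> s < T -> (fun n => q n s) @ \oo --> m s.
  move=> s0 sT; have d := is_derive_seq (df s0 (ltW (lt_trans sT TT1))) tn0 tcvg.
  have : \forall n \near \oo, t n < T1 - s.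
    have e0 : 0 < T1 - s by rewrite subr_gt0 (lt_trans sT).
    move/cvgrPdist_lt : tcvg => /(_ _ e0); apply: filterS => n.
    by rewrite sub0r normrN gtr0_norm.
  move=> nt; apply: cvg_trans d; apply: near_eq_cvg; apply: filterS nt => n tn.
  rewrite /q /F !clampE ?ltW ?addr_gt0//.
  - exact: lt_trans sT TT1.
  - by move: tn; rewrite ltrBrDr.
have mD : measurable (`]0, T[ : set R) by exact: measurable_itv.
have mq n : measurable_fun (`]0, T[ : set R) (q n).
  by apply: (measurable_funS measurableT) => //; exact: continuous_measurable_fun.
have mm : measurable_fun (`]0, T[ : set R) m.
  apply: (@measurable_fun_cvg _ _ _ _ q) => // s /=; rewrite in_itv/= => /andP[s0 sT].
  exact: cvgm.
have qC n s : `|q n s| <= C.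
  rewrite /q normrM gtr0_norm ?invr_gt0// ler_pdivrMl//.
  by apply: (le_trans (F_lipschitz _ _)); rewrite addrK gtr0_norm// mulrC.
have [//|||i1 i2] := @Rdominated_cvg _ _ _ mu (`]0, T[ : set R) mD q m (cst C) mq mm.
- apply: ae_true => s; rewrite /= in_itv/= => /andP[s0 sT]; exact: cvgm.
- have ic : mu.-integrable `[0, T] (EFin \o (fun _ : R => C)).
    apply: continuous_compact_integrable; first exact: segment_compact.
    by apply: continuous_subspaceT => x; exact: cvg_cst.
  apply: integrableS ic; [exact: measurable_itv|exact: measurable_itv|].
  by apply: subset_itvScc; rewrite bnd_simp.
- by move=> n s _; exact: qC.
split => //.
by have := cvg_unique _ i2 cvg1; apply.
Qed.

End FTC.
End BoundedDerivative.

(** * Gaussians with a moving centre *)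

Section GaussianEstimates.
Context {R : realType}.

Definition gk (c b x : R) := expR (- (c * (x - b) ^+ 2)).

(** Derivative of the Gaussian in [x], that is minus its derivative in the
    centre [b]. *)
Definition dgk (c b x : R) := - (2 * c * (x - b)) * gk c b x.

Lemma oneDsqr_shift (b x : R) : 1 + x ^+ 2 <= 2 * (1 + b ^+ 2) * (1 + (x - b) ^+ 2).
Proof.
have := sqr_ge0 (x - 2 * b); have := sqr_ge0 (b * (x - b)); nra.
Qed.

(** Uniformity for bounded centres: shifting the centre costs a factor in the
    decay that depends only on the bound. *)
Lemma gk_decay (c B : R) (N : nat) (p : {poly R}) : 0 < c ->
  exists2 D, 0 <= D & forall b x, `|b| <= B ->
    `|p.[x - b] * gk c b x| <= D / (1 + x ^+ 2) ^+ N.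
Proof.
move=> c0; have [D D0 hD] := poly_gauss_decay p N c0.
exists (D * (2 * (1 + B ^+ 2)) ^+ N).
  by rewrite mulr_ge0// exprn_ge0// mulr_ge0// addr_ge0// sqr_ge0.
move=> b x bB; apply: (le_trans (hD (x - b))).
have h1 := sqrD1_gt0 x; have h2 := sqrD1_gt0 (x - b).
rewrite ler_pdivrMr ?exprn_gt0// mulrAC ler_pdivlMr ?exprn_gt0//.
rewrite -mulrA ler_wpM2l// -exprMn; apply: lerXn2r; rewrite ?nnegrE ?(ltW h1)//.
  by rewrite !mulr_ge0// ?(ltW h2)// addr_ge0// sqr_ge0.
apply: (le_trans (oneDsqr_shift b x)); rewrite ler_wpM2r ?(ltW h2)// ler_wpM2l// lerD2l.
by rewrite -[leLHS]real_normK ?num_real// lerXn2r// nnegrE// (le_trans _ bB).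
Qed.

Lemma is_derive_gk_center (c x b : R) : is_derive b (1:R) (fun b => gk c b x) (- dgk c b x).
Proof. by rewrite /gk /dgk; deriv; rewrite /gk /=; ring. Qed.

Definition ddgk (c b x : R) := (4 * c ^+ 2 * (x - b) ^+ 2 - 2 * c) * gk c b x.

Lemma is_derive_dgk_center (c x b : R) : is_derive b (1:R) (fun b => dgk c b x) (- ddgk c b x).
Proof. by rewrite /dgk /ddgk /gk; deriv; rewrite /=; ring. Qed.

Lemma MVT_le (f f' : R -> R) (a b M : R) : (forall x, is_derive x (1:R) f (f' x)) ->
  (forall x, `|x - a| <= `|b - a| -> `|f' x| <= M) -> `|f b - f a| <= M * `|b - a|.
Proof.
move=> df hM; have cf := der_continuous df.
have [ab|ba|->] := ltgtP a b; last by rewrite !subrr normr0 mulr0.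
- have [x xab ->] := MVT ab (fun x _ => df x) (continuous_subspaceT cf).
  rewrite normrM ler_wpM2r// hM//.
  move: xab; rewrite in_itv/= => /andP[ax xb].
  by rewrite !gtr0_norm ?subr_gt0// lerD2r ltW.
- have [x xab] := MVT ba (fun x _ => df x) (continuous_subspaceT cf).
  rewrite distrC => ->; rewrite normrM (distrC b) ler_wpM2r// hM//.
  move: xab; rewrite in_itv/= => /andP[ax xb].
  by rewrite !ltr0_norm ?subr_lt0// lerN2 lerD2r ltW.
Qed.

(** Controls the motion of the centre along a characteristic, with enough decay
    in [x] to be paired with a polynomially weighted function. *)
Lemma gk_taylor (c B : R) (N : nat) : 0 < c ->
  exists2 D, 0 <= D & forall b b' x, `|b| <= B -> `|b'| <= B ->
    `|gk c b' x - gk c b x + (b' - b) * dgk c b x|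
      <= (b' - b) ^+ 2 * D / (1 + x ^+ 2) ^+ N.
Proof.
move=> c0.
have [D D0 hD] := gk_decay (3 * B) N ((4 * c ^+ 2) *: 'X^2 - (2 * c)%:P) c0.
exists D => // b b' x bB b'B.
have bb' : `|b' - b| <= 2 * B by apply: (le_trans (ler_normB _ _)); lra.
pose rem u := gk c u x - gk c b x + (u - b) * dgk c b x.
have drem u : is_derive u (1:R) rem (- dgk c u x + dgk c b x).
  have h := is_derive_gk_center c x u.
  by rewrite /rem; deriv; rewrite ?/=; ring.
have hdd u : `|u - b| <= `|b' - b| -> `|- ddgk c u x| <= D / (1 + x ^+ 2) ^+ N.
  move=> ub; have uB : `|u| <= 3 * B.
    by rewrite -(subrK b u); apply: (le_trans (ler_normD _ _)); lra.
  have := hD u x uB; rewrite normrN /ddgk.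
  by rewrite !(hornerD, hornerZ, hornerN, hornerC, hornerXn).
have hd u : `|u - b| <= `|b' - b| -> `|- dgk c u x + dgk c b x| <= D / (1 + x ^+ 2) ^+ N * `|b' - b|.
  move=> ub; rewrite addrC -normrN opprB.
  apply: (@le_trans _ _ (D / (1 + x ^+ 2) ^+ N * `|u - b|)).
    apply: (@MVT_le (fun u => dgk c u x) (fun u => - ddgk c u x) b u).
      by move=> w; exact: is_derive_dgk_center.
    by move=> w wu; apply: hdd; exact: le_trans ub.
  by rewrite ler_wpM2l// divr_ge0// exprn_ge0// ltW// sqrD1_gt0.
have := MVT_le drem hd.
rewrite {2}/rem !subrr mul0r addr0 subr0 => /le_trans; apply.
have e : `|b' - b| * `|b' - b| = (b' - b) ^+ 2 by rewrite -expr2 real_normK ?num_real.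
by rewrite -[leLHS]mulrA e mulrC mulrA lexx.
Qed.

Lemma measurable_gk c b : measurable_fun setT (gk c b).
Proof. exact: measurable_gaussian. Qed.

Lemma measurable_dgk c b : measurable_fun setT (dgk c b).
Proof.
apply: continuous_measurable_fun.
apply: (@der_continuous _ _ (fun x => ddgk c b x)) => x.
by rewrite /dgk /ddgk /gk; deriv; rewrite /=; ring.
Qed.

End GaussianEstimates.

(** * Transport equations tested against Gaussians *)

Section Mild.
Context {R : realType}.
Local Notation mu := (@lebesgue_measure R).

(** Jointly measurable, and of negative Sobolev order uniformly on bounded time
    intervals. *)
Definition tempered_family (w : R -> R -> R) : Prop :=
  measurable_fun setT (fun p : R * R => w p.1 p.2) /\
  forall T : R, 0 <= T -> exists N K, forall t : R, 0 <= t <= T ->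
    (wnorm N (w t) <= K%:E)%E.

Definition gpair (w : R -> R -> R) (q : R -> R) (s : R) := \int[mu]_eta (w s eta * q eta).

(** The equation [u_t - k u_eta = v] tested against Gaussians; the derivative in
    [eta] has been moved to the Gaussian. *)
Record weak_transport (k : R) (u v : R -> R -> R) : Prop := WeakTransport {
  wt_cvg0 : forall c b : R, 0 < c ->
    gpair u (gk c b) s @[s --> 0^'+] --> gpair u (gk c b) 0;
  wt_cont : forall c b s : R, 0 < c -> 0 < s ->
    {for s, continuous (gpair u (dgk c b))};
  wt_der : forall c b s : R, 0 < c -> 0 < s ->
    is_derive s (1:R) (gpair u (gk c b)) (gpair v (gk c b) s - k * gpair u (dgk c b) s)
}.

Variables (k : R) (u v : R -> R -> R).
Hypothesis tu : tempered_family u.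
Hypothesis tv : tempered_family v.
Hypothesis W : weak_transport k u v.

Let mu_u := tu.1.
Let mu_v := tv.1.
Let bound_u := tu.2.
Let bound_v := tv.2.
Let u_cvg0 := wt_cvg0 W.
Let u_cont := wt_cont W.
Let u_der := wt_der W.

Let mslice (w : R -> R -> R) t : measurable_fun setT (fun p : R * R => w p.1 p.2) ->
  measurable_fun setT (w t).
Proof. by move=> mw; exact: (measurableT_comp mw (pair1_measurable t)). Qed.

Let gk_dec (c B : R) N : 0 < c -> exists2 D, 0 <= D & forall b x, `|b| <= B ->
  `|gk c b x| <= D / (1 + x ^+ 2) ^+ N.
Proof.
move=> c0; have [D D0 h] := gk_decay B N 1 c0; exists D => // b x bB.
by have := h b x bB; rewrite hornerC mul1r.
Qed.

Let dgk_dec (c B : R) N : 0 < c -> exists2 D, 0 <= D & forall b x, `|b| <= B ->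
  `|dgk c b x| <= D / (1 + x ^+ 2) ^+ N.
Proof.
move=> c0; have [D D0 h] := gk_decay B N (- (2 * c) *: 'X) c0; exists D => // b x bB.
by have := h b x bB; rewrite hornerZ hornerX /dgk mulNr.
Qed.

Variables (c b0 : R).
Hypothesis c0 : 0 < c.
Let beta s := b0 - k * s.
Let f s := gpair u (gk c (beta s)) s.
Let m s := gpair v (gk c (beta s)) s.

Let beta_bound T s : 0 <= s <= T -> `|beta s| <= `|b0| + `|k| * T.
Proof.
move=> /andP[s0 sT]; apply: (le_trans (ler_normB _ _)).
by rewrite lerD2l normrM (ger0_norm s0) ler_wpM2l.
Qed.

Let expansion T : 0 <= T -> exists2 C, 0 <= C & forall s t, 0 <= s <= T -> 0 <= t <= T ->
  `|gpair u (gk c (beta t)) t - gpair u (gk c (beta s)) t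
     - (t - s) * (k * gpair u (dgk c (beta s)) t)| <= C * (t - s) ^+ 2.
Proof.
move=> T0; have [N [K hK]] := bound_u T0.
have [D D0 hD] := gk_taylor (`|b0| + `|k| * T) N.+1 c0.
have [D1 _ h1] := gk_dec (`|b0| + `|k| * T) N.+1 c0.
have [D2 _ h2] := dgk_dec (`|b0| + `|k| * T) N.+1 c0.
exists (k ^+ 2 * D * (`|K| + pi)).
  apply: mulr_ge0; first by rewrite mulr_ge0// sqr_ge0.
  by rewrite addr_ge0// ltW// pi_gt0.
move=> s t sT tT.
have mut := mslice t mu_u.
have ig r : 0 <= r <= T -> mu.-integrable setT (EFin \o (fun x => u t x * gk c (beta r) x)).
  move=> rT; have hx x := h1 _ x (beta_bound rT).
  exact: (wnorm_pairing mut (measurable_gk _ _) hx (hK _ tT)).1.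
have idg : mu.-integrable setT (EFin \o (fun x => u t x * dgk c (beta s) x)).
  have hx x := h2 _ x (beta_bound sT).
  exact: (wnorm_pairing mut (measurable_dgk _ _) hx (hK _ tT)).1.
pose q x := gk c (beta t) x - gk c (beta s) x + (beta t - beta s) * dgk c (beta s) x.
have mq : measurable_fun setT q.
  apply: measurable_funD; first by apply: measurable_funB; exact: measurable_gk.
  by apply: measurable_funM => //; exact: measurable_dgk.
have hq x : `|q x| <= ((beta t - beta s) ^+ 2 * D) / (1 + x ^+ 2) ^+ N.+1.
  exact: hD (beta_bound sT) (beta_bound tT).
have hK' : (wnorm N (u t) <= `|K|%:E)%E.
  by apply: (le_trans (hK _ tT)); rewrite lee_fin ler_norm.
have [_ hb] := wnorm_pairing mut mq hq hK'.
have bts : beta t - beta s = - (k * (t - s)) by rewrite /beta; ring.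
move: hb; rewrite bts sqrrN exprMn.
have -> : \int[mu]_x (u t x * q x) = gpair u (gk c (beta t)) t - gpair u (gk c (beta s)) t
     - (t - s) * (k * gpair u (dgk c (beta s)) t).
  rewrite /gpair [X in _ - X]mulrA -RintegralZl// -RintegralB//; [|exact: ig..].
  rewrite -RintegralB//.
  - by apply: eq_Rintegral => x _; rewrite /q bts; ring.
  - by apply: integrable_subr => //; exact: ig.
  - exact: integrable_scaler.
move=> h; apply: (le_trans h); rewrite le_eqVlt; apply/orP; left; apply/eqP; ring.
Qed.

Let df (s : R) : 0 < s -> is_derive s (1:R) f (m s).
Proof.
move=> s0.
have s1 : 0 <= s + 1 by rewrite addr_ge0 ?ltW.
have [C C0 hC] := expansion s1.
have sI : 0 <= s <= s + 1 by rewrite ltW//= lerDl.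
pose E t := k * gpair u (dgk c (beta s)) t.
pose B t := gpair u (gk c (beta t)) t - gpair u (gk c (beta s)) t.
have dB : is_derive s (1:R) B (E s).
  apply: (@is_derive_expansion _ B E s C (Num.min s 1)).
  - by rewrite lt_min s0 ltr01.
  - by rewrite /B subrr.
  - by apply: cvgMl_tmp; exact: u_cont.
  - move=> t; rewrite lt_min !ltr_norml => /andP[/andP[t1 t2] /andP[t3 t4]].
    apply: hC => //; apply/andP; split; lra.
have dA := u_der (beta s) c0 s0.
have fE : f = (fun t => gpair u (gk c (beta s)) t + B t).
  by apply/funext => t; rewrite /f /B addrC subrK.
rewrite fE; eapply is_derive_eq; first exact: der_add dA dB.
by rewrite /E subrK.
Qed.

Let f_cvg0 : f s @[s --> 0^'+] --> f 0.
Proof.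
have [C C0 hC] := expansion (@ler01 R).
have [N [K hK]] := bound_u (@ler01 R).
have [D D0 hD] := dgk_dec (`|b0| + `|k| * 1) N.+1 c0.
have z01 : ((0 : R) <= (0 : R) <= (1 : R))%R by rewrite lexx ler01.
pose M := `|k| * (D * (K + pi)).
have hE s : 0 <= s <= 1 -> `|k * gpair u (dgk c (beta 0)) s| <= M.
  move=> s01; rewrite normrM ler_wpM2l//.
  have hx x := hD _ x (beta_bound z01).
  exact: (wnorm_pairing (mslice s mu_u) (measurable_dgk _ _) hx (hK _ s01)).2.
have M0 : 0 <= M := le_trans (normr_ge0 _) (hE 0 z01).
have beta0 : beta 0 = b0 by rewrite /beta mulr0 subr0.
rewrite {2}/f beta0.
have := @u_cvg0 c b0 c0.
have small : (fun s => f s - gpair u (gk c b0) s) s @[s --> 0^'+] --> (0 : R).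
  apply/cvgrPdist_le => eps eps0.
  near=> s; rewrite sub0r normrN.
  have s0 : 0 < s by near: s; exact: nbhs_right_gt.
  have s1 : s <= 1 by near: s; exact: nbhs_right_le.
  have se : s <= eps / (C + M + 1) by near: s; apply: nbhs_right_le; rewrite divr_gt0// ltr_wpDl// addr_ge0.
  have s01 : 0 <= s <= 1 by rewrite ltW.
  have := hC 0 s z01 s01; rewrite subr0 -/(f s) beta0 => h.
  have h2 := hE s s01; rewrite beta0 in h2.
  rewrite -[X in `|X|](subrK (s * (k * gpair u (dgk c b0) s))).
  apply: (le_trans (ler_normD _ _)); rewrite [`|s * _|]normrM (gtr0_norm s0).
  move: se; rewrite ler_pdivlMr; last by rewrite ltr_wpDl// addr_ge0.
  have : s * `|k * gpair u (dgk c b0) s| <= s * M by rewrite ler_wpM2l// ltW.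
  have : C * s ^+ 2 <= C * s by rewrite expr2 mulrA ler_piMr// mulr_ge0// ltW.
  move: h; lra.
move=> h; have e : f = (fun s => (f s - gpair u (gk c b0) s) + gpair u (gk c b0) s).
  by apply/funext => s; rewrite subrK.
by rewrite -[X in _ --> X]add0r e; exact: (cvgD small h).
Unshelve. all: by end_near.
Qed.

Let m_bound T : 0 <= T -> exists C, forall s, 0 <= s <= T -> `|m s| <= C.
Proof.
move=> T0; have [N [K hK]] := bound_v T0.
have [D D0 hD] := gk_dec (`|b0| + `|k| * T) N.+1 c0.
exists (D * (K + pi)) => s sT.
have hx x := hD _ x (beta_bound sT).
exact: (wnorm_pairing (mslice s mu_v) (measurable_gk _ _) hx (hK _ sT)).2.
Qed.

(** With a centre that moves at speed [- k], the transport term cancels and the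
    pairing has derivative [gpair v].  That derivative is bounded, which suffices
    to integrate it. *)
Lemma weak_duhamel T : 0 < T ->
  gpair u (gk c (b0 - k * T)) T - gpair u (gk c b0) 0
  = \int[mu]_(s in `]0, T[) gpair v (gk c (b0 - k * s)) s.
Proof.
move=> T0.
(* the interval is enlarged so that difference quotients at T stay inside *)
have T10 : 0 <= T + 1 by rewrite addr_ge0// ltW.
have [C hC] := m_bound T10.
have TT1 : T < T + 1 by rewrite ltrDl.
have [_ ->] := @ftc_bounded_derivative _ f m T (T + 1) C T0 TT1 f_cvg0
  (fun s s0 _ => df s0) (fun s s0 sT => hC s (introT andP (conj (ltW s0) sT))).
by rewrite /f /beta mulr0 subr0.
Qed.

End Mild.

(** * Exchange of real integrals *)

Section Swap.
Context {R : realType}.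
Local Notation mu := (@lebesgue_measure R).

Lemma le_abse_fine (z : \bar R) : (`|(fine z)%:E| <= `|z|)%E.
Proof. by case: z => [r||] //=; rewrite ?normr0 leey. Qed.

Lemma Rintegral_swap (h : R * R -> R) : (mu \x mu)%E.-integrable setT (EFin \o h) ->
  mu.-integrable setT (EFin \o (fun x => \int[mu]_y h (x, y))) /\
  \int[mu]_x \int[mu]_y h (x, y) = \int[mu]_y \int[mu]_x h (x, y).
Proof.
move=> hi.
have iF := integrable_fubini_F hi; have mF := measurable_int _ iF.
have mG := measurable_fubini_G hi.
have mfF : measurable_fun setT (fun x => (\int[mu]_y h (x, y))%:E).
  by apply: measurable_EFinT; exact: (measurableT_comp (fine_measurable measurableT) mF).
have mfG : measurable_fun setT (fun y => (\int[mu]_x h (x, y))%:E).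
  by apply: measurable_EFinT; exact: (measurableT_comp (fine_measurable measurableT) mG).
split.
  apply: le_integrable iF => //= x _.
  exact: (le_abse_fine (fubini_F mu (EFin \o h) x)).
rewrite /Rintegral -/(Rintegral _ _ _).
have eF : (\int[mu]_x (\int[mu]_y h (x, y))%:E = \int[mu]_x \int[mu]_y (h (x, y))%:E)%E.
  apply: ae_eq_integral => //.
  apply: ae_imp (ae_integrable1 hi) => x ix _; rewrite EFin_Rintegral//.
have eG : (\int[mu]_y (\int[mu]_x h (x, y))%:E = \int[mu]_y \int[mu]_x (h (x, y))%:E)%E.
  apply: ae_eq_integral => //.
  apply: ae_imp (ae_integrable2 hi) => x ix _; rewrite EFin_Rintegral//.
congr fine; rewrite eF eG; exact: (Fubini hi).
Qed.

End Swap.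

(** * Duhamel's formula on almost every characteristic *)

Section PointwiseDuhamel.
Context {R : realType}.
Local Notation mu := (@lebesgue_measure R).
Variables (k : R) (u v : R -> R -> R).
Hypothesis tu : tempered_family u.
Hypothesis tv : tempered_family v.
Hypothesis W : weak_transport k u v.
Variable T : R.
Hypothesis T0 : 0 < T.

Let IT : set R := `]0, T[%classic.
Let mIT : measurable IT. Proof. exact: measurable_itv. Qed.
Let vt (p : R * R) := \1_IT p.2 * v p.2 (p.1 - k * p.2).

Let mI : measurable_fun setT (\1_IT : R -> R).
Proof. exact: measurable_indic. Qed.

Lemma measurable_sheared (w : R -> R -> R) : measurable_fun setT (fun p : R * R => w p.1 p.2) ->
  measurable_fun setT (fun p : R * R => w p.2 (p.1 - k * p.2)).
Proof.
move=> mw; apply: (measurableT_comp (f := fun p : R * R => w p.1 p.2) mw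
  (g := fun p : R * R => (p.2, p.1 - k * p.2))).
have h : measurable_fun setT (fun p : R * R => p.1 - k * p.2).
  by apply: measurable_funB => //; exact: measurable_funM.
exact: (measurable_fun_pair measurable_snd h).
Qed.

Let mvt : measurable_fun setT vt.
Proof.
apply: measurable_funM; first exact: (measurableT_comp mI measurable_snd).
exact: measurable_sheared tv.1.
Qed.

Let vtE eta : \int[mu]_s vt (eta, s) = \int[mu]_(s in IT) v s (eta - k * s).
Proof.
rewrite [RHS]Rintegral_mkcond; apply: eq_Rintegral => s _.
by rewrite /vt /= indicE patchE; case: ifP => _; rewrite ?mul1r ?mul0r.
Qed.

Let V eta := \int[mu]_(s in IT) v s (eta - k * s).

Let mV : measurable_fun setT V.
Proof.
rewrite (_ : V = (fun eta => \int[mu]_s vt (eta, s))); last by apply/funext => eta; rewrite vtE.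
exact: measurable_Rintegral_param.
Qed.

Let mgkp c b : measurable_fun setT (fun p : R * R => gk c b p.1).
Proof. exact: (measurableT_comp (measurable_gk c b) measurable_fst). Qed.

Let int_vt c b : 0 < c -> (mu \x mu)%E.-integrable setT (EFin \o (fun p => vt p * gk c b p.1)).
Proof.
move=> c0.
have [N [K hK]] := tv.2 T (ltW T0).
have [D D0 hD] := gk_decay (`|b| + `|k| * T) N.+1 1 c0.
have mvg : measurable_fun setT (fun p => vt p * gk c b p.1) by exact: measurable_funM.
have mvg' := measurable_EFinT mvg.
apply/integrable21ltyP => //.
apply: (@le_lt_trans _ _ (\int[mu]_s (\1_IT s * `|D * (K + pi)|)%:E)%E).
  apply: ge0_le_integral => //.
  - by move=> s _; apply: integral_ge0.
  - apply: (@measurable_fun_fubini_tonelli_G _ _ _ _ _ mu (fun p => `|(vt p * gk c b p.1)%:E|%E)) => //.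
    exact: measurableT_comp.
  - by apply: measurable_EFinT; exact: measurable_funM.
  - move=> s _; rewrite /vt/= indicE; have [sI|sI] := boolP (s \in IT); last first.
      under eq_integral do rewrite !mul0r /= normr0.
      by rewrite integral0 mul0r.
    under eq_integral do rewrite mul1r.
    rewrite mul1r.
    have s0T : 0 <= s <= T by move: sI; rewrite inE /IT/= in_itv/= => /andP[/ltW -> /ltW ->].
    pose g eta := `|(v s eta * gk c b (eta + k * s))%:E|%E.
    have mvs : measurable_fun setT (v s) by exact: (measurableT_comp tv.1 (pair1_measurable s)).
    have mgs : measurable_fun setT (fun eta : R => gk c b (eta + k * s)).
      exact: (measurableT_comp (measurable_gk c b) (measurable_affine_shift (k * s))).
    rewrite (_ : (fun x => _) = (fun x => g (x + - (k * s)))); last first.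
      by apply/funext => x; rewrite /g subrK.
    rewrite ge0_integral_shift; last 2 first.
    + apply: measurableT_comp => //; apply: measurable_EFinT; exact: measurable_funM.
    + by move=> x; rewrite /g.
    have hb : `|b - k * s| <= `|b| + `|k| * T.
      move/andP: s0T => [s0 sT]; apply: (le_trans (ler_normB _ _)).
      by rewrite lerD2l normrM (ger0_norm s0) ler_wpM2l.
    apply: (@le_trans _ _ (D * (K + pi))%:E); last by rewrite lee_fin ler_norm.
    apply: (wnorm_pairing_abs (N := N)) => //; last exact: hK.
    move=> x; have := hD (b - k * s) x hb; rewrite hornerC mul1r.
    by rewrite /gk opprB addrA.
under eq_integral do rewrite EFinM muleC.
rewrite ge0_integralZl//; last first.
  by apply: measurable_EFinT.
have mIE : (mu IT = T%:E)%E by rewrite /IT lebesgue_measure_itv/= lte_fin T0 -EFinB subr0.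
have mIE' : (\int[mu]_s (\1_IT s)%:E = T%:E)%E.
  by rewrite -mIE -[in RHS](setIT IT); exact: integral_indic.
apply: (@le_lt_trans _ _ (`|D * (K + pi)|%:E * T%:E)%E); last by rewrite -EFinM ltry.
by rewrite -mIE'; exact: lexx.
Qed.

Let vt_out c b s : s \notin IT -> \int[mu]_x (vt (x, s) * gk c b (x, s).1) = 0.
Proof.
move=> sI; rewrite /Rintegral integral0_eq// => x _.
by rewrite /vt/= indicE (negbTE sI) !mul0r.
Qed.

(** Undo the motion of the centre by translating the integration variable: the
    difference of the two sides is orthogonal to every Gaussian. *)
Lemma duhamel_ae :
  {ae mu, forall eta, mu.-integrable `]0, T[ (EFin \o (fun s => v s (eta - k * s))) /\
    u T (eta - k * T) = u 0 eta + \int[mu]_(s in `]0, T[) v s (eta - k * s)}.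
Proof.
have ae1 : {ae mu, forall eta, mu.-integrable IT (EFin \o (fun s => v s (eta - k * s)))}.
  have := ae_integrable1 (int_vt 0 (@ltr01 R)).
  apply: (@filterS _ (almost_everywhere mu)) => eta h.
  have g0 : gk 1 0 eta != 0 by rewrite gt_eqF// expR_gt0.
  have := integrable_scaler measurableT (gk 1 0 eta)^-1 h.
  move=> h2; apply/integrable_mkcond => //; rewrite restrict_EFin.
  have := h2; congr (_.-integrable _ (_ \o _)); apply/funext => s.
  rewrite patchE /vt/= indicE; case: ifP => _.
    by rewrite mul1r mulrCA mulVf// mulr1.
  by rewrite !mul0r mulr0.
suff : {ae mu, forall eta, u T (eta - k * T) - u 0 eta - V eta = 0}.
  move=> h; have := ae_and ae1 h; apply: ae_imp => eta [i1 i2]; split => //.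
  by rewrite -/IT -/(V eta); lra.
have mut t : measurable_fun setT (u t) by exact: (measurableT_comp tu.1 (pair1_measurable t)).
have muT : measurable_fun setT (fun eta : R => u T (eta - k * T)).
  exact: (measurableT_comp (mut T) (measurable_affine_shift (- (k * T)))).
have parts c b : 0 < c ->
  [/\ mu.-integrable setT (EFin \o (fun eta => u T (eta - k * T) * gk c b eta)),
      mu.-integrable setT (EFin \o (fun eta => u 0 eta * gk c b eta)),
      mu.-integrable setT (EFin \o (fun eta => V eta * gk c b eta)) &
      \int[mu]_eta (u T (eta - k * T) * gk c b eta) - \int[mu]_eta (u 0 eta * gk c b eta)
      - \int[mu]_eta (V eta * gk c b eta) = 0].
  move=> c0.
  have [N [K hK]] := tu.2 T (ltW T0).
  have [D D0 hD] := gk_decay (`|b| + `|k| * T) N.+1 1 c0.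
  have hx b' : `|b'| <= `|b| + `|k| * T -> forall x, `|gk c b' x| <= D / (1 + x ^+ 2) ^+ N.+1.
    by move=> hb' x; have := hD b' x hb'; rewrite hornerC mul1r.
  have hb0 : `|b| <= `|b| + `|k| * T by rewrite lerDl mulr_ge0// ltW.
  have hbT : `|b - k * T| <= `|b| + `|k| * T.
    by apply: (le_trans (ler_normB _ _)); rewrite normrM (gtr0_norm T0).
  have z0T : ((0 : R) <= (0 : R) <= T)%R by rewrite lexx/= ltW.
  have zTT : 0 <= T <= T by rewrite lexx ltW.
  have [i0 _] := wnorm_pairing (mut 0) (measurable_gk c b) (hx _ hb0) (hK _ z0T).
  have [iT _] := wnorm_pairing (mut T) (measurable_gk c (b - k * T)) (hx _ hbT) (hK _ zTT).
  have gkshift eta : gk c (b - k * T) (eta + - (k * T)) = gk c b eta.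
    by rewrite /gk; congr (expR (- (_ * _ ^+ 2))); ring.
  have iT' := integrable_shift (- (k * T)) iT.
  have [ih hswap] := Rintegral_swap (int_vt b c0).
  have [iV eV] : mu.-integrable setT (EFin \o (fun eta => V eta * gk c b eta)) /\
      \int[mu]_eta (V eta * gk c b eta) = \int[mu]_eta \int[mu]_s (vt (eta, s) * gk c b eta).
    have mVg : measurable_fun setT (fun eta => V eta * gk c b eta).
      by apply: measurable_funM; [exact: mV|exact: measurable_gk].
    refine (integrable_ae_eq _ _ ih _); [exact: measurableT|exact: mVg|].
    apply: ae_imp ae1 => eta iv _.
    rewrite /V -vtE /= RintegralZr; [by []|exact: measurableT|].
    have iv' : mu.-integrable setT ((EFin \o (fun s : R => v s (eta - k * s))) \_ IT).
      by refine ((integrable_mkcond _ _).1 iv); exact: mIT.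
    have := iv'; rewrite restrict_EFin.
    congr (_.-integrable _ (_ \o _)); apply/funext => s.
    by rewrite /vt/= patchE indicE; case: ifP => _; rewrite ?mul1r ?mul0r.
  split; [|exact: i0|exact: iV|].
    by have := iT'; congr (_.-integrable _ (_ \o _)); apply/funext => eta; rewrite gkshift.
  rewrite eV hswap.
  have -> : \int[mu]_eta (u T (eta - k * T) * gk c b eta) = gpair u (gk c (b - k * T)) T.
    rewrite /gpair -[RHS](Rintegral_shift (- (k * T))); last first.
      by apply: measurable_funM; [exact: mut|exact: measurable_gk].
    by apply: eq_Rintegral => eta _; rewrite gkshift.
  apply/eqP; rewrite subr_eq0; apply/eqP.
  rewrite -/(gpair u (gk c b) 0) (weak_duhamel tu tv W b c0 T0) Rintegral_mkcond.
  apply: eq_Rintegral => s _; rewrite patchE; case: ifPn => sI; last first.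
    exact: esym (vt_out _ _ sI).
  have gks eta : gk c (b - k * s) (eta + - (k * s)) = gk c b eta.
    by rewrite /gk; congr (expR (- (_ * _ ^+ 2))); ring.
  rewrite /gpair -[LHS](Rintegral_shift (- (k * s))); last first.
    apply: measurable_funM; last exact: measurable_gk.
    exact: (measurableT_comp tv.1 (pair1_measurable s)).
  by apply: eq_Rintegral => eta _; rewrite gks /vt/= indicE sI mul1r.
apply: gauss_uniqueness => c b c0; have [i1 i2 i3 e] := parts c b c0.
  have := integrable_subr measurableT (integrable_subr measurableT i1 i2) i3.
  by congr (_.-integrable _ (_ \o _)); apply/funext => eta; rewrite /gk; ring.
rewrite -[RHS]e -RintegralB// -RintegralB//; last exact: integrable_subr.
by apply: eq_Rintegral => eta _; rewrite /gk; ring.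
Qed.

End PointwiseDuhamel.

(** * Real modes of a spectrum *)

Section ModeBounds.
Context {R : realType}.
Local Notation mu := (@lebesgue_measure R).
Variables (n : int) (r1 r2 : R).
Local Notation k := (wavenumber n : R).

(** Real part of [(r1 + i r2) z].  The pairs [(1, 0)] and [(0, 1)] recover [z]
    up to sign; all linear equations are treated for real functions. *)
Definition rlin (z : R[i]) : R := r1 * complex.Re z - r2 * complex.Im z.

Lemma sqr_lin_le z : rlin z ^+ 2 <= (r1 ^+ 2 + r2 ^+ 2) * sqr_norm z.
Proof.
rewrite /rlin /sqr_norm; have := sqr_ge0 (r1 * complex.Im z + r2 * complex.Re z); nra.
Qed.

Lemma measurable_lin (f : spectrum R) : real_spectrum f -> measurable_fun setT (fun eta => rlin (f n eta)).
Proof.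
by move=> [mre mim _]; apply: measurable_funB; apply: measurable_funM => //.
Qed.

Lemma measurable_sqr_norm (f : spectrum R) (m : int) : real_spectrum f ->
  measurable_fun setT (fun eta => sqr_norm (f m eta)).
Proof.
move=> [mre mim _]; apply: measurable_funD; apply: measurable_funX; [exact: mre|exact: mim].
Qed.

Lemma sqr_norm_ge0 (z : R[i]) : 0 <= sqr_norm z.
Proof. by rewrite addr_ge0// sqr_ge0. Qed.

Lemma esum_term_le (a : int -> \bar R) (m : int) : (a m <= \esum_(i in [set: int]) a i)%E.
Proof.
apply: esum_ge; exists [set m]; last by rewrite fsbig_set1.
by split => //; exact: finite_set1.
Qed.

Lemma weighted_norm_term (w : int -> R -> R) (f : spectrum R) (K : R) :
  (forall m eta, 0 <= w m eta) ->
  (weighted_norm w f <= K%:E)%E ->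
  (\int[mu]_eta (w n eta * sqr_norm (f n eta))%:E <= (K ^+ 2)%:E)%E.
Proof.
move=> w0 h; apply: (le_trans (esum_term_le (fun m => \int[mu]_eta (w m eta * sqr_norm (f m eta))%:E)%E n)).
set S := (\esum_(i in _) _)%E in h *.
have S0 : (0 <= S)%E.
  apply: esum_ge0 => m _; apply: integral_ge0 => eta _.
  by rewrite lee_fin mulr_ge0// sqr_norm_ge0.
rewrite -(sqr_sqrte S0) EFin_expe.
by rewrite !expe2; apply: lee_pmul => //; rewrite sqrte_ge0.
Qed.

Lemma jap2_powR (s : R) (N : nat) (a b : R) : - s <= N%:R ->
  ((1 + a ^+ 2) ^+ N)^-1 / (1 + b ^+ 2) ^+ N <= jap2 a b `^ (2 * s).
Proof.
move=> sN; rewrite /jap2.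
have y1 : 1 <= 1 + a ^+ 2 + b ^+ 2 by have := sqr_ge0 a; have := sqr_ge0 b; lra.
have y0 : 0 <= 1 + a ^+ 2 + b ^+ 2 by lra.
rewrite -powR12_sqrt// -powRrM mulrA mulVf// mul1r.
rewrite -invfM -exprMn.
apply: (@le_trans _ _ ((1 + a ^+ 2 + b ^+ 2) `^ (- N%:R))); last by rewrite ler_powR// lerNl.
rewrite powRN powR_mulrn// lef_pV2 ?posrE ?exprn_gt0//; last 2 first.
- by rewrite mulr_gt0// ltr_pwDl// sqr_ge0.
- by lra.
rewrite lerXn2r ?nnegrE//; last by have := sqr_ge0 (a * b); have := sqr_ge0 a; have := sqr_ge0 b; nra.
by rewrite mulr_ge0// addr_ge0// sqr_ge0.
Qed.

(** The weight [jap2 k eta ^ (2 s)] is at least a power of [1 + eta^2] once [k] is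
    fixed, the loss being a constant that depends on [k]. *)
Lemma wnorm_lin (s K : R) : exists N L, forall f : spectrum R,
  real_spectrum f -> (H_norm s f <= K%:E)%E -> (wnorm N (fun eta => rlin (f n eta)) <= L%:E)%E.
Proof.
pose N := Num.bound (`|s|).
have sN : - s <= N%:R by rewrite (le_trans (ler_norm _))// normrN ltW// archi_boundP.
pose c : R := (r1 ^+ 2 + r2 ^+ 2) * (1 + k ^+ 2) ^+ N.
have c0 : 0 <= c by rewrite mulr_ge0 ?exprn_ge0 ?addr_ge0 ?sqr_ge0.
exists N, (c * K ^+ 2) => f rf hf.
have ht := weighted_norm_term (fun _ _ => powR_ge0 _ _) hf.
have mw : measurable_fun setT (fun eta => jap2 k eta `^ (2 * s) * sqr_norm (f n eta)).
  apply: measurable_funM; last exact: measurable_sqr_norm.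
  apply: (measurableT_comp (measurable_powR _)).
  apply: continuous_measurable_fun => x; rewrite /jap2.
  apply: continuous_comp; last exact: sqrt_continuous.
  apply: cvgD; first exact: cvg_cst.
  exact: exprn_continuous.
apply: (@le_trans _ _ (\int[mu]_eta (c%:E * (jap2 k eta `^ (2 * s) * sqr_norm (f n eta))%:E))%E).
  apply: ge0_le_integral => //.
  - by move=> x _; rewrite lee_fin; exact: (wnorm_ge0_term N (fun eta => rlin (f n eta))).
  - by apply: measurable_EFinT; apply: measurable_wnorm; exact: measurable_lin.
  - by apply: measurable_funeM; apply: measurable_EFinT.
  - move=> x _; rewrite -EFinM lee_fin.
    have x0 := sqrD1_gt0 x; have k0 := sqrD1_gt0 k.
    apply: (@le_trans _ _ ((r1 ^+ 2 + r2 ^+ 2) * sqr_norm (f n x) / (1 + x ^+ 2) ^+ N)).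
      by rewrite ler_wpM2r ?invr_ge0 ?exprn_ge0 ?(ltW x0)//; exact: sqr_lin_le.
    have h : (1 + x ^+ 2) ^- N <= (1 + k ^+ 2) ^+ N * jap2 k x `^ (2 * s).
      by have := jap2_powR k x sN; rewrite ler_pdivrMl// exprn_gt0.
    rewrite /c -!mulrA ler_wpM2l ?addr_ge0 ?sqr_ge0// mulrC mulrA.
    by apply: ler_wpM2r; first exact: sqr_norm_ge0.
rewrite ge0_integralZl//; last 2 first.
- exact: measurable_EFinT.
- by move=> x _; rewrite lee_fin mulr_ge0// ?powR_ge0// sqr_norm_ge0.
by rewrite EFinM; apply: (lee_wpmul2l _ ht); rewrite lee_fin.
Qed.

(** Cut off at negative times, where an evolution carries no information, so that
    joint measurability holds on the whole plane. *)
Definition rmode (u : R -> spectrum R) (t eta : R) : R :=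
  if 0 <= t then rlin (u t n eta) else 0.

Lemma tempered_mode (u : R -> spectrum R) : evolution u -> tempered_family (rmode u).
Proof.
move=> [mre mim rs bd]; split.
  pose D : set (R * R) := [set t : R | 0 <= t] `*` [set: R].
  have mD : measurable D.
    apply: measurableX => //.
    by rewrite (_ : [set t : R | 0 <= t] = `[0, +oo[%classic)//; apply/seteqP; split => x /=; rewrite in_itv/= andbT.
  have ml : measurable_fun D (fun p : R * R => rlin (u p.1 n p.2)).
    by apply: measurable_funB; apply: measurable_funM => //.
  have := (measurable_restrictT _ mD).1 ml.
  rewrite (_ : _ \_ D = (fun p : R * R => rmode u p.1 p.2))//.
  apply/funext => -[t x]; rewrite patchE /rmode /=.
  by case: ifPn => [/set_mem[/= -> _]//|]; case: ifPn => // t0 /negP[]; apply/mem_set; split.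
move=> T T0; have [s [K hK]] := bd T T0.
have [N [L hL]] := wnorm_lin s K.
exists N, L => t tT; have /andP[t0 _] := tT.
by rewrite /rmode t0; apply: hL; [exact: rs|exact: hK].
Qed.

Lemma tempered_mode_at u t : evolution u -> 0 <= t ->
  exists N K, (wnorm N (fun eta => rlin (u t n eta)) <= K%:E)%E.
Proof.
move=> eu t0; have [_ /(_ t t0)[N [K h]]] := tempered_mode eu.
by exists N, K; have := h t; rewrite t0 lexx /rmode t0; apply.
Qed.

End ModeBounds.

(** * Wave packets with a prescribed transform *)

Section WaveTests.
Context {R : realType}.
Local Notation mu := (@lebesgue_measure R).
Variables (n : int) (r1 r2 c b : R).
Hypothesis c0 : 0 < c.
Local Notation k := (wavenumber n : R).
Local Notation L := (rlin r1 r2).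
(* The transform of exp (- a y^2) is a multiple of exp (- c z^2). *)
Let a := (4 * c)^-1.
Let a0 : 0 < a. Proof. by rewrite invr_gt0 mulr_gt0. Qed.
Let kap := cos_transform a 1 0.

Lemma kap_gt0 : 0 < kap. Proof. exact: cos_transform1_gt0. Qed.

(** Packets whose transform is [r1 - i r2] times [w] times a Gaussian.  Pairing a
    spectrum with them yields the real function [rlin r1 r2] of its mode, and
    differential operators act on [w] alone. *)
Definition wave_weight (p q w : {poly R}) : Prop := forall z,
  htest_c a p q z = r1 * (w.[z] * (kap * expR (- (c * z ^+ 2)))) /\
  htest_s a p q z = r2 * (w.[z] * (kap * expR (- (c * z ^+ 2)))).

Let cosE z : cos_transform a 1 z = kap * expR (- (c * z ^+ 2)).
Proof.
rewrite cos_transform1//; congr (_ * expR (- _)); rewrite /a.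
by field; rewrite gt_eqF//= gt_eqF// mulr_gt0.
Qed.

Definition wave0 := gtest a k b r1%:P r2%:P.

(** The packet whose transform carries [2 c z], that is minus the derivative of
    the Gaussian: it is how the transport term acts on [wave0]. *)
Definition wave1 := gtest a k b (r2 *: 'X) (- r1 *: 'X).

Lemma wave_weight0 : wave_weight r1%:P r2%:P 1.
Proof.
move=> z; rewrite /htest_c /htest_s -!alg_polyC !cos_transformZ// !sin_transformZ//.
by rewrite sin_transform1// cosE hornerC; split; ring.
Qed.

Lemma wave_weight1 : wave_weight (r2 *: 'X) (- r1 *: 'X) ((2 * c) *: 'X).
Proof.
move=> z; rewrite /htest_c /htest_s !cos_transformZ// !sin_transformZ//.
rewrite cos_transformX// sin_transformX// cosE hornerZ hornerX /a.
by split; field; rewrite gt_eqF.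
Qed.

Lemma wave_weight_dxx p q w : wave_weight p q w ->
  wave_weight (k *: (- k *: p)) (- k *: (k *: q)) (- k ^+ 2 *: w).
Proof.
move=> h z; have [h1 h2] := h z.
by rewrite htest_c_dx// !htest_s_dx// htest_c_dx// h1 h2 hornerZ; split; ring.
Qed.

Lemma wave_weight_dyy p q w : wave_weight p q w ->
  let p' := gauss_deriv a p + b *: q in let q' := gauss_deriv a q - b *: p in
  wave_weight (gauss_deriv a p' + b *: q') (gauss_deriv a q' - b *: p')
    (- ('X + b%:P) ^+ 2 * w).
Proof.
move=> h p' q' z; have [h1 h2] := h z.
rewrite htest_c_dy// htest_s_dy// htest_c_dy// htest_s_dy// h1 h2.
by rewrite !(hornerM, hornerN, hornerD, horner_exp, hornerX, hornerC); split; ring.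
Qed.

Lemma wave_weight_dydx p q w : wave_weight p q w ->
  let p' := k *: q in let q' := - k *: p in
  wave_weight (gauss_deriv a p' + b *: q') (gauss_deriv a q' - b *: p')
    (- k *: (('X + b%:P) * w)).
Proof.
move=> h p' q' z; have [h1 h2] := h z.
rewrite htest_c_dy// htest_s_dy// htest_c_dx// htest_s_dx// h1 h2.
by rewrite !(hornerM, hornerN, hornerD, hornerZ, hornerX, hornerC); split; ring.
Qed.

Lemma wave_weight_dx_muly :
  wave_weight (k *: ('X * r2%:P)) (- k *: ('X * r1%:P)) (k *: ((2 * c) *: 'X)).
Proof.
have -> : 'X * r2%:P = r2 *: 'X by rewrite mulrC mul_polyC.
have -> : - k *: ('X * r1%:P) = k *: (- r1 *: 'X) by rewrite mulrC mul_polyC !scalerA mulrN mulNr.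
move=> z; have [h1 h2] := wave_weight1 z; move: h1 h2; rewrite /htest_c /htest_s.
rewrite !(cos_transformZ a0 (_ *: 'X) k) !(sin_transformZ a0 (_ *: 'X) k) -mulrBr -mulrDr => -> ->.
by rewrite !hornerZ; split; ring.
Qed.

Lemma dist_wave (f : spectrum R) N K p q w : real_spectrum f ->
  (wnorm N (fun eta => L (f n eta)) <= K%:E)%E -> wave_weight p q w ->
  mu.-integrable setT (EFin \o (fun eta => L (f n eta) * (w.[eta - b] * gk c b eta))) /\
  dist f (gtest a k b p q) = kap * \int[mu]_eta (L (f n eta) * (w.[eta - b] * gk c b eta)).
Proof.
move=> rf hK ww.
have [D D0 hD] := gk_decay `|b| N.+1 w c0.
have mw : measurable_fun setT (fun eta : R => w.[eta - b] * gk c b eta).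
  apply: measurable_funM; last exact: measurable_gk.
  apply: (measurableT_comp (f := fun z => w.[z])); last exact: (measurable_affine_shift (- b)).
  by apply: continuous_measurable_fun; exact: continuous_horner.
have ml := measurable_lin n r1 r2 rf.
have [iw _] := wnorm_pairing ml mw (fun x => hD b x (lexx _)) hK.
split; first exact: iw.
have e : pairing_integrand a b n f p q = (fun eta => kap * (L (f n eta) * (w.[eta - b] * gk c b eta))).
  apply/funext => eta; rewrite /pairing_integrand; have [-> ->] := ww (eta - b).
  by rewrite /rlin /gk; ring.
rewrite dist_gtest// e; last exact: (integrable_scaler measurableT _ iw).
by rewrite RintegralZl//; exact: iw.
Qed.

End WaveTests.

(** * From distributions to transport of the modes *)

Section Transport.
Context {R : realType}.
Local Notation mu := (@lebesgue_measure R).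
Variables (n : int) (r1 r2 : R).
Local Notation k := (wavenumber n : R).
Local Notation L := (rlin r1 r2).
Local Notation mode := (rmode n r1 r2).
Let kap c : R := cos_transform (4 * c)^-1 1 0.

Let kap0 c : 0 < c -> 0 < kap c. Proof. exact: kap_gt0. Qed.

Let a0 c : (0 : R) < c -> 0 < (4 * c)^-1. Proof. by move=> c0; rewrite invr_gt0 mulr_gt0. Qed.

Lemma schwartz_wave c b p q : 0 < c -> schwartz (gtest (4 * c)^-1 k b p q).
Proof. by move=> c0; apply: schwartz_gtest; [exact: a0|exact: erefl]. Qed.

Variable u : R -> spectrum R.
Hypothesis eu : evolution u.

Let rs t : 0 <= t -> real_spectrum (u t). Proof. by case: eu => _ _ h _; exact: h. Qed.

Lemma dist_mode c b t p q w : 0 < c -> 0 <= t -> wave_weight r1 r2 c p q w ->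
  dist (u t) (gtest (4 * c)^-1 k b p q) = kap c * gpair (mode u) (fun eta => w.[eta - b] * gk c b eta) t.
Proof.
move=> c0 t0 ww; have [N [K hK]] := tempered_mode_at n r1 r2 eu t0.
rewrite (dist_wave b c0 (rs t0) hK ww).2 /gpair /rmode.
by congr (_ * _); apply: eq_Rintegral => eta _; rewrite t0.
Qed.

Lemma integrable_mode c b t (w : {poly R}) : 0 < c -> 0 <= t ->
  mu.-integrable setT (EFin \o (fun eta => mode u t eta * (w.[eta - b] * gk c b eta))).
Proof.
move=> c0 t0; have [N [K hK]] := tempered_mode_at n r1 r2 eu t0.
have [D D0 hD] := gk_decay `|b| N.+1 w c0.
have mw : measurable_fun setT (fun eta : R => w.[eta - b] * gk c b eta).
  apply: measurable_funM; last exact: measurable_gk.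
  apply: (measurableT_comp (f := fun z => w.[z])); last exact: (measurable_affine_shift (- b)).
  by apply: continuous_measurable_fun; exact: continuous_horner.
have ml := measurable_lin n r1 r2 (rs t0).
have [iw _] := wnorm_pairing ml mw (fun x => hD b x (lexx _)) hK.
by rewrite /rmode t0.
Qed.

Lemma dist_mode0 c b t : 0 < c -> 0 <= t ->
  dist (u t) (wave0 n r1 r2 c b) = kap c * gpair (mode u) (gk c b) t.
Proof.
move=> c0 t0; rewrite (dist_mode b c0 t0 (wave_weight0 r1 r2 c0)); congr (_ * _).
by apply: eq_Rintegral => eta _; rewrite hornerC mul1r.
Qed.

Lemma dist_mode1 c b t : 0 < c -> 0 <= t ->
  dist (u t) (wave1 n r1 r2 c b) = - (kap c * gpair (mode u) (dgk c b) t).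
Proof.
move=> c0 t0; rewrite (dist_mode b c0 t0 (wave_weight1 r1 r2 c0)).
rewrite -mulrN -mulN1r; congr (_ * _).
rewrite /gpair -RintegralZl//; last first.
  have := integrable_mode b (- (2 * c) *: 'X) c0 t0.
  by congr (_.-integrable _ (_ \o _)); apply/funext => eta; rewrite hornerZ hornerX /dgk mulNr.
by apply: eq_Rintegral => eta _; rewrite hornerZ hornerX /dgk; ring.
Qed.

Lemma dist_muly_dx_mode c b t : 0 < c -> 0 <= t ->
  dist_muly (dist_dx (dist (u t))) (wave0 n r1 r2 c b) = kap c * (k * gpair (mode u) (dgk c b) t).
Proof.
move=> c0 t0; rewrite /dist_muly /dist_dx muly_gtest partial_x_gtest.
rewrite (dist_mode b c0 t0 (wave_weight_dx_muly n r1 r2 c0)) -mulrN; congr (_ * _).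
rewrite /gpair -RintegralZl//; last first.
  have := integrable_mode b (- (2 * c) *: 'X) c0 t0.
  by congr (_.-integrable _ (_ \o _)); apply/funext => eta; rewrite hornerZ hornerX /dgk mulNr.
rewrite -mulN1r -RintegralZl//; last exact: integrable_mode.
by apply: eq_Rintegral => eta _; rewrite !hornerZ hornerX /dgk; ring.
Qed.

Lemma near_pos (s : R) : 0 < s -> \forall x \near s, 0 <= x.
Proof. by move=> s0; near=> x; apply: ltW; near: x; exact: lt_nbhsr. Unshelve. all: by end_near. Qed.

(** The continuity required of the pairing with [dgk] is obtained by testing the
    same equation with [wave1], which makes that pairing even differentiable. *)
Lemma evolves_transport (G : R -> distr) (v : R -> R -> R) : evolves u G ->
  (forall c b t, 0 < c -> 0 < t -> G t (wave0 n r1 r2 c b) =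
     dist_muly (dist_dx (dist (u t))) (wave0 n r1 r2 c b) - kap c * gpair v (gk c b) t) ->
  weak_transport k (mode u) v.
Proof.
move=> ev hG.
have E0 c b s : 0 < c -> 0 <= s -> (kap c)^-1 * dist (u s) (wave0 n r1 r2 c b) = gpair (mode u) (gk c b) s.
  by move=> c0 s0; rewrite dist_mode0// mulKf// gt_eqF// kap0.
have E1 c b s : 0 < c -> 0 <= s -> - (kap c)^-1 * dist (u s) (wave1 n r1 r2 c b) = gpair (mode u) (dgk c b) s.
  by move=> c0 s0; rewrite dist_mode1// mulrNN mulKf// gt_eqF// kap0.
split=> [c b c0|c b s c0 s0|c b s c0 s0].
- have [h _] := ev _ (schwartz_wave b r1%:P r2%:P c0).
  rewrite -(E0 _ _ _ c0 (lexx 0)).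
  apply: (@cvg_trans _ ((fun s => (kap c)^-1 * dist (u s) (wave0 n r1 r2 c b)) @ 0^'+)); last exact: cvgMl_tmp h.
  apply: near_eq_cvg; near=> s.
  by rewrite -E0.
- have [_ /(_ s s0) h] := ev _ (schwartz_wave b (r2 *: 'X) (- r1 *: 'X) c0).
  have h1 := is_deriveZ (- (kap c)^-1) h.
  have h2 : is_derive s (1:R) (gpair (mode u) (dgk c b))
     (- (kap c)^-1 *: - G s (gtest (4 * c)^-1 k b (r2 *: 'X) (- r1 *: 'X))).
    apply: near_eq_is_derive h1; apply: filterS (near_pos s0) => x x0.
    by rewrite -E1.
  by apply: differentiable_continuous; apply/derivable1_diffP.
- have [_ /(_ s s0) h] := ev _ (schwartz_wave b r1%:P r2%:P c0).
  have h1 := is_deriveZ (kap c)^-1 h.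
  rewrite (hG _ _ _ c0 s0) (dist_muly_dx_mode _ c0 (ltW s0)) in h1.
  have h2 : is_derive s (1:R) (gpair (mode u) (gk c b))
     ((kap c)^-1 *: - (kap c * (k * gpair (mode u) (dgk c b) s) - kap c * gpair v (gk c b) s)).
    apply: near_eq_is_derive h1; apply: filterS (near_pos s0) => x x0.
    by rewrite -E0.
  eapply is_derive_eq; first exact: h2.
  rewrite /= /GRing.scale /=; field.
  by rewrite gt_eqF// kap0.
Unshelve. all: by end_near. Qed.

End Transport.

(** * Operations on tempered families *)

Section TemperedClosure.
Context {R : realType}.
Implicit Types (w : R -> R -> R) (g : R -> R).

Let mslice w t : measurable_fun setT (fun p : R * R => w p.1 p.2) -> measurable_fun setT (w t).
Proof. by move=> mw; exact: (measurableT_comp mw (pair1_measurable t)). Qed.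

Lemma tempered_familyM g j (c : R) w : measurable_fun setT g ->
  (forall x, g x ^+ 2 <= c * (1 + x ^+ 2) ^+ j) -> 0 <= c ->
  tempered_family w -> tempered_family (fun t eta => g eta * w t eta).
Proof.
move=> mg hg c0 [mw bw]; split.
  by apply: measurable_funM => //; exact: (measurableT_comp mg measurable_snd).
move=> T T0; have [N [K hK]] := bw T T0; exists (N + j)%N, (c * K) => t tT.
apply: (le_trans (wnormM N (mslice t mw) mg hg c0)).
by rewrite EFinM; apply: (lee_wpmul2l _ (hK t tT)); rewrite lee_fin.
Qed.

Lemma tempered_familyD w w' : tempered_family w -> tempered_family w' ->
  tempered_family (fun t eta => w t eta + w' t eta).
Proof.
move=> [mw bw] [mw' bw']; split; first exact: measurable_funD.
move=> T T0; have [N [K hK]] := bw T T0; have [N' [K' hK']] := bw' T T0.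
exists (N + N')%N, (2 * (K + K')) => t tT.
have m1 := mslice t mw; have m2 := mslice t mw'.
apply: (le_trans (wnormD (N + N') m1 m2)).
rewrite EFinM (EFinD K K'); apply: lee_wpmul2l; first by rewrite lee_fin.
apply: leeD.
  by apply: (le_trans (le_wnorm (leq_addr _ _) m1)); exact: hK.
by apply: (le_trans (le_wnorm (leq_addl _ _) m2)); exact: hK'.
Qed.

Lemma tempered_familyZ (a : R) w : tempered_family w -> tempered_family (fun t eta => a * w t eta).
Proof.
move=> tw; apply: (@tempered_familyM (fun=> a) 0 (a ^+ 2)) => //.
- by move=> x; rewrite expr0 mulr1.
- exact: sqr_ge0.
Qed.

Lemma tempered_family0 : tempered_family (fun _ _ : R => 0 : R).
Proof.
split; first exact: measurable_cst.
move=> T T0; exists 0, 0 => t _; rewrite /wnorm.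
by under eq_integral do rewrite expr0n/= mul0r; rewrite integral0.
Qed.

End TemperedClosure.

(** * The inverse Laplacian on a mode *)

Section InverseLaplacian.
Context {R : realType}.
Local Notation mu := (@lebesgue_measure R).
Variables (n : int) (r1 r2 : R).
Hypothesis n0 : n != 0.
Local Notation k := (wavenumber n : R).
Local Notation L := (rlin r1 r2).

Lemma wavenumber_neq0 (m : int) : m != 0 -> (wavenumber m : R) != 0.
Proof.
by move=> m0; rewrite /wavenumber mulf_neq0 ?intr_eq0// mulf_neq0// gt_eqF// pi_gt0.
Qed.

Let k0 : k != 0. Proof. exact: wavenumber_neq0. Qed.

Lemma symbol_gt0 eta : 0 < k ^+ 2 + eta ^+ 2.
Proof. by rewrite ltr_wpDr ?sqr_ge0// exprn_even_gt0. Qed.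

Lemma Re_inv_lap (f : spectrum R) m eta :
  complex.Re (inv_lap f m eta) = - (wavenumber m ^+ 2 + eta ^+ 2)^-1 * complex.Re (f m eta).
Proof. by rewrite /inv_lap; case: (f m eta) => x y /=; ring. Qed.

Lemma Im_inv_lap (f : spectrum R) m eta :
  complex.Im (inv_lap f m eta) = - (wavenumber m ^+ 2 + eta ^+ 2)^-1 * complex.Im (f m eta).
Proof. by rewrite /inv_lap; case: (f m eta) => x y /=; ring. Qed.

Lemma rlin_inv_lap (f : spectrum R) eta :
  L (inv_lap f n eta) = - (k ^+ 2 + eta ^+ 2)^-1 * L (f n eta).
Proof. by rewrite /rlin Re_inv_lap Im_inv_lap; ring. Qed.

End InverseLaplacian.

Section RealInverseLaplacian.
Context {R : realType}.

Lemma measurable_symbol_inv (m : int) : measurable_fun setT (fun eta : R => (wavenumber m ^+ 2 + eta ^+ 2)^-1).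
Proof.
rewrite (_ : (fun eta => _) = (fun eta : R => (wavenumber m ^+ 2 + eta ^+ 2) `^ (-1))).
  apply: (measurableT_comp (measurable_powR _)).
  by apply: measurable_funD => //; exact: measurable_funX.
by apply/funext => x; rewrite powR_inv1// addr_ge0// sqr_ge0.
Qed.

Lemma real_inv_lap (f : spectrum R) : real_spectrum f -> real_spectrum (inv_lap f).
Proof.
move=> [mre mim sym]; split=> [m|m|m].
- rewrite (_ : (fun eta => _) = (fun eta => - (wavenumber m ^+ 2 + eta ^+ 2)^-1 * complex.Re (f m eta))).
    apply: measurable_funM => //; apply: measurableT_comp => //; exact: measurable_symbol_inv.
  by apply/funext => eta; rewrite Re_inv_lap.
- rewrite (_ : (fun eta => _) = (fun eta => - (wavenumber m ^+ 2 + eta ^+ 2)^-1 * complex.Im (f m eta))).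
    apply: measurable_funM => //; apply: measurableT_comp => //; exact: measurable_symbol_inv.
  by apply/funext => eta; rewrite Im_inv_lap.
- apply: ae_imp (sym m) => eta h; rewrite /inv_lap h /wavenumber intrN mulrN !sqrrN.
  by case: (f m eta) => x y /=; apply/eqP; rewrite eq_complex /=; apply/andP; split; apply/eqP; ring.
Qed.

End RealInverseLaplacian.

(** * The linearized Euler system on a mode *)

Section CouetteTransport.
Context {R : realType}.
Local Notation mu := (@lebesgue_measure R).
Variables (gamma M : R) (rho_in alpha_in omega_in theta_in : spectrum R)
  (rho alpha omega theta : R -> spectrum R).
Hypothesis sol : couette_solution gamma M rho_in alpha_in omega_in theta_in rho alpha omega theta.
Variables (n : int) (r1 r2 : R).
Local Notation k := (wavenumber n : R).
Local Notation L := (rlin r1 r2).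
Local Notation mode := (rmode n r1 r2).
Let kap c : R := cos_transform (4 * c)^-1 1 0.

Let er : evolution rho. Proof. by case: (sol_class sol). Qed.
Let ea : evolution alpha. Proof. by case: (sol_class sol). Qed.
Let eo : evolution omega. Proof. by case: (sol_class sol). Qed.
Let et : evolution theta. Proof. by case: (sol_class sol). Qed.

Let igk (u : R -> spectrum R) c b t (q : {poly R}) : evolution u -> 0 < c -> 0 < t ->
  mu.-integrable setT (EFin \o (fun eta => mode u t eta * (q.[eta - b] * gk c b eta))).
Proof. by move=> eu c0 /ltW t0; exact: integrable_mode. Qed.

Let igk1 (u : R -> spectrum R) c b t : evolution u -> 0 < c -> 0 < t ->
  mu.-integrable setT (EFin \o (fun eta => mode u t eta * gk c b eta)).
Proof.
move=> eu c0 t0; have := igk b 1 eu c0 t0.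
by congr (_.-integrable _ (_ \o _)); apply/funext => eta; rewrite hornerC mul1r.
Qed.

Lemma gpairZ (r : R) (u : R -> spectrum R) c b t : evolution u -> 0 < c -> 0 < t ->
  gpair (fun t eta => r * mode u t eta) (gk c b) t = r * gpair (mode u) (gk c b) t.
Proof.
move=> eu c0 t0; rewrite /gpair -RintegralZl//; last exact: igk1.
by apply: eq_Rintegral => eta _; rewrite mulrA.
Qed.

Lemma rho_transport : weak_transport k (mode rho) (fun t eta => - 1 * mode alpha t eta).
Proof.
apply: (evolves_transport er (sol_rho sol)) => c b t c0 t0.
by rewrite gpairZ// addrfctE (dist_mode0 _ _ _ ea b c0 (ltW t0)) /kap; ring.
Qed.

Lemma omega_transport : weak_transport k (mode omega) (fun t eta => 1 * mode alpha t eta).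
Proof.
apply: (evolves_transport eo (sol_omega sol)) => c b t c0 t0.
by rewrite gpairZ// addrfctE opprfctE (dist_mode0 _ _ _ ea b c0 (ltW t0)) /kap; ring.
Qed.

Lemma theta_transport : weak_transport k (mode theta) (fun t eta => - (gamma - 1) * mode alpha t eta).
Proof.
apply: (evolves_transport et (sol_theta sol)) => c b t c0 t0.
rewrite gpairZ// addrfctE scalrfctE (dist_mode0 _ _ _ ea b c0 (ltW t0)) /kap /= /GRing.scale /=; ring.
Qed.

Hypothesis n0 : n != 0.
Hypothesis gamma0 : 0 < gamma.
Hypothesis M0 : 0 < M.
Local Notation sym := (fun eta : R => k ^+ 2 + eta ^+ 2).

(** Away from the zero mode the symbol is at least [k^2], so the inverse Laplacian
    preserves polynomial weights. *)
Lemma dist_inv_lap_mode (u : R -> spectrum R) c b t p q w : evolution u -> 0 < c -> 0 < t ->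
  wave_weight r1 r2 c p q w ->
  mu.-integrable setT (EFin \o (fun eta => mode u t eta * (- (sym eta)^-1 * (w.[eta - b] * gk c b eta)))) /\
  dist (inv_lap (u t)) (gtest (4 * c)^-1 k b p q) =
    kap c * \int[mu]_eta (mode u t eta * (- (sym eta)^-1 * (w.[eta - b] * gk c b eta))).
Proof.
move=> eu c0 t0 ww.
have rs : real_spectrum (u t) by case: eu => _ _ h _; exact/h/ltW.
have [N [K hK]] := tempered_mode_at n r1 r2 eu (ltW t0).
pose C : R := ((k ^+ 2)^-1) ^+ 2.
have C0 : 0 <= C by exact: sqr_ge0.
have k2 : 0 < k ^+ 2 by rewrite exprn_even_gt0//= wavenumber_neq0.
have mg : measurable_fun setT (fun eta => - (sym eta)^-1).
  by apply: measurableT_comp => //; exact: measurable_symbol_inv.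
have hg x : (- (sym x)^-1) ^+ 2 <= C * (1 + x ^+ 2) ^+ 0.
  rewrite expr0 mulr1 sqrrN; apply: lerXn2r; rewrite ?nnegrE ?invr_ge0.
  - by rewrite ltW// symbol_gt0.
  - exact: ltW.
  - by rewrite lef_pV2 ?posrE// ?symbol_gt0// lerDl sqr_ge0.
have hK' : (wnorm (N + 0) (fun eta => L (inv_lap (u t) n eta)) <= (C * K)%:E)%E.
  rewrite (_ : (fun eta => _) = (fun eta => - (sym eta)^-1 * L (u t n eta))); last first.
    by apply/funext => eta; rewrite rlin_inv_lap.
  apply: (le_trans (wnormM N (measurable_lin n r1 r2 rs) mg hg C0)).
  by rewrite EFinM; apply: (lee_wpmul2l _ hK); rewrite lee_fin.
have [iw dw] := dist_wave b c0 (real_inv_lap rs) hK' ww.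
have e eta : L (inv_lap (u t) n eta) * (w.[eta - b] * gk c b eta) =
    mode u t eta * (- (sym eta)^-1 * (w.[eta - b] * gk c b eta)).
  by rewrite rlin_inv_lap /rmode (ltW t0); ring.
split; first by have := iw; congr (_.-integrable _ (_ \o _)); apply/funext => eta; rewrite e.
by rewrite dw; congr (_ * _); apply: eq_Rintegral => eta _; rewrite e.
Qed.

Lemma Rintegral_comb6 (a1 a2 : R) (f1 f2 f3 f4 f5 f6 : R -> R) :
  mu.-integrable setT (EFin \o f1) -> mu.-integrable setT (EFin \o f2) ->
  mu.-integrable setT (EFin \o f3) -> mu.-integrable setT (EFin \o f4) ->
  mu.-integrable setT (EFin \o f5) -> mu.-integrable setT (EFin \o f6) ->
  \int[mu]_x (a1 * (f1 x + f2 x) + a2 * (f3 x + f4 x + f5 x + f6 x)) =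
  a1 * (\int[mu]_x f1 x + \int[mu]_x f2 x) +
  a2 * (\int[mu]_x f3 x + \int[mu]_x f4 x + \int[mu]_x f5 x + \int[mu]_x f6 x).
Proof.
move=> i1 i2 i3 i4 i5 i6.
have D := integrable_addr measurableT.
have i12 := D _ _ _ _ _ _ i1 i2; have i34 := D _ _ _ _ _ _ i3 i4.
have i345 := D _ _ _ _ _ _ i34 i5; have i36 := D _ _ _ _ _ _ i345 i6.
have z12 := integrable_scaler measurableT a1 i12; have z36 := integrable_scaler measurableT a2 i36.
rewrite (RintegralD _ z12 z36); last exact: measurableT.
rewrite RintegralZl; [|exact: measurableT|exact: i12].
rewrite RintegralZl; [|exact: measurableT|exact: i36].
rewrite (RintegralD _ i345 i6); last exact: measurableT.
rewrite (RintegralD _ i34 i5); last exact: measurableT.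
rewrite (RintegralD _ i3 i4); last exact: measurableT.
by rewrite (RintegralD _ i1 i2).
Qed.

(** Right-hand side of the equation for [alpha] on a mode, once the transport term
    is removed. *)
Definition alpha_source (t eta : R) : R :=
  - (2 * k * eta) / sym eta * mode alpha t eta
  + - (2 * k ^+ 2) / sym eta * mode omega t eta
  + (gamma * M ^+ 2)^-1 * (sym eta * (mode rho t eta + mode theta t eta)).

(** Unfolds the operations on distributions by conversion; the derivatives land on
    the test function. *)
Lemma distrE (D T1 T2 T3 T4 : @distr R) (a : R) phi :
  (D + 2 *: dist_dx (dist_dy T1 + dist_dx T2) + a *: (dist_lap T3 + dist_lap T4)) phi =
  D phi + 2 * - (- T1 (partial_y (partial_x phi)) + - T2 (partial_x (partial_x phi)))
  + a * ((- - T3 (partial_x (partial_x phi)) + - - T3 (partial_y (partial_y phi)))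
      + (- - T4 (partial_x (partial_x phi)) + - - T4 (partial_y (partial_y phi)))).
Proof. by []. Qed.

Lemma alpha_transport : weak_transport k (mode alpha) alpha_source.
Proof.
apply: (evolves_transport ea (sol_alpha sol)) => c b t c0 t0.
have w0 := wave_weight0 r1 r2 c0.
have wyx := wave_weight_dydx n b c0 w0.
have wxx := wave_weight_dxx n c0 w0.
have wyy := wave_weight_dyy b c0 w0.
rewrite distrE /wave0 !(partial_x_gtest, partial_y_gtest).
have [i1 ->] := dist_inv_lap_mode b ea c0 t0 wyx.
have [i2 ->] := dist_inv_lap_mode b eo c0 t0 wxx.
have i3 := igk b (- k ^+ 2 *: 1) er c0 t0.
have i4 := igk b (- k ^+ 2 *: 1) et c0 t0.
have i5 := igk b (- ('X + b%:P) ^+ 2 * 1) er c0 t0.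
have i6 := igk b (- ('X + b%:P) ^+ 2 * 1) et c0 t0.
rewrite (dist_mode n er b c0 (ltW t0) wxx) (dist_mode n et b c0 (ltW t0) wxx).
rewrite (dist_mode n er b c0 (ltW t0) wyy) (dist_mode n et b c0 (ltW t0) wyy).
set J1 := Rintegral _ _ _; set J2 := Rintegral _ _ _.
set J3 := gpair _ _ _; set J4 := gpair _ _ _; set J5 := gpair _ _ _; set J6 := gpair _ _ _.
suff -> : gpair alpha_source (gk c b) t =
    - 2 * (J1 + J2) - (gamma * M ^+ 2)^-1 * (J3 + J4 + J5 + J6).
  rewrite /= /GRing.scale /= /kap; ring.
rewrite -mulNr /J1 /J2 /J3 /J4 /J5 /J6 /gpair.
rewrite -(Rintegral_comb6 _ _ i1 i2 i3 i5 i4 i6).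
apply: eq_Rintegral => eta _; rewrite /alpha_source.
rewrite !(hornerZ, hornerM, hornerN, hornerD, hornerC, horner_exp, hornerX).
have s0 := symbol_gt0 n0 eta.
field.
by rewrite !gt_eqF.
Qed.

Lemma tempered_alpha_source : tempered_family alpha_source.
Proof.
have k2 : 0 < k ^+ 2 by rewrite exprn_even_gt0//= wavenumber_neq0.
have mi := measurable_symbol_inv n : measurable_fun setT (fun eta : R => (sym eta)^-1).
have i1 x : 0 < sym x by exact: symbol_gt0.
apply: tempered_familyD; first apply: tempered_familyD.
- apply: (@tempered_familyM _ _ 0 1) => //; last exact: tempered_mode.
    by apply: measurable_funM => //; apply: measurableT_comp => //; exact: measurable_funM.
  move=> x; rewrite expr0 mulr1 exprMn exprVn ler_pdivrMr ?exprn_gt0// mul1r sqrrN.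
  by have := sqr_ge0 (k ^+ 2 - x ^+ 2); nra.
- apply: (@tempered_familyM _ _ 0 4) => //; last exact: tempered_mode.
    by apply: measurable_funM.
  move=> x; rewrite expr0 mulr1 exprMn exprVn ler_pdivrMr ?exprn_gt0// sqrrN.
  have x2 := sqr_ge0 x; have : 0 <= x ^+ 2 * x ^+ 2 by rewrite mulr_ge0.
  have : 0 <= k ^+ 2 * x ^+ 2 by rewrite mulr_ge0// ltW.
  nra.
- apply: tempered_familyZ; apply: (@tempered_familyM _ _ 2 ((1 + k ^+ 2) ^+ 2)).
  + by apply: measurable_funD => //; exact: measurable_funX.
  + move=> x; rewrite -exprMn; apply: lerXn2r; rewrite ?nnegrE ?(ltW (i1 x))//.
      by rewrite mulr_ge0// addr_ge0// sqr_ge0.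
    have x2 := sqr_ge0 x; have : 0 <= k ^+ 2 * x ^+ 2 by rewrite mulr_ge0// ltW.
    nra.
  + exact: sqr_ge0.
  + by apply: tempered_familyD; exact: tempered_mode.
Qed.

(** The exceptional set of frequencies may depend on the time [T]. *)
Lemma couette_mild T : 0 < T -> {ae mu, forall eta,
  let A s := mode alpha s (eta - k * s) in
  let F s := alpha_source s (eta - k * s) in
  let J := \int[mu]_(s in `]0, T[) A s in
  [/\ mu.-integrable `]0, T[ (EFin \o A) /\ mu.-integrable `]0, T[ (EFin \o F),
      mode rho T (eta - k * T) = mode rho 0 eta - J,
      mode omega T (eta - k * T) = mode omega 0 eta + J,
      mode theta T (eta - k * T) = mode theta 0 eta - (gamma - 1) * J &
      mode alpha T (eta - k * T) = mode alpha 0 eta + \int[mu]_(s in `]0, T[) F s]}.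
Proof.
move=> T0.
have tm u : evolution u -> tempered_family (mode u) by exact: tempered_mode.
have h1 := duhamel_ae (tm _ er) (tempered_familyZ _ (tm _ ea)) rho_transport T0.
have h2 := duhamel_ae (tm _ eo) (tempered_familyZ _ (tm _ ea)) omega_transport T0.
have h3 := duhamel_ae (tm _ et) (tempered_familyZ _ (tm _ ea)) theta_transport T0.
have h4 := duhamel_ae (tm _ ea) tempered_alpha_source alpha_transport T0.
have := ae_and (ae_and h1 h2) (ae_and h3 h4).
apply: ae_imp => eta [[[_ e1] [i2 e2]] [[_ e3] [i4 e4]]].
pose A s := mode alpha s (eta - k * s).
have iA : mu.-integrable `]0, T[ (EFin \o A).
  by have := i2; congr (_.-integrable _ (_ \o _)); apply/funext => s; rewrite mul1r.
have eJ r : \int[mu]_(s in `]0, T[) (r * A s) = r * \int[mu]_(s in `]0, T[) A s.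
  by rewrite RintegralZl.
split; first by split.
- by rewrite e1 eJ mulN1r.
- by rewrite e2 eJ mul1r.
- by rewrite e3 eJ mulNr.
- by rewrite e4.
Qed.

End CouetteTransport.

(** * The zero mode *)

Section ZeroMode.
Context {R : realType}.
Local Notation mu := (@lebesgue_measure R).
Variables (gamma M : R) (rho_in alpha_in omega_in theta_in : spectrum R)
  (rho alpha omega theta : R -> spectrum R).
Hypothesis sol : couette_solution gamma M rho_in alpha_in omega_in theta_in rho alpha omega theta.

Lemma wavenumber0 : wavenumber 0 = 0 :> R.
Proof. by rewrite /wavenumber mulr0. Qed.

(** At [k = 0] there is no transport and the source [alpha] vanishes, so Duhamel's
    formula is trivial. *)
Lemma zero_mode_frozen (r1 r2 r : R) (u : R -> spectrum R) T : evolution u -> 0 < T ->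
  weak_transport (wavenumber 0) (rmode 0 r1 r2 u) (fun t eta => r * rmode 0 r1 r2 alpha t eta) ->
  zero_mean (u 0) -> {ae mu, forall eta, rmode 0 r1 r2 u T eta = 0}.
Proof.
move=> eu T0 wt u0.
have ea : evolution alpha by case: (sol_class sol).
have mean t : 0 < t -> {ae mu, forall eta, rmode 0 r1 r2 alpha t eta = 0}.
  move=> t0; have [h _] := sol_mean sol (ltW t0); apply: ae_imp h => eta.
  by rewrite /rmode (ltW t0) /rlin => -> /=; rewrite !mulr0 subrr.
have g0 c b t : 0 < t -> gpair (fun t eta => r * rmode 0 r1 r2 alpha t eta) (gk c b) t = 0.
  move=> t0; rewrite /gpair.
  have [_ ->] : mu.-integrable setT (EFin \o (fun eta => r * rmode 0 r1 r2 alpha t eta * gk c b eta)) /\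
     \int[mu]_eta (r * rmode 0 r1 r2 alpha t eta * gk c b eta) = \int[mu]_eta (cst 0 eta).
    refine (integrable_ae_eq _ _ _ _).
    - exact: measurableT.
    - apply: measurable_funM; last exact: measurable_gk.
      apply: measurable_funM => //.
      exact: (measurableT_comp (tempered_mode 0 r1 r2 ea).1 (pair1_measurable t)).
    - exact: integrable0.
    - by apply: ae_imp (mean t t0) => eta -> _; rewrite mulr0 mul0r.
  by rewrite /Rintegral /= integral0.
have wt' : weak_transport (wavenumber 0) (rmode 0 r1 r2 u) (fun _ _ => 0).
  case: wt => w1 w2 w3; split=> // c b s c0 s0.
  have := w3 c b s c0 s0; rewrite g0//.
  suff -> : gpair (fun _ _ => 0) (gk c b) s = 0 by [].
  by rewrite /gpair; under eq_Rintegral do rewrite mul0r; rewrite /Rintegral integral0.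
have := duhamel_ae (tempered_mode 0 r1 r2 eu) tempered_family0 wt' T0.
move=> h; have := ae_and h u0; apply: ae_imp => eta [[_ e] e0].
move: e; rewrite wavenumber0 mul0r subr0 => ->.
rewrite /rmode lexx /rlin e0 /= !mulr0 subrr add0r /Rintegral integral0//.
Qed.

Lemma rho_zero_mode r1 r2 T : 0 < T -> zero_mean rho_in -> {ae mu, forall eta, rmode 0 r1 r2 rho T eta = 0}.
Proof.
move=> T0 z; have [r0 _ _ _] := sol_init sol; have [er _ _ _] := sol_class sol.
by apply: (zero_mode_frozen er T0 (rho_transport sol 0 r1 r2)); rewrite r0.
Qed.

Lemma theta_zero_mode r1 r2 T : 0 < T -> zero_mean theta_in -> {ae mu, forall eta, rmode 0 r1 r2 theta T eta = 0}.
Proof.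
move=> T0 z; have [_ _ _ h0] := sol_init sol; have [_ _ _ et] := sol_class sol.
by apply: (zero_mode_frozen et T0 (theta_transport sol 0 r1 r2)); rewrite h0.
Qed.

End ZeroMode.

(** * Primitives of integrable functions *)

Section Primitive.
Context {R : realType}.
Local Notation mu := (@lebesgue_measure R).

Lemma ae_neq (s : R) : {ae mu, forall x, x != s}.
Proof.
exists [set s]; split; [exact: measurable_set1|exact: lebesgue_measure_set1|].
by move=> x /= /negP; rewrite negbK => /eqP.
Qed.

Lemma integrable_patch (D : set R) (g : R -> R) : measurable D ->
  mu.-integrable D (EFin \o g) -> mu.-integrable setT (EFin \o (g \_ D)).
Proof.
move=> mD ig; rewrite -restrict_EFin.
by refine ((integrable_mkcond _ _).1 ig); exact: mD.
Qed.

(** The integrand is known only almost everywhere.  Where it agrees a.e. with a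
    continuous function, the integral does not see the difference, and the
    fundamental theorem applies to that function. *)
Lemma primitive (g : R -> R) (T : R) : 0 < T -> mu.-integrable `]0, T[ (EFin \o g) ->
  exists G : R -> R, [/\ G 0 = 0,
    forall s, 0 <= s <= T -> G s = \int[mu]_(x in `]0, s[) g x,
    forall s, 0 <= s <= T -> {for s, continuous G} &
    forall f : R -> R, (forall s, 0 < s < T -> {for s, continuous f}) ->
      {ae mu, forall s, 0 < s < T -> g s = f s} ->
      forall s, 0 < s < T -> is_derive s (1:R) G (f s)].
Proof.
move=> T0 ig.
pose I0 : set R := `]0, T[%classic; pose IB : set R := `[-1, T + 1]%classic.
have mI0 : measurable I0 by exact: measurable_itv.
have inI0 x : (x \in I0) = (0 < x < T) by rewrite /I0 mem_setE in_itv.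
pose gh := g \_ I0.
have igh : mu.-integrable setT (EFin \o gh).
  exact: integrable_patch.
have ighS D : measurable D -> mu.-integrable D (EFin \o gh).
  by move=> mD; apply: (integrableS measurableT mD _ igh).
have mgh : measurable_fun setT gh.
  by move/measurable_int : igh => /measurable_EFinP.
pose G s := \int[mu]_(x in `[-1, s]) gh x.
have m1T : (-1 : R) < T + 1 by lra.
have cG s : -1 < s < T + 1 -> {for s, continuous G}.
  move=> sI; have := @parameterized_integral_continuous R (-1) (T + 1) gh (ltW m1T) (ighS _ (measurable_itv _)).
  by move/continuous_within_itvP => /(_ m1T)[h _ _]; apply: h; rewrite in_itv.
have GE s : 0 <= s <= T -> G s = \int[mu]_(x in `]0, s[) g x.
  move=> /andP[s0 sT]; rewrite /G [LHS]Rintegral_mkcond [RHS]Rintegral_mkcond.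
  have i2 : mu.-integrable setT (EFin \o (gh \_ `[-1, s])).
    by apply: integrable_patch; [exact: measurable_itv|apply: ighS; exact: measurable_itv].
  suff [_ ->] : mu.-integrable setT (EFin \o (g \_ `]0, s[)) /\
     \int[mu]_x (g \_ `]0, s[) x = \int[mu]_x (gh \_ `[-1, s]) x by [].
  refine (integrable_ae_eq _ _ i2 _); first exact: measurableT.
    apply/(measurable_restrictT _ _).1; first exact: measurable_itv.
    apply: (@measurable_funS _ _ _ _ I0) => //.
      by move=> x /=; rewrite /I0/= !in_itv/= => /andP[-> /lt_le_trans->].
    by move/measurable_int : ig => /measurable_EFinP.
  apply: ae_imp (ae_neq s) => x xs _.
  rewrite !patchE; have [x0s|x0s] := boolP (x \in `]0, s[%classic).
    move: x0s; rewrite inE/= in_itv/= => /andP[x0 x_s].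
    rewrite ifT; last by rewrite inE/= in_itv/= (ltW x_s) andbT; lra.
    by rewrite /gh patchE inI0 x0 (lt_le_trans x_s).
  case: ifPn => //; rewrite inE/= in_itv/= => /andP[x1 x_s].
  rewrite /gh patchE inI0; case: ifPn => // /andP[x0 xT].
  by case/negP: x0s; rewrite inE/= in_itv/= x0 lt_neqAle xs.
exists G; split => //.
- rewrite GE ?lexx ?(ltW T0)// set_itvoo0 ?Rintegral_set0//.
- by move=> s /andP[s0 sT]; apply: cG; lra.
move=> f cf gf s sT.
pose fh := f \_ I0.
have mfh : measurable_fun setT fh.
  apply/(measurable_restrictT _ _).1 => //.
  apply: open_continuous_measurable_fun; first exact: itv_open.
  by move=> x; rewrite inI0 => /cf.
have [ifh _] : mu.-integrable setT (EFin \o fh) /\ \int[mu]_x fh x = \int[mu]_x gh x.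
  refine (integrable_ae_eq _ _ igh _); [exact: measurableT|exact: mfh|].
  apply: ae_imp gf => x h _; rewrite /fh /gh !patchE inI0; by case: ifPn => // /h ->.
have ifhS D : measurable D -> mu.-integrable D (EFin \o fh).
  by move=> mD; apply: (integrableS measurableT mD _ ifh).
have GF : G = fun x => \int[mu]_(y in [set` `[-1, x]]) fh y.
  apply/funext => x; rewrite /G.
  suff [_ ->] : mu.-integrable `[-1, x] (EFin \o gh) /\
     \int[mu]_(y in `[-1, x]) gh y = \int[mu]_(y in `[-1, x]) fh y by [].
  refine (integrable_ae_eq _ _ (ifhS _ _) _).
  - exact: measurable_itv.
  - exact: measurable_funTS.
  - exact: measurable_itv.
  apply: ae_imp gf => y h _; rewrite /fh /gh !patchE inI0; by case: ifPn => // /h ->.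
have /andP[s0 s_T] := sT.
have sT1 : s < T + 1 by lra.
have s1 : -1 < s by lra.
have fhs : fh s = f s by rewrite /fh patchE inI0 sT.
have cfh : {for s, continuous fh}.
  change (fh x @[x --> s] --> fh s); rewrite fhs; apply: cvg_trans (cf s sT); apply: near_eq_cvg.
  near=> y; rewrite /fh patchE inI0 ifT//; apply/andP; split.
    near: y; exact: lt_nbhsr.
  near: y; exact: lt_nbhsl.
have [d e] := @continuous_FTC1_closed R fh (-1) s (T + 1) sT1 (ifhS _ (measurable_itv _)) s1 cfh.
rewrite GF; split; first exact: d.
by rewrite -derive1E e fhs.
Unshelve. all: by end_near. Qed.

End Primitive.

(** * Almost every time on almost every characteristic *)

Section AlmostEverywhereSections.
Context {R : realType}.
Local Notation mu := (@lebesgue_measure R).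

(** Tonelli's theorem for the indicator of the strip times [|D|]. *)
Lemma ae_sections (D : R * R -> R) (T : R) : measurable_fun setT D ->
  (forall s, 0 < s < T -> {ae mu, forall eta, D (eta, s) = 0}) ->
  {ae mu, forall eta, {ae mu, forall s, 0 < s < T -> D (eta, s) = 0}}.
Proof.
move=> mD hD.
pose IT : set R := `]0, T[%classic.
have mIT : measurable IT by exact: measurable_itv.
pose f (p : R * R) : \bar R := (\1_IT p.2 * `|D p|)%:E.
have f0 p : (0 <= f p)%E by rewrite lee_fin mulr_ge0.
have mf : measurable_fun setT f.
  apply: measurable_EFinT; apply: measurable_funM; last exact: measurableT_comp.
  exact: (measurableT_comp (measurable_indic mIT) measurable_snd).
have z0 : (\int[mu]_eta \int[mu]_s f (eta, s) = 0)%E.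
  rewrite (@fubini_tonelli _ _ _ _ _ mu mu f mf f0).
  apply: integral0_eq => s _.
  have [sI|sI] := boolP (s \in IT); last first.
    by apply: integral0_eq => eta _; rewrite /f /= indicE (negbTE sI) mul0r.
  have sT : 0 < s < T by move: sI; rewrite inE /IT/= in_itv.
  rewrite (@ae_eq_integral _ _ _ mu setT (cst 0%E)) ?integral0//.
    by apply: (measurableT_comp mf (pair2_measurable s)).
  by apply: ae_imp (hD s sT) => eta h _ /=; rewrite /f /= h normr0 mulr0.
have mF := @measurable_fun_fubini_tonelli_F _ _ _ _ _ mu f mf f0.
have F0 eta : (0 <= \int[mu]_s f (eta, s))%E by apply: integral_ge0.
have h1 : ae_eq mu setT (fun eta => \int[mu]_s f (eta, s))%E (cst 0%E).
  apply/ae_eq_integral_abs => //.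
  by under eq_integral do rewrite gee0_abs//.
apply: ae_imp h1 => eta /(_ I) h.
have h2 : ae_eq mu setT (fun s => f (eta, s)) (cst 0%E).
  apply/ae_eq_integral_abs => //.
    exact: (measurableT_comp mf (pair1_measurable eta)).
  by under eq_integral do rewrite gee0_abs//.
apply: ae_imp h2 => s /(_ I); rewrite /f/= indicE => -[] + sT.
rewrite mem_set; last by rewrite /IT/= in_itv.
by rewrite mul1r => /eqP; rewrite normr_eq0 => /eqP.
Qed.

End AlmostEverywhereSections.

Section RunningIntegral.
Context {R : realType}.
Local Notation mu := (@lebesgue_measure R).

(** An integral with a variable upper bound is a parametric integral of the
    function cut off to a measurable set of [(p, s)]. *)
Lemma measurable_running (k : R) (w : R -> R -> R) :
  measurable_fun setT (fun p : R * R => w p.1 p.2) ->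
  measurable_fun setT (fun p : R * R => \int[mu]_(s in `]0, p.2[) w s (p.1 - k * s)).
Proof.
move=> mw.
pose E : set ((R * R) * R) := [set x | 0 < x.2 < x.1.2].
have mE : measurable E.
  rewrite (_ : E = [set x | 0 < x.2] `&` [set x | x.2 < x.1.2]); last first.
    apply/seteqP; split => x /=; first by move=> /andP.
    by move=> [a b]; apply/andP.
  have m2 : measurable_fun setT (fun x : (R * R) * R => x.2) by exact: measurable_snd.
  have m12 : measurable_fun setT (fun x : (R * R) * R => x.1.2).
    exact: (measurableT_comp measurable_snd measurable_fst).
  apply: measurableI.
    have := measurable_fun_ltr (measurable_cst (0 : R)) m2 measurableT (I : measurable [set true]).
    by rewrite setTI.
  have := measurable_fun_ltr m2 m12 measurableT (I : measurable [set true]).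
  by rewrite setTI.
pose h (x : (R * R) * R) := \1_E x * w x.2 (x.1.1 - k * x.2).
have mh : measurable_fun setT h.
  apply: measurable_funM; first exact: measurable_indic.
  have m := measurable_sheared k mw.
  have mp : measurable_fun setT (fun x : (R * R) * R => (x.1.1, x.2)).
    apply: measurable_fun_pair; last exact: measurable_snd.
    exact: (measurableT_comp measurable_fst measurable_fst).
  exact: (measurableT_comp m mp).
rewrite (_ : (fun p => _) = (fun p => \int[mu]_s h (p, s))).
  exact: measurable_Rintegral_param.
apply/funext => p; rewrite Rintegral_mkcond; apply: eq_Rintegral => s _.
have eE : (p, s) \in E = (0 < s < p.2) by apply/idP/idP; [move=> /set_mem|move=> h1; apply/mem_set].
rewrite /h /= patchE indicE eE mem_setE in_itv/=.
by case: ifP; rewrite ?mul1r ?mul0r.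
Qed.

End RunningIntegral.

(** * The acoustic system on a characteristic *)

Section CharacteristicODE.
Context {R : realType}.
Local Notation mu := (@lebesgue_measure R).

(** The end values are separate parameters because [P] and [A] agree with the
    modes at the two end times, but only almost everywhere in between. *)
Record acoustic_ode (M k eta xi T p0 a0 pT aT : R) (P A : R -> R) : Prop := AcousticODE {
  ode_cont : forall s, 0 <= s <= T -> {for s, continuous P} /\ {for s, continuous A};
  ode_ends : [/\ P 0 = p0, A 0 = a0, P T = pT & A T = aT];
  ode_P : forall s, 0 < s < T -> is_derive s (1:R) P (- A s / M);
  ode_A : forall s, 0 < s < T -> is_derive s (1:R) A
    (let sym := k ^+ 2 + (eta - k * s) ^+ 2 in
     - (2 * k * (eta - k * s)) / sym * A s - 2 * k ^+ 2 / sym * (xi - M * P s) + sym / M * P s)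
}.

Variables (gamma M : R) (rho_in alpha_in omega_in theta_in : spectrum R)
  (rho alpha omega theta : R -> spectrum R).
Hypothesis sol : couette_solution gamma M rho_in alpha_in omega_in theta_in rho alpha omega theta.
Hypothesis gamma0 : 0 < gamma.
Hypothesis M0 : 0 < M.
Variables (n : int) (r1 r2 : R).
Hypothesis n0 : n != 0.
Local Notation k := (wavenumber n : R).
Local Notation mode := (rmode n r1 r2).

Definition pressure_mode t eta := (mode rho t eta + mode theta t eta) / (gamma * M).
Definition xi_mode t eta := (mode rho t eta + mode theta t eta + gamma * mode omega t eta) / gamma.
Definition entropy_mode t eta := ((gamma - 1) * mode rho t eta - mode theta t eta) / M.

Let subrD_eq0 (x a j : R) : x - a + j = 0 -> x = a - j.
Proof. by move=> h; lra. Qed.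

Let subrB_eq0 (x a j : R) : x - a - j = 0 -> x = a + j.
Proof. by move=> h; lra. Qed.

(** The primitives [J] and [H] of the sources are continuous, and [alpha] agrees
    a.e. in time with [A = alpha0 + H].  Replacing it under the integral defining
    [J] makes [J] differentiable; then all sources agree a.e. with continuous
    functions of time, and [H] is differentiable too. *)
Lemma acoustic_characteristics T : 0 < T -> {ae mu, forall eta,
  let eta' := eta - k * T in
  [/\ xi_mode T eta' = xi_mode 0 eta, entropy_mode T eta' = entropy_mode 0 eta &
   exists P A, acoustic_ode M k eta (xi_mode 0 eta) T
     (pressure_mode 0 eta) (mode alpha 0 eta) (pressure_mode T eta') (mode alpha T eta') P A]}.
Proof.
move=> T0.
have [er ea eo et] := sol_class sol.
have mj u : evolution u -> measurable_fun setT (fun p : R * R => mode u p.1 p.2).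
  by move=> eu; exact: (tempered_mode n r1 r2 eu).1.
have mF : measurable_fun setT (fun p : R * R => alpha_source gamma M rho alpha omega theta n r1 r2 p.1 p.2).
  exact: (tempered_alpha_source sol r1 r2 n0).1.
have m0 u : evolution u -> measurable_fun setT (fun p : R * R => mode u 0 p.1).
  move=> eu; apply: (measurableT_comp (f := mode u 0)); last exact: measurable_fst.
  exact: (measurableT_comp (mj u eu) (pair1_measurable (0 : R))).
have sh u : evolution u -> measurable_fun setT (fun p : R * R => mode u p.2 (p.1 - k * p.2)).
  by move=> eu; apply: (measurable_sheared k (mj u eu)).
have mJ := measurable_running k (mj _ ea).
have mJF := measurable_running k mF.
have E s := couette_mild sol r1 r2 n0 gamma0 M0 (T := s).
have Er : {ae mu, forall eta, {ae mu, forall s, 0 < s < T -> mode rho s (eta - k * s) - mode rho 0 eta +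
    \int[mu]_(t in `]0, s[) mode alpha t (eta - k * t) = 0}}.
  apply: (@ae_sections _ (fun p => mode rho p.2 (p.1 - k * p.2) - mode rho 0 p.1 +
    \int[mu]_(t in `]0, p.2[) mode alpha t (p.1 - k * t))).
    by apply: measurable_funD => //; apply: measurable_funB; [exact: sh|exact: m0].
  by move=> s /andP[s0 _]; apply: ae_imp (E s s0) => eta [_ -> _ _ _] /=; ring.
have Eo : {ae mu, forall eta, {ae mu, forall s, 0 < s < T -> mode omega s (eta - k * s) - mode omega 0 eta -
    \int[mu]_(t in `]0, s[) mode alpha t (eta - k * t) = 0}}.
  apply: (@ae_sections _ (fun p => mode omega p.2 (p.1 - k * p.2) - mode omega 0 p.1 -
    \int[mu]_(t in `]0, p.2[) mode alpha t (p.1 - k * t))).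
    by apply: measurable_funB => //; apply: measurable_funB; [exact: sh|exact: m0].
  by move=> s /andP[s0 _]; apply: ae_imp (E s s0) => eta [_ _ -> _ _] /=; ring.
have Et : {ae mu, forall eta, {ae mu, forall s, 0 < s < T -> mode theta s (eta - k * s) - mode theta 0 eta +
    (gamma - 1) * \int[mu]_(t in `]0, s[) mode alpha t (eta - k * t) = 0}}.
  apply: (@ae_sections _ (fun p => mode theta p.2 (p.1 - k * p.2) - mode theta 0 p.1 +
    (gamma - 1) * \int[mu]_(t in `]0, p.2[) mode alpha t (p.1 - k * t))).
    apply: measurable_funD; last exact: measurable_funM.
    by apply: measurable_funB; [exact: sh|exact: m0].
  by move=> s /andP[s0 _]; apply: ae_imp (E s s0) => eta [_ _ _ -> _] /=; ring.
have Ea : {ae mu, forall eta, {ae mu, forall s, 0 < s < T -> mode alpha s (eta - k * s) - mode alpha 0 eta -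
    \int[mu]_(t in `]0, s[) alpha_source gamma M rho alpha omega theta n r1 r2 t (eta - k * t) = 0}}.
  apply: (@ae_sections _ (fun p => mode alpha p.2 (p.1 - k * p.2) - mode alpha 0 p.1 -
    \int[mu]_(t in `]0, p.2[) alpha_source gamma M rho alpha omega theta n r1 r2 t (p.1 - k * t))).
    by apply: measurable_funB => //; apply: measurable_funB; [exact: sh|exact: m0].
  by move=> s /andP[s0 _]; apply: ae_imp (E s s0) => eta [_ _ _ _ ->] /=; ring.
have := ae_and (E T T0) (ae_and (ae_and Er Eo) (ae_and Et Ea)).
apply: ae_imp => eta [[[iA iF] rT oT tT aT] [[hr ho] [ht ha]]].
have g_ne : gamma != 0 by rewrite gt_eqF.
have M_ne : M != 0 by rewrite gt_eqF.
split.
- by rewrite /xi_mode rT oT tT; field.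
- by rewrite /entropy_mode rT tT; field.
have [J [J0 JE Jc Jd]] := primitive T0 iA.
have [H [H0 HE Hc Hd]] := primitive T0 iF.
exists (fun s => pressure_mode 0 eta - J s / M), (fun s => mode alpha 0 eta + H s).
have TT : 0 <= T <= T by rewrite lexx (ltW T0).
have cP s : 0 <= s <= T -> {for s, continuous (fun s => pressure_mode 0 eta - J s / M)}.
  by move=> /Jc c; apply: cvgB; [exact: cvg_cst|exact: cvgMr_tmp].
have cA s : 0 <= s <= T -> {for s, continuous (fun s => mode alpha 0 eta + H s)}.
  by move=> /Hc c; apply: cvgD; [exact: cvg_cst|].
have dJ s : 0 < s < T -> is_derive s (1:R) J (mode alpha 0 eta + H s).
  move=> sT; apply: (Jd (fun s => mode alpha 0 eta + H s)) => //.
    by move=> t /andP[/ltW t0 /ltW tT']; apply: cA; rewrite t0.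
  apply: ae_imp ha => t h tT'; have := h tT'.
  by rewrite (HE t); [exact: subrB_eq0|move: tT' => /andP[/ltW -> /ltW ->]].
split.
- by move=> s sT; split; [exact: cP|exact: cA].
- rewrite J0 H0 mul0r subr0 addr0 (HE T TT) (JE T TT) -aT; split => //.
  by rewrite /pressure_mode rT tT; field; rewrite g_ne M_ne.
- move=> s sT; have d := dJ s sT.
  eapply is_derive_eq; first by apply: is_deriveB; apply: der_mul.
  by rewrite /GRing.scale /=; field.
- move=> s sT /=.
  have dsym (t : R) : is_derive t (1:R) (fun s => k ^+ 2 + (eta - k * s) ^+ 2) (- (2 * k * (eta - k * t))).
    by deriv; rewrite /=; ring.
  have dlin (t : R) : is_derive t (1:R) (fun s => - (2 * k * (eta - k * s))) (2 * k ^+ 2).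
    by deriv; rewrite /=; ring.
  have csym := der_continuous dsym; have clin := der_continuous dlin.
  have sym_ne t : k ^+ 2 + (eta - k * t) ^+ 2 != 0 by rewrite gt_eqF// symbol_gt0.
  pose f s := (- (2 * k * (eta - k * s)) / (k ^+ 2 + (eta - k * s) ^+ 2) * (mode alpha 0 eta + H s)
     - 2 * k ^+ 2 / (k ^+ 2 + (eta - k * s) ^+ 2) * (xi_mode 0 eta - M * (pressure_mode 0 eta - J s / M))
     + (k ^+ 2 + (eta - k * s) ^+ 2) / M * (pressure_mode 0 eta - J s / M)).
  have d : is_derive s (1:R) H (f s); first apply: (Hd f) => //.
  + move=> t /andP[/ltW t0 /ltW tT'].
    have tI : 0 <= t <= T by rewrite t0.
    have cs : {for t, continuous (fun s => (k ^+ 2 + (eta - k * s) ^+ 2)^-1)}.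
      by apply: cvgV; [exact: sym_ne|exact: csym].
    apply: cvgD; [apply: cvgB|].
    * by apply: cvgM; [apply: cvgM; [exact: clin|exact: cs]|exact: cA].
    * apply: cvgM; first by apply: cvgMl_tmp; exact: cs.
      by apply: cvgB; [exact: cvg_cst|apply: cvgMl_tmp; exact: cP].
    * by apply: cvgM; [apply: cvgMr_tmp; exact: csym|exact: cP].
  + have := ae_and (ae_and hr ho) (ae_and ht ha).
    apply: ae_imp => t [[h1 h2] [h3 h4]] tT'.
    have tI : 0 <= t <= T by move: tT' => /andP[/ltW -> /ltW ->].
    move: (h1 tT') (h2 tT') (h3 tT') (h4 tT'); rewrite -!(JE t tI) -!(HE t tI) /alpha_source.
    move=> e1 e2 e3 e4; have sn := sym_ne t.
    rewrite /xi_mode /pressure_mode.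
    rewrite (subrD_eq0 e1) (subrB_eq0 e2) (subrD_eq0 e3) (subrB_eq0 e4).
    by rewrite /f /xi_mode /pressure_mode; field; rewrite g_ne M_ne.
  eapply is_derive_eq; first by apply: der_add.
  by rewrite add0r.
Qed.

End CharacteristicODE.

(** * The acoustic energy *)

Section AcousticEnergy.
Context {R : realType}.

Definition inv_jap (s : R) : R := (Num.sqrt (1 + s ^+ 2))^-1.

Lemma inv_jap_gt0 s : 0 < inv_jap s.
Proof. by rewrite invr_gt0 sqrtr_gt0 sqrD1_gt0. Qed.

Lemma inv_jap_sqr s : inv_jap s ^+ 2 = (1 + s ^+ 2)^-1.
Proof. by rewrite exprVn sqr_sqrtr// ltW// sqrD1_gt0. Qed.

Lemma is_derive_inv_jap (s : R) : is_derive s (1:R) inv_jap (- s * inv_jap s ^+ 3).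
Proof.
have q0 := sqrD1_gt0 s.
have d1 : is_derive s (1:R) (fun s : R => 1 + s ^+ 2) (2 * s) by deriv; rewrite /=; ring.
have d2 := @der_comp _ Num.sqrt (fun s : R => 1 + s ^+ 2) s _ _ (is_derive1_sqrt q0) d1.
have sq : Num.sqrt (1 + s ^+ 2) != 0 by rewrite gt_eqF// sqrtr_gt0.
have := @der_inv _ (fun s : R => Num.sqrt (1 + s ^+ 2)) s _ sq d2; rewrite /inv_jap => d; eapply is_derive_eq; first exact: d.
by field.
Qed.

Lemma mul_le_bound (c C b B : R) : `|c| <= C -> `|b| <= B -> c * b <= C * B.
Proof. by move=> cC bB; apply: (le_trans (ler_norm _)); rewrite normrM ler_pM. Qed.

(** Growth rate of the energy once the integrable factor [1 / (1 + s^2)] is taken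
    out.  Here [x], [y], [z] are the three squares in the energy and [b1], [b2],
    [b3] the mixed products, dominated by them; [h (1 + s^2)] and [s h] are at
    most [1]. *)
Lemma energy_bracket (M s h q x y z g b1 b2 b3 : R) : 0 < M -> q = 1 + s ^+ 2 -> h * (q + M) = 1 -> 0 < h ->
  0 <= x -> 0 <= y -> 0 <= z -> 0 <= g <= x ->
  2 * `|b1| <= x + y -> 2 * `|b2| <= y + z -> 2 * `|b3| <= x + z ->
  M * (s * h) * (y - x) - 4 * b2 + 4 * M * b1
   + M * (h * q - 3 * (s ^+ 2 * h) - 2 * (s ^+ 2 * h) * (h * q)) * b1
   + 2 * (M * (s ^+ 2 * h)) * b1 - 2 * (M * (s * h)) * b3 + 2 * M * (M * (s * h)) * g
  <= (2 + 8 * M + 2 * M ^+ 2) * (x + y + z).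
Proof.
move=> M0 qE hE h0 x0 y0 z0 /andP[g0 gx] hb1 hb2 hb3.
have s2 := sqr_ge0 s.
have hq : h * q <= 1 by rewrite -hE mulrDr lerDl mulr_ge0// ltW.
have sg1 : s ^+ 2 * h <= 1 by rewrite mulrC; apply: (le_trans _ hq); rewrite ler_wpM2l ?(ltW h0)// qE; lra.
have sg0 : 0 <= s ^+ 2 * h by rewrite mulr_ge0// ltW.
have hq0 : 0 <= h * q by rewrite mulr_ge0 ?(ltW h0)// qE; lra.
have sq : `|s| <= q by rewrite qE ler_norml; apply/andP; split; have := sqr_ge0 (s + 1); have := sqr_ge0 (s - 1); nra.
have sh : `|s * h| <= 1.
  by rewrite normrM (gtr0_norm h0) mulrC; apply: (le_trans _ hq); rewrite ler_wpM2l ?(ltW h0).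
have Msh : `|M * (s * h)| <= M by rewrite normrM (gtr0_norm M0) ler_piMr// ltW.
have t1 : M * (s * h) * (y - x) <= M * (x + y) by apply: mul_le_bound => //; rewrite ler_norml; lra.
have t2 : - b2 <= `|b2| by rewrite -normrN ler_norm.
have t3 : M * b1 <= M * `|b1| by rewrite ler_wpM2l ?(ltW M0)// ler_norm.
have t3' : M * (2 * `|b1|) <= M * (x + y) by rewrite ler_wpM2l// ltW.
have sgq : 0 <= s ^+ 2 * h * (h * q) by rewrite mulr_ge0.
have sgq1 : s ^+ 2 * h * (h * q) <= 1 by rewrite mulr_ile1.
have t4 : M * (h * q - 3 * (s ^+ 2 * h) - 2 * (s ^+ 2 * h) * (h * q)) * b1 <= (M * 6) * `|b1|.
  apply: mul_le_bound => //; rewrite normrM (gtr0_norm M0) ler_wpM2l ?(ltW M0)// ler_norml.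
  by rewrite -(mulrA 2); apply/andP; split; lra.
have t5 : M * (s ^+ 2 * h) * b1 <= M * `|b1|.
  apply: mul_le_bound => //; rewrite normrM (gtr0_norm M0) ler_piMr ?(ltW M0)//.
  by rewrite ger0_norm.
have t6 : M * (s * h) * - b3 <= M * `|b3| by apply: mul_le_bound => //; rewrite normrN.
have t6' : M * (2 * `|b3|) <= M * (x + z) by rewrite ler_wpM2l// ltW.
have t7 : M * (s * h) * g <= M * x by apply: mul_le_bound => //; rewrite ger0_norm.
have t7' : M * (M * (s * h) * g) <= M * (M * x) by rewrite ler_wpM2l// ltW.
have Mz : 0 <= M * z by rewrite mulr_ge0// ltW.
have Mx : 0 <= M * x by rewrite mulr_ge0// ltW.
have My : 0 <= M * y by rewrite mulr_ge0// ltW.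
have MMy : 0 <= M * (M * y) by rewrite mulr_ge0// ltW.
have MMz : 0 <= M * (M * z) by rewrite mulr_ge0// ltW.
lra.
Qed.

Lemma energy_products (k j P A X : R) : 1 <= `|k| -> 0 < j -> j <= 1 ->
  let x := j * P ^+ 2 in let y := j ^+ 3 * A ^+ 2 / k ^+ 2 in let z := X ^+ 2 / k ^+ 2 in
  [/\ 2 * `|j ^+ 2 * (P * A) / k| <= x + y, 2 * `|j ^+ 3 * (P * A) / k ^+ 2| <= x + y,
      2 * `|j ^+ 3 * (A * X) / k ^+ 2| <= y + z, 2 * `|j ^+ 3 * (P * X) / k ^+ 2| <= x + z &
      0 <= j ^+ 3 * P ^+ 2 / k ^+ 2 <= x].
Proof.
move=> k1 j0 j1 x y z.
have k0 : k != 0 by rewrite -normr_gt0 (lt_le_trans _ k1).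
have ki : `|k^-1| <= 1 by rewrite normfV invf_le1// (lt_le_trans _ k1).
have k2 : 0 < k ^- 2 by rewrite invr_gt0 exprn_even_gt0.
have k2' : k ^- 2 <= 1.
  by rewrite invf_le1 ?exprn_even_gt0// -[k ^+ 2]real_normK ?num_real// exprn_ege1.
have j3 : j ^+ 3 <= 1 by rewrite exprn_ile1// ltW.
have j3' : j ^+ 3 <= j by rewrite exprSr ler_piMl ?(ltW j0)// exprn_ile1// ltW.
have j30 : 0 < j ^+ 3 by rewrite exprn_gt0.
have am (a b : R) : 2 * `|a * b| <= a ^+ 2 + b ^+ 2.
  rewrite normrM -[a ^+ 2]real_normK ?num_real// -[b ^+ 2]real_normK ?num_real//.
  by have := sqr_ge0 (`|a| - `|b|); nra.
have u : 2 * `|j ^+ 2 * (P * A) / k| <= x + y.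
  have -> : j ^+ 2 * (P * A) / k = j * (P * (j * A / k)) by ring.
  rewrite normrM (gtr0_norm j0) mulrCA /x /y.
  have -> : j * P ^+ 2 + j ^+ 3 * A ^+ 2 / k ^+ 2 = j * (P ^+ 2 + (j * A / k) ^+ 2) by field.
  by rewrite ler_wpM2l ?(ltW j0).
split => //.
- have -> : j ^+ 3 * (P * A) / k ^+ 2 = (j / k) * (j ^+ 2 * (P * A) / k) by field.
  rewrite normrM; apply: (le_trans _ u); rewrite ler_wpM2l// ler_piMl//.
  by rewrite normrM (gtr0_norm j0) mulr_ile1// ltW.
- have -> : j ^+ 3 * (A * X) / k ^+ 2 = j ^+ 3 * k ^- 2 * (A * X) by field.
  rewrite normrM (gtr0_norm (mulr_gt0 j30 k2)) mulrCA.
  apply: (@le_trans _ _ (j ^+ 3 * k ^- 2 * (A ^+ 2 + X ^+ 2))).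
    by rewrite ler_wpM2l// ltW// mulr_gt0.
  have : j ^+ 3 * (X ^+ 2 * k ^- 2) <= 1 * (X ^+ 2 * k ^- 2).
    by rewrite ler_wpM2r// mulr_ge0 ?sqr_ge0// ltW.
  rewrite /y /z; lra.
- have -> : j ^+ 3 * (P * X) / k ^+ 2 = j ^+ 3 * k ^- 2 * (P * X) by field.
  rewrite normrM (gtr0_norm (mulr_gt0 j30 k2)) mulrCA.
  apply: (@le_trans _ _ (j ^+ 3 * k ^- 2 * (P ^+ 2 + X ^+ 2))).
    by rewrite ler_wpM2l// ltW// mulr_gt0.
  rewrite mulrDr /x /z; apply: lerD.
    rewrite ler_wpM2r ?sqr_ge0//; apply: (le_trans _ j3').
    by rewrite ler_piMr// ltW.
  by rewrite -mulrA (mulrC _ (X ^+ 2)) ler_piMl// mulr_ge0 ?sqr_ge0// ltW.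
- apply/andP; split; first by rewrite mulr_ge0 ?(ltW k2)// mulr_ge0 ?sqr_ge0// ltW.
  rewrite /x mulrAC ler_wpM2r ?sqr_ge0//; apply: (le_trans _ j3').
  by rewrite ler_piMr// ltW.
Qed.

Lemma inv_jap_le1 s : inv_jap s <= 1.
Proof. by rewrite invf_le1 ?sqrtr_gt0 ?sqrD1_gt0// -[leLHS]sqrtr1 ler_wsqrtr// sqrD1_ge1. Qed.

Definition acoustic_mass (k s P A X : R) : R :=
  inv_jap s * P ^+ 2 + inv_jap s ^+ 3 * A ^+ 2 / k ^+ 2 + X ^+ 2 / k ^+ 2.

Lemma acoustic_mass_ge0 k s P A X : 0 <= acoustic_mass k s P A X.
Proof.
have j0 := ltW (inv_jap_gt0 s).
apply: addr_ge0; last by rewrite divr_ge0 ?sqr_ge0.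
apply: addr_ge0; first by apply: mulr_ge0 => //; exact: sqr_ge0.
by rewrite divr_ge0 ?sqr_ge0//; apply: mulr_ge0; [exact: exprn_ge0|exact: sqr_ge0].
Qed.

(** The derivative of the cross term cancels, to leading order in [s], the part
    [s / (1 + s^2) (y - x)] of the derivative of the squares [x] and [y] of [P] and
    [A], which decays too slowly to be integrated.  The denominator [1 + s^2 + M]
    keeps the cross term below half of the squares for all [M > 0]. *)
Definition acoustic_energy (M k s P A X : R) : R :=
  inv_jap s * P ^+ 2 + inv_jap s ^+ 3 * A ^+ 2 / k ^+ 2
  + M * s * inv_jap s ^+ 3 * (1 + s ^+ 2 + M)^-1 * (P * A) / k ^+ 2 + X ^+ 2 / k ^+ 2.

Definition energy_rate (M : R) : R := 2 + 8 * M + 2 * M ^+ 2.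

(** Relative to the geometric mean of the two squares, the cross term has the
    coefficient [M / (1 + s^2 + M) * s / sqrt (1 + s^2) / k], at most [1] in
    absolute value. *)
Lemma energy_equiv (M k s P A X : R) : 0 < M -> 1 <= `|k| ->
  acoustic_mass k s P A X <= 2 * acoustic_energy M k s P A X /\
  acoustic_energy M k s P A X <= 2 * acoustic_mass k s P A X.
Proof.
move=> M0 k1; have [u _ _ _ _] := energy_products P A X k1 (inv_jap_gt0 s) (inv_jap_le1 s).
have k0 : k != 0 by rewrite -normr_gt0 (lt_le_trans _ k1).
have q0 := sqrD1_gt0 s; have qM0 : 0 < 1 + s ^+ 2 + M by rewrite addr_gt0.
have j0 := inv_jap_gt0 s.
have sj : `|s * inv_jap s| <= 1.
  rewrite -(@expr_le1 _ 2)// real_normK ?num_real// exprMn inv_jap_sqr ler_pdivrMr// mul1r; lra.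
have Mh : `|M / (1 + s ^+ 2 + M)| <= 1 by rewrite ger0_norm; [rewrite ler_pdivrMr// mul1r; lra|rewrite divr_ge0// ltW].
have ki : `|k^-1| <= 1 by rewrite normfV invf_le1// (lt_le_trans _ k1).
set U := inv_jap s ^+ 2 * (P * A) / k in u.
have hc : M * s * inv_jap s ^+ 3 * (1 + s ^+ 2 + M)^-1 * (P * A) / k ^+ 2 =
  (M / (1 + s ^+ 2 + M)) * (s * inv_jap s) * k^-1 * U by rewrite /U; field; rewrite k0 gt_eqF.
have cU : `|(M / (1 + s ^+ 2 + M)) * (s * inv_jap s) * k^-1 * U| <= `|U|.
  by rewrite normrM ler_piMl// normrM mulr_ile1// normrM mulr_ile1.
rewrite /acoustic_mass /acoustic_energy hc.
have z0 : 0 <= X ^+ 2 / k ^+ 2 by rewrite divr_ge0 ?sqr_ge0.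
move: cU u; set c := _ * U => cU u.
have := ler_norm c; have := ler_norm (- c); rewrite normrN; split; lra.
Qed.

(** The factor [j^2 = 1 / (1 + s^2)] of the whole derivative is what the choice of
    the cross term achieves. *)
Lemma is_derive_energy (M k c0 X t : R) (P A : R -> R) : 0 < M -> k != 0 ->
  let s := t - c0 in let j := inv_jap s in let q := 1 + s ^+ 2 in
  is_derive t (1:R) P (- A t / M) ->
  is_derive t (1:R) A (2 * s / q * A t - 2 / q * (X - M * P t) + k ^+ 2 * q / M * P t) ->
  is_derive t (1:R) (fun t => acoustic_energy M k (t - c0) (P t) (A t) X)
    (j ^+ 2 * (let h := (q + M)^-1 in
      let x := j * P t ^+ 2 in let y := j ^+ 3 * A t ^+ 2 / k ^+ 2 in
      let b1 := j ^+ 3 * (P t * A t) / k ^+ 2 in let b2 := j ^+ 3 * (A t * X) / k ^+ 2 in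
      let b3 := j ^+ 3 * (P t * X) / k ^+ 2 in let g := j ^+ 3 * P t ^+ 2 / k ^+ 2 in
      M * (s * h) * (y - x) - 4 * b2 + 4 * M * b1
       + M * (h * q - 3 * (s ^+ 2 * h) - 2 * (s ^+ 2 * h) * (h * q)) * b1
       + 2 * (M * (s ^+ 2 * h)) * b1 - 2 * (M * (s * h)) * b3 + 2 * M * (M * (s * h)) * g)).
Proof.
move=> M0 k0 s j q dP dA.
have q0 : 0 < q by exact: sqrD1_gt0.
have j0 : 0 < j by exact: inv_jap_gt0.
have ds : is_derive t (1:R) (fun t => t - c0) 1 by deriv; rewrite /=; ring.
pose jf t := inv_jap (t - c0).
have dj : is_derive t (1:R) jf (- s * j ^+ 3).
  eapply is_derive_eq; first exact: (@der_comp _ inv_jap (fun t => t - c0) t _ _ (is_derive_inv_jap (t - c0)) ds).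
  by rewrite mulr1.
pose hf t := (1 + (t - c0) ^+ 2 + M)^-1.
have qM : 1 + (t - c0) ^+ 2 + M != 0 by rewrite gt_eqF// addr_gt0.
have dh : is_derive t (1:R) hf (- (2 * s) * hf t ^+ 2).
  have d1 : is_derive t (1:R) (fun t => 1 + (t - c0) ^+ 2 + M) (2 * s) by deriv; rewrite /= /s; ring.
  eapply is_derive_eq; first exact: (@der_inv _ (fun t => 1 + (t - c0) ^+ 2 + M) t _ qM d1).
  by rewrite /hf; field.
rewrite (_ : (fun t => _) = (fun t => jf t * P t ^+ 2 + jf t ^+ 3 * A t ^+ 2 / k ^+ 2
  + M * (t - c0) * jf t ^+ 3 * hf t * (P t * A t) / k ^+ 2 + X ^+ 2 / k ^+ 2))//.
deriv.
have hE : hf t = (j ^- 2 + M)^-1 by rewrite /hf /j inv_jap_sqr invrK.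
have qE : q = j ^- 2 by rewrite /j inv_jap_sqr invrK.
have jE : jf t = j by [].
rewrite /= -/s hE jE qE.
have jn : j != 0 by rewrite gt_eqF.
have jM : 1 + M * j ^+ 2 != 0 by rewrite gt_eqF// addr_gt0// mulr_gt0// exprn_gt0.
field.
by rewrite k0 jn jM gt_eqF.
Qed.

Lemma continuous_energy (M k c0 X : R) (P A : R -> R) (t : R) : 0 < M ->
  {for t, continuous P} -> {for t, continuous A} ->
  {for t, continuous (fun t => acoustic_energy M k (t - c0) (P t) (A t) X)}.
Proof.
move=> M0 cP cA; rewrite /acoustic_energy.
have ds (x : R) : is_derive x (1:R) (fun t => t - c0) 1 by deriv; rewrite /=; ring.
have cs : {for t, continuous (fun t => t - c0)} by exact: (der_continuous ds).
have dj (x : R) := @der_comp _ inv_jap (fun t => t - c0) x _ _ (is_derive_inv_jap (x - c0)) (ds x).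
have cj : {for t, continuous (fun t => inv_jap (t - c0))} by exact: (der_continuous dj).
have cX (f : R -> R) n : {for t, continuous f} -> {for t, continuous (fun t => f t ^+ n)}.
  by move=> cf; apply: (@cvg_comp _ _ _ f (fun x => x ^+ n) _ _ _ cf); exact: exprn_continuous.
have ch : {for t, continuous (fun t => (1 + (t - c0) ^+ 2 + M)^-1)}.
  apply: cvgV; first by rewrite gt_eqF// addr_gt0// sqrD1_gt0.
  apply: cvgD; last exact: cvg_cst.
  by apply: cvgD; [exact: cvg_cst|exact: cX].
apply: cvgD; last exact: cvg_cst.
apply: cvgD; first apply: cvgD.
- by apply: cvgM; [exact: cj|exact: cX].
- by apply: cvgMr_tmp; apply: cvgM; exact: cX.
- apply: cvgMr_tmp; apply: cvgM; last by apply: cvgM; [exact: cP|exact: cA].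
  apply: cvgM; last exact: ch.
  by apply: cvgM; [apply: cvgMl_tmp; exact: cs|exact: cX].
Qed.

Definition energy_factor (M : R) : R := 4 * expR (2 * energy_rate M * pi).

(** Gronwall's inequality with rate [K / (1 + s^2)]: the energy times
    [exp (- K atan s)] is nonincreasing, and [atan] varies by less than [pi]. *)
Lemma acoustic_estimate (M k eta xi T p0 a0 pT aT : R) (P A : R -> R) :
  0 < M -> 1 <= `|k| -> 0 < T -> acoustic_ode M k eta xi T p0 a0 pT aT P A ->
  acoustic_mass k (T - eta / k) pT aT xi <= energy_factor M * acoustic_mass k (- (eta / k)) p0 a0 xi.
Proof.
move=> M0 k1 T0 [cPA [P0 A0 PT AT] dP dA].
have k0 : k != 0 by rewrite -normr_gt0 (lt_le_trans _ k1).
pose c0 := eta / k; pose K := 2 * energy_rate M.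
have K0 : 0 <= energy_rate M by rewrite /energy_rate; have := sqr_ge0 M; lra.
pose E t := acoustic_energy M k (t - c0) (P t) (A t) xi.
(* exp (- K atan s) is the integrating factor of the rate K / (1 + s^2) *)
pose G t := E t * expR (- (K * atan (t - c0))).
have dE t : 0 < t < T -> exists2 dE, is_derive t (1:R) E dE & dE <= inv_jap (t - c0) ^+ 2 * (K * E t).
  move=> tT; have qt := sqrD1_gt0 (t - c0).
  have dA' := dA t tT; rewrite /= in dA'.
  have dA2 : is_derive t (1:R) A (2 * (t - c0) / (1 + (t - c0) ^+ 2) * A t
     - 2 / (1 + (t - c0) ^+ 2) * (xi - M * P t) + k ^+ 2 * (1 + (t - c0) ^+ 2) / M * P t).
    eapply is_derive_eq; first exact: dA'.
    have -> : eta - k * t = - (k * (t - c0)) by rewrite /c0; field.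
    move: (t - c0) qt => s qt; field.
    rewrite (gt_eqF M0) (gt_eqF qt) /= gt_eqF//.
    by rewrite ltr_pwDl ?exprn_even_gt0// sqr_ge0.
  have dEt := is_derive_energy M0 k0 (dP t tT) dA2; eexists; first exact: dEt.
  rewrite ler_wpM2l ?sqr_ge0//.
  have [u b1 b2 b3 g] := energy_products (P t) (A t) xi k1 (inv_jap_gt0 (t - c0)) (inv_jap_le1 (t - c0)).
  have [em _] := energy_equiv (t - c0) (P t) (A t) xi M0 k1.
  have j0 := inv_jap_gt0 (t - c0).
  apply: (@le_trans _ _ (energy_rate M * acoustic_mass k (t - c0) (P t) (A t) xi)); last first.
    by rewrite [K]mulrC -mulrA; apply: ler_wpM2l.
  apply: energy_bracket => //.
  - by rewrite mulVf// gt_eqF// addr_gt0.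
  - by rewrite invr_gt0 addr_gt0.
  - by rewrite mulr_ge0 ?sqr_ge0// ltW.
  - by rewrite divr_ge0 ?sqr_ge0// mulr_ge0 ?sqr_ge0// exprn_ge0// ltW.
  - by rewrite divr_ge0 ?sqr_ge0.
have dat (t : R) : is_derive t (1:R) (fun t => expR (- (K * atan (t - c0))))
    (- (K * inv_jap (t - c0) ^+ 2) * expR (- (K * atan (t - c0)))).
  by deriv; rewrite inv_jap_sqr /=; ring.
have cat := der_continuous dat.
have dG t : 0 < t < T -> exists2 dG, is_derive t (1:R) G dG & dG <= 0.
  move=> tT; have [D d De] := dE t tT.
  eexists; first exact: (der_mul d (dat t)).
  set e := expR _; have e0 : 0 < e by exact: expR_gt0.
  have -> : E t * (- (K * inv_jap (t - c0) ^+ 2) * e) + e * D = e * (D - inv_jap (t - c0) ^+ 2 * (K * E t)) by ring.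
  by rewrite mulr_ge0_le0 ?(ltW e0)// subr_le0.
have GT : G T <= G 0.
  apply: (@ler0_derive1_le_cc _ G 0 T).
  - by move=> t; rewrite in_itv/= => /dG[D [d _] _].
  - by move=> t; rewrite in_itv/= => /dG[D d D0]; rewrite derive1E (@derive_val _ _ _ _ _ _ _ d).
  - apply: continuous_in_subspaceT => t; rewrite mem_setE in_itv/= => tT; have [cP cA] := cPA t tT.
    by apply: cvgM; [exact: continuous_energy|exact: cat].
  - by rewrite in_itv/= lexx ltW.
  - by rewrite in_itv/= lexx ltW.
  - exact: ltW.
have [_ e0] := energy_equiv (- c0) p0 a0 xi M0 k1.
have [eT _] := energy_equiv (T - c0) pT aT xi M0 k1.
have m0 : 0 <= acoustic_mass k (- c0) p0 a0 xi.
  exact: acoustic_mass_ge0.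
apply: (le_trans eT).
move: GT; rewrite /G /E P0 A0 PT AT sub0r => GT.
have at1 := atan_ltpi2 (T - c0); have at2 := atan_gtNpi2 (- c0).
set ET := acoustic_energy _ _ _ pT _ _ in eT GT *; set E0 := acoustic_energy _ _ _ p0 _ _ in e0 GT.
set aT' := atan (T - c0) in at1 GT; set a0' := atan (- c0) in at2 GT.
have hE : ET <= E0 * expR (K * (aT' - a0')).
  have -> : ET = ET * expR (- (K * aT')) * expR (K * aT').
    by rewrite -mulrA -expRD addNr expR0 mulr1.
  apply: (@le_trans _ _ (E0 * expR (- (K * a0')) * expR (K * aT'))).
    by rewrite ler_wpM2r// expR_ge0.
  by rewrite -mulrA -expRD mulrBr (addrC (- _)).
have hexp : expR (K * (aT' - a0')) <= expR (K * pi).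
  rewrite ler_expR ler_wpM2l ?mulr_ge0//; lra.
have hE0 : E0 * expR (K * (aT' - a0')) <= 2 * acoustic_mass k (- c0) p0 a0 xi * expR (K * pi).
  apply: (@le_trans _ _ (2 * acoustic_mass k (- c0) p0 a0 xi * expR (K * (aT' - a0')))).
    by rewrite ler_wpM2r// expR_ge0.
  by rewrite ler_wpM2l// mulr_ge0.
rewrite /energy_factor -/K; move: hE hE0; set e := expR (K * pi); set m := acoustic_mass _ _ _ _ _.
lra.
Qed.

End AcousticEnergy.

(** * Japanese brackets *)

Section PointwiseBounds.
Context {R : realType}.
Implicit Types (k t eta M F : R).

Lemma jap_gt0 (a : R) : 0 < jap a.
Proof. by rewrite sqrtr_gt0 sqrD1_gt0. Qed.

Lemma jap_ge1 (a : R) : 1 <= jap a.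
Proof. by rewrite -[leLHS]sqrtr1 ler_wsqrtr// sqrD1_ge1. Qed.

Lemma jap_sqr (a : R) : jap a ^+ 2 = 1 + a ^+ 2.
Proof. by rewrite sqr_sqrtr// ltW// sqrD1_gt0. Qed.

Lemma inv_japE (s : R) : inv_jap s = (jap s)^-1. Proof. by []. Qed.

(** Peetre's inequality; it trades decay in [t - c] for decay in [t] at the price
    of weights in [c]. *)
Lemma jap_peetre (t c : R) : jap t <= 2 * (jap c * jap (t - c)).
Proof.
have h := oneDsqr_shift c t.
have p0 : 0 <= jap c * jap (t - c) by rewrite mulr_ge0// ltW// jap_gt0.
rewrite -(@ler_pXn2r _ 2)// ?nnegrE ?mulr_ge0 ?(ltW (jap_gt0 _))//.
rewrite !exprMn !jap_sqr; apply: (le_trans h).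
rewrite mulrA ler_wpM2r ?(ltW (sqrD1_gt0 _))//.
by rewrite ler_wpM2r ?(ltW (sqrD1_gt0 _))//; lra.
Qed.

Lemma japN (a : R) : jap (- a) = jap a. Proof. by rewrite /jap sqrrN. Qed.

Lemma jap_peetre' (t c : R) : jap (t - c) <= 2 * (jap t * jap c).
Proof.
have := jap_peetre (t - c) t; rewrite (_ : t - c - t = - c) ?japN//; ring.
Qed.

Lemma jap_div_le (k eta : R) : 1 <= k ^+ 2 -> jap (eta / k) <= jap eta.
Proof.
move=> k1; apply: ler_wsqrtr; rewrite lerD2l exprMn exprVn ler_pdivrMr; last lra.
by rewrite ler_peMr// sqr_ge0.
Qed.

Lemma inv_sqr_le (k : R) : 1 <= k ^+ 2 -> (k ^+ 2)^-1 <= 2 * (jap k)^-1 ^+ 2.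
Proof.
move=> k1; rewrite exprVn jap_sqr; have k2 : 0 < k ^+ 2 by apply: lt_le_trans k1.
have q : 0 < 1 + k ^+ 2 by rewrite addr_gt0.
rewrite -(@ler_pM2l _ (1 + k ^+ 2))// mulrCA mulfV ?gt_eqF// mulr1 ler_pdivrMr//; lra.
Qed.

Lemma jap_inv_le1 (a : R) : (jap a)^-1 <= 1.
Proof. by rewrite invf_le1 ?jap_gt0// jap_ge1. Qed.

Lemma inv_jap_div_sqr (k eta : R) : 1 <= k ^+ 2 -> inv_jap (eta / k) ^+ 2 * (k ^+ 2)^-1 = (k ^+ 2 + eta ^+ 2)^-1.
Proof.
move=> k1; have k2 : 0 < k ^+ 2 by apply: lt_le_trans k1.
have kn : k != 0 by apply: contraTneq k2 => ->; rewrite expr0n ltxx.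
rewrite inv_jap_sqr -invfM; congr _^-1; by field.
Qed.

End PointwiseBounds.

Ltac nn := repeat first [assumption | (apply: ltW; assumption) | apply: mulr_ge0 | apply: exprn_ge0 | apply: addr_ge0
  | (rewrite invr_ge0) | apply: ler0n].
Ltac mono := repeat first [exact: lexx | assumption | (apply: ler_pM; [by nn|by nn| | ]) | apply: lerD
  | (apply: lerXn2r; [by rewrite nnegrE; nn|by rewrite nnegrE; nn|])].

(** * From the energy estimate to weighted bounds *)

Section AbstractBounds.
Context {R : realType}.

(** Here [u], [v], [W], [J], [jt], [j0] stand for the bracket of [eta / k], the
    inverse bracket of [t], the inverse bracket of [k], the bracket of [eta], and
    the inverse brackets of [t - eta / k] and of [eta / k]; [kap] is [1 / k^2] and
    [o] is the square of the vorticity.  The pressure part of [o] is controlled by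
    the energy and gives the first term, the conserved part the second. *)
Lemma bound_Pvx (u v kap W j0 J jt F N p0 a0 x0 pt o : R) :
  0 <= u -> 0 <= v -> 0 <= kap -> 0 <= W -> 0 <= j0 -> 0 < J -> 0 <= jt -> 0 <= F -> 0 <= N ->
  0 <= p0 -> 0 <= a0 -> 0 <= x0 -> 0 <= pt ->
  u * j0 = 1 -> jt <= 2 * u * v -> kap <= 2 * W ^+ 2 -> W <= 1 -> u <= J -> j0 ^+ 2 * kap <= (J ^+ 2)^-1 ->
  kap <= 1 ->
  jt * pt <= F * (j0 * p0 + j0 ^+ 3 * a0 * kap + x0 * kap) -> o <= 2 * x0 + 2 * N * pt ->
  jt ^+ 2 * kap * o <= (8 * N * F * v) * (W * p0 + W * (J ^+ 2)^-1 * a0 + W * J * x0)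
    + (16 * v ^+ 2) * (W ^+ 2 * J ^+ 2 * x0).
Proof.
move=> u0 v0 kap0 W0 j00 J0 jt0 F0 N0 p0' a0' x0' pt0 uj hj hk W1 uJ hjk k1 est ho.
have J0' := ltW J0; have Ji0 : 0 <= (J ^+ 2)^-1 by rewrite invr_ge0 exprn_ge0.
have kW : kap <= 2 * W by apply: (le_trans hk); rewrite ler_wpM2l// expr2 ler_piMl.
have t1 : jt ^+ 2 * kap * x0 <= 8 * v ^+ 2 * (W ^+ 2 * J ^+ 2 * x0).
  apply: (@le_trans _ _ ((2 * u * v) ^+ 2 * (2 * W ^+ 2) * x0)); first by mono.
  have -> : (2 * u * v) ^+ 2 * (2 * W ^+ 2) * x0 = (8 * v ^+ 2 * W ^+ 2 * x0) * u ^+ 2 by ring.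
  have -> : 8 * v ^+ 2 * (W ^+ 2 * J ^+ 2 * x0) = (8 * v ^+ 2 * W ^+ 2 * x0) * J ^+ 2 by ring.
  by mono.
have t2 : jt ^+ 2 * kap * pt <= 4 * F * v * (W * p0 + W * (J ^+ 2)^-1 * a0 + W * J * x0).
  have -> : jt ^+ 2 * kap * pt = jt * kap * (jt * pt) by ring.
  apply: (@le_trans _ _ ((2 * u * v) * kap * (F * (j0 * p0 + j0 ^+ 3 * a0 * kap + x0 * kap)))); first by mono.
  have -> : (2 * u * v) * kap * (F * (j0 * p0 + j0 ^+ 3 * a0 * kap + x0 * kap)) =
    2 * F * v * kap * ((u * j0) * p0 + (u * j0) * (j0 ^+ 2 * kap) * a0 + u * x0 * kap) by ring.
  rewrite uj !mul1r.
  apply: (@le_trans _ _ (2 * F * v * (2 * W) * (p0 + (J ^+ 2)^-1 * a0 + J * x0 * 1))); first by mono.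
  by rewrite le_eqVlt; apply/orP; left; apply/eqP; ring.
apply: (@le_trans _ _ (jt ^+ 2 * kap * (2 * x0 + 2 * N * pt))); first by apply: ler_wpM2l => //; nn.
have t2' : N * (jt ^+ 2 * kap * pt) <= N * (4 * F * v * (W * p0 + W * (J ^+ 2)^-1 * a0 + W * J * x0)) by mono.
lra.
Qed.

(** As in [bound_Pvx] with two more powers of [jt], since the second component of
    the velocity carries [k] instead of [eta]. *)
Lemma bound_Pvy (u v kap W j0 J jt F N p0 a0 x0 pt o : R) :
  0 <= u -> 0 <= v -> 0 <= kap -> 0 <= W -> 0 <= j0 -> 0 < J -> 0 <= jt -> 0 <= F -> 0 <= N ->
  0 <= p0 -> 0 <= a0 -> 0 <= x0 -> 0 <= pt ->
  u * j0 = 1 -> jt <= 2 * u * v -> kap <= 2 * W ^+ 2 -> W <= 1 -> u <= J -> kap <= 1 ->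
  jt * pt <= F * (j0 * p0 + j0 ^+ 3 * a0 * kap + x0 * kap) -> o <= 2 * x0 + 2 * N * pt ->
  jt ^+ 4 * kap * o <= (32 * N * F * v ^+ 3) * (W * J ^+ 2 * p0 + W * a0 + W * J ^+ 3 * x0)
    + (64 * v ^+ 4) * (W ^+ 2 * J ^+ 4 * x0).
Proof.
move=> u0 v0 kap0 W0 j00 J0 jt0 F0 N0 p0' a0' x0' pt0 uj hj hk W1 uJ k1 est ho.
have J0' := ltW J0.
have kW : kap <= 2 * W by apply: (le_trans hk); rewrite ler_wpM2l// expr2 ler_piMl.
have t1 : jt ^+ 4 * kap * x0 <= 32 * v ^+ 4 * (W ^+ 2 * J ^+ 4 * x0).
  apply: (@le_trans _ _ ((2 * u * v) ^+ 4 * (2 * W ^+ 2) * x0)); first by mono.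
  have -> : (2 * u * v) ^+ 4 * (2 * W ^+ 2) * x0 = (32 * v ^+ 4 * W ^+ 2 * x0) * u ^+ 4 by ring.
  have -> : 32 * v ^+ 4 * (W ^+ 2 * J ^+ 4 * x0) = (32 * v ^+ 4 * W ^+ 2 * x0) * J ^+ 4 by ring.
  by mono.
have t2 : jt ^+ 4 * kap * pt <= 16 * F * v ^+ 3 * (W * J ^+ 2 * p0 + W * a0 + W * J ^+ 3 * x0).
  have -> : jt ^+ 4 * kap * pt = jt ^+ 3 * kap * (jt * pt) by ring.
  apply: (@le_trans _ _ ((2 * u * v) ^+ 3 * kap * (F * (j0 * p0 + j0 ^+ 3 * a0 * kap + x0 * kap)))); first by mono.
  have -> : (2 * u * v) ^+ 3 * kap * (F * (j0 * p0 + j0 ^+ 3 * a0 * kap + x0 * kap)) =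
    8 * F * v ^+ 3 * kap * ((u * j0) * u ^+ 2 * p0 + (u * j0) ^+ 3 * a0 * kap + u ^+ 3 * x0 * kap) by ring.
  rewrite uj expr1n !mul1r.
  apply: (@le_trans _ _ (8 * F * v ^+ 3 * (2 * W) * (J ^+ 2 * p0 + a0 * 1 + J ^+ 3 * x0 * 1))); first by mono.
  by rewrite le_eqVlt; apply/orP; left; apply/eqP; ring.
apply: (@le_trans _ _ (jt ^+ 4 * kap * (2 * x0 + 2 * N * pt))); first by apply: ler_wpM2l => //; nn.
have t2' : N * (jt ^+ 4 * kap * pt) <= N * (16 * F * v ^+ 3 * (W * J ^+ 2 * p0 + W * a0 + W * J ^+ 3 * x0)) by mono.
lra.
Qed.

(** Nothing decays here: the energy bounds the squares up to the factor [1 / jt],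
    which costs one power of the bracket of [t] and one of [eta / k]. *)
Lemma bound_Q (u tau kap j0 J jt jti F Q p0 a0 x0 pt a_t : R) :
  0 <= u -> 0 <= tau -> 0 <= kap -> 0 <= j0 -> 0 <= J -> 0 <= jt -> 0 <= jti -> 0 <= F -> 0 <= Q ->
  0 <= p0 -> 0 <= a0 -> 0 <= x0 -> 0 <= pt -> 0 <= a_t ->
  u * j0 = 1 -> jti * jt = 1 -> jti <= 2 * tau * u -> u <= J -> j0 ^+ 2 * kap <= 2 * Q -> kap <= 1 ->
  jt * pt + jt ^+ 3 * a_t * kap <= F * (j0 * p0 + j0 ^+ 3 * a0 * kap + x0 * kap) ->
  pt + jt ^+ 2 * a_t * kap <= (4 * F * tau) * (p0 + Q * a0 + J * x0).
Proof.
move=> u0 tau0 kap0 j00 J0 jt0 jti0 F0 Q0 p0' a0' x0' pt0 at0 uj jj hj uJ hQ k1 est.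
have -> : pt + jt ^+ 2 * a_t * kap = jti * (jt * pt + jt ^+ 3 * a_t * kap).
  have -> : jti * (jt * pt + jt ^+ 3 * a_t * kap) = (jti * jt) * (pt + jt ^+ 2 * a_t * kap) by ring.
  by rewrite jj mul1r.
apply: (@le_trans _ _ (2 * tau * u * (F * (j0 * p0 + j0 ^+ 3 * a0 * kap + x0 * kap)))); first by mono.
have -> : 2 * tau * u * (F * (j0 * p0 + j0 ^+ 3 * a0 * kap + x0 * kap)) =
   2 * F * tau * ((u * j0) * p0 + (u * j0) * (j0 ^+ 2 * kap) * a0 + u * x0 * kap) by ring.
rewrite uj !mul1r.
apply: (@le_trans _ _ (2 * F * tau * (p0 + 2 * Q * a0 + J * x0 * 1))); first by mono.
have : 0 <= F * tau * p0 by nn.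
have : 0 <= F * tau * (J * x0) by nn.
lra.
Qed.

End AbstractBounds.

Section Constants.
Context {R : realType}.

Lemma energy_factor_ge1 (N : R) : 0 < N -> 1 <= energy_factor N.
Proof.
move=> N0; have h : 1 <= expR (2 * energy_rate N * pi) :> R.
  rewrite -[leLHS]expR0 ler_expR !mulr_ge0 ?pi_ge0// /energy_rate.
  by have := sqr_ge0 N; lra.
rewrite /energy_factor; lra.
Qed.

Lemma wavenumber_ge1 (n : int) : n != 0 -> 1 <= `|wavenumber n : R|.
Proof.
move=> n0; rewrite /wavenumber normrM -intr_norm.
have h1 : (1 : R) <= (`|n|%R)%:~R by rewrite (ler_int _ 1); move: n0; lia.
have h2 : (1 : R) <= `|2 * pi| by rewrite ger0_norm ?mulr_ge0 ?pi_ge0//; have := pi_ge2 R; lra.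
by rewrite -[leLHS]mulr1 ler_pM.
Qed.

End Constants.

(** * The estimate for complex amplitudes *)

Section ComplexModes.
Context {R : realType}.
Local Notation mu := (@lebesgue_measure R).
Variables (gamma M : R) (rho_in alpha_in omega_in theta_in : spectrum R)
  (rho alpha omega theta : R -> spectrum R).
Hypothesis sol : couette_solution gamma M rho_in alpha_in omega_in theta_in rho alpha omega theta.
Hypothesis gamma1 : 1 < gamma.
Hypothesis M0 : 0 < M.
Variable n : int.
Local Notation k := (wavenumber n : R).

Definition pressure (r th : spectrum R) : spectrum R := ((gamma * M)^-1)%:C *: (r + th).
Definition entropy (r th : spectrum R) : spectrum R := (M^-1)%:C *: ((gamma - 1)%:C *: r - th).

(** The conserved combination [Xi], which gives [omega = Xi - M P]. *)
Definition vorticity_density (r th om : spectrum R) : spectrum R := (gamma^-1)%:C *: (r + th + gamma%:C *: om).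

Let gamma0 : 0 < gamma. Proof. exact: lt_trans gamma1. Qed.

Lemma sqr_norm_rlin (z : R[i]) : sqr_norm z = rlin 1 0 z ^+ 2 + rlin 0 1 z ^+ 2.
Proof. by rewrite /sqr_norm /rlin; ring. Qed.

Lemma rlin_scale (r1 r2 a : R) (z : R[i]) : rlin r1 r2 (a%:C * z) = a * rlin r1 r2 z.
Proof. by rewrite /rlin; case: z => x y /=; ring. Qed.

Lemma rlinD (r1 r2 : R) (z w : R[i]) : rlin r1 r2 (z + w) = rlin r1 r2 z + rlin r1 r2 w.
Proof. by rewrite /rlin; case: z => x y; case: w => x' y' /=; ring. Qed.

Lemma rlinB (r1 r2 : R) (z w : R[i]) : rlin r1 r2 (z - w) = rlin r1 r2 z - rlin r1 r2 w.
Proof. by rewrite /rlin; case: z => x y; case: w => x' y' /=; ring. Qed.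

Lemma rlin_pressure r1 r2 (r th : spectrum R) eta :
  rlin r1 r2 (pressure r th n eta) = (rlin r1 r2 (r n eta) + rlin r1 r2 (th n eta)) / (gamma * M).
Proof. by rewrite -rlinD -[RHS]mulrC -rlin_scale. Qed.

Lemma rlin_entropy r1 r2 (r th : spectrum R) eta :
  rlin r1 r2 (entropy r th n eta) = ((gamma - 1) * rlin r1 r2 (r n eta) - rlin r1 r2 (th n eta)) / M.
Proof. by rewrite -rlin_scale -rlinB -[RHS]mulrC -rlin_scale. Qed.

Lemma rlin_vorticity r1 r2 (r th om : spectrum R) eta :
  rlin r1 r2 (vorticity_density r th om n eta) =
  (rlin r1 r2 (r n eta) + rlin r1 r2 (th n eta) + gamma * rlin r1 r2 (om n eta)) / gamma.
Proof. by rewrite -rlin_scale -!rlinD -[RHS]mulrC -rlin_scale. Qed.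

(** The energy estimate is quadratic and the equations are real, so it is enough
    to add those of the real and the imaginary parts. *)
Lemma characteristic_estimate t : 0 <= t -> n != 0 -> {ae mu, forall eta,
  let e := eta - k * t in
  let P s := pressure (rho s) (theta s) n in let S s := entropy (rho s) (theta s) n in
  let X s := vorticity_density (rho s) (theta s) (omega s) n in
  let js := inv_jap (t - eta / k) in let j0 := inv_jap (eta / k) in
  [/\ sqr_norm (X t e) = sqr_norm (X 0 eta), sqr_norm (S t e) = sqr_norm (S 0 eta) &
     js * sqr_norm (P t e) + js ^+ 3 * sqr_norm (alpha t n e) * (k ^+ 2)^-1 <=
     energy_factor M * (j0 * sqr_norm (P 0 eta) + j0 ^+ 3 * sqr_norm (alpha 0 n eta) * (k ^+ 2)^-1
       + sqr_norm (X 0 eta) * (k ^+ 2)^-1)]}.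
Proof.
move=> t0 n0; have k1 := @wavenumber_ge1 R _ n0.
have F1 := energy_factor_ge1 M0.
have inv_japN (s : R) : inv_jap (- s) = inv_jap s by rewrite /inv_jap sqrrN.
have [<-|tn0] := eqVneq 0 t.
  apply: ae_true => eta; rewrite mulr0 subr0 sub0r inv_japN; split => //.
  have j0 := ltW (inv_jap_gt0 (eta / k)).
  have k20 : 0 <= (k ^+ 2)^-1 by rewrite invr_ge0 sqr_ge0.
  set p := sqr_norm _; set a := sqr_norm _; set x := sqr_norm _.
  have pp : 0 <= p by exact: sqr_norm_ge0. have aa : 0 <= a by exact: sqr_norm_ge0.
  have xx : 0 <= x by exact: sqr_norm_ge0.
  have m0 : 0 <= inv_jap (eta / k) * p + inv_jap (eta / k) ^+ 3 * a * (k ^+ 2)^-1 + x * (k ^+ 2)^-1 by nn.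
  have xk : 0 <= x * (k ^+ 2)^-1 by nn.
  apply: (@le_trans _ _ (inv_jap (eta / k) * p + inv_jap (eta / k) ^+ 3 * a * (k ^+ 2)^-1 + x * (k ^+ 2)^-1)).
    by rewrite lerDl.
  by rewrite ler_peMl.
have tp : 0 < t by rewrite lt_neqAle tn0.
have h1 := acoustic_characteristics sol gamma0 M0 1 0 n0 tp.
have h2 := acoustic_characteristics sol gamma0 M0 0 1 n0 tp.
apply: ae_imp (ae_and h1 h2) => eta [[X1 S1 [P1 [A1 o1]]] [X2 S2 [P2 [A2 o2]]]].
have E1 := acoustic_estimate M0 k1 tp o1; have E2 := acoustic_estimate M0 k1 tp o2.
move: X1 X2 S1 S2 E1 E2.
rewrite /xi_mode /entropy_mode /pressure_mode /rmode lexx (ltW tp).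
rewrite -!rlin_pressure -!rlin_entropy -!rlin_vorticity => X1 X2 S1 S2 E1 E2.
split; first by rewrite !sqr_norm_rlin X1 X2.
  by rewrite !sqr_norm_rlin S1 S2.
move: E1 E2; rewrite /acoustic_mass !inv_japN !sqr_norm_rlin.
have k20 : 0 <= (k ^+ 2)^-1 by rewrite invr_ge0 sqr_ge0.
set x1 := rlin 1 0 (vorticity_density _ _ _ n eta); set x2 := rlin 0 1 (vorticity_density _ _ _ n eta).
have y1 : 0 <= x1 ^+ 2 * (k ^+ 2)^-1 by rewrite mulr_ge0// sqr_ge0.
have y2 : 0 <= x2 ^+ 2 * (k ^+ 2)^-1 by rewrite mulr_ge0// sqr_ge0.
lra.
Qed.

End ComplexModes.

(** * Comparison of weighted norms *)

Section SquaredNorms.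
Context {R : realType}.
Local Notation mu := (@lebesgue_measure R).
Implicit Types (w : int -> R -> R) (f : spectrum R).

Definition msq w f (n : int) : \bar R := (\int[mu]_eta (w n eta * sqr_norm (f n eta))%:E)%E.

Lemma msq_ge0 w f n : (forall n eta, 0 <= w n eta) -> (0 <= msq w f n)%E.
Proof.
move=> w0; apply: integral_ge0 => eta _; rewrite lee_fin mulr_ge0//; exact: sqr_norm_ge0.
Qed.

Lemma weighted_norm_ge0 w f : (0 <= weighted_norm w f)%E.
Proof. exact: sqrte_ge0. Qed.

Lemma weighted_norm_sqr w f : (forall n eta, 0 <= w n eta) ->
  (weighted_norm w f ^+ 2 = \esum_(n in [set: int]) msq w f n)%E.
Proof. by move=> w0; rewrite sqr_sqrte//; apply: esum_ge0 => n _; exact: msq_ge0. Qed.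

Local Open Scope ereal_scope.

Lemma esumZ_le (c : R) (a : int -> \bar R) : (0 <= c)%R -> (forall n, 0 <= a n) ->
  \esum_(n in [set: int]) (c%:E * a n) <= c%:E * \esum_(n in [set: int]) a n.
Proof.
move=> c0 a0; rewrite ge_ereal_sup => //= _ [X [finX _] <-].
rewrite -ge0_mule_fsumr//; apply: lee_wpmul2l; first by rewrite lee_fin.
by apply: ereal_sup_ubound; exists X.
Qed.

Lemma esum_le4 (X A B C D : int -> \bar R) (c d : R) : (0 <= c)%R -> (0 <= d)%R ->
  (forall n, 0 <= A n) -> (forall n, 0 <= B n) -> (forall n, 0 <= C n) -> (forall n, 0 <= D n) ->
  (forall n, X n <= c%:E * (A n + B n + C n) + d%:E * D n) ->
  \esum_(n in [set: int]) X n <= c%:E * (\esum_(n in [set: int]) A n + \esum_(n in [set: int]) B n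
    + \esum_(n in [set: int]) C n) + d%:E * \esum_(n in [set: int]) D n.
Proof.
move=> c0 d0 A0 B0 C0 D0 h.
have S0 n : 0 <= A n + B n + C n by rewrite !adde_ge0.
apply: (@le_trans _ _ (\esum_(n in [set: int]) (c%:E * (A n + B n + C n) + d%:E * D n))).
  by apply: le_esum.
rewrite esumD; last 2 first.
- by move=> n _; rewrite mule_ge0// lee_fin.
- by move=> n _; rewrite mule_ge0// lee_fin.
apply: leeD; last exact: esumZ_le.
apply: (le_trans (esumZ_le c0 S0)); rewrite !esumD// => n _; exact: adde_ge0.
Qed.

Lemma sqrD_le (x y : \bar R) : 0 <= x -> 0 <= y -> x ^+ 2 + y ^+ 2 <= (x + y) ^+ 2.
Proof.
case: x => [x| |]//; case: y => [y| |]//; rewrite ?lee_fin => x0 y0.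
- by have := mulr_ge0 x0 y0; lra.
Qed.

Lemma L2_norm_vec_le f g : L2_norm_vec f g <= L2_norm f + L2_norm g.
Proof.
have A0 : 0 <= L2_norm f by exact: weighted_norm_ge0.
have B0 : 0 <= L2_norm g by exact: weighted_norm_ge0.
apply: lee_sqrE; first exact: adde_ge0.
rewrite sqr_sqrte; first exact: sqrD_le.
by rewrite adde_ge0// expe_ge0.
Qed.

(** A bound between masses of modes gives one between norms, since
    [c (A^2 + B^2 + C^2) + d D^2 <= (a (A + B + C) + b D)^2]. *)
Lemma norm_le4 w f wA fA wB fB wC fC wD fD (a b c d : R) :
  (0 <= c)%R -> (0 <= d)%R -> (0 <= a)%R -> (0 <= b)%R -> (c <= a ^+ 2)%R -> (d <= b ^+ 2)%R ->
  (forall n eta, 0 <= w n eta)%R -> (forall n eta, 0 <= wA n eta)%R -> (forall n eta, 0 <= wB n eta)%R ->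
  (forall n eta, 0 <= wC n eta)%R -> (forall n eta, 0 <= wD n eta)%R ->
  (forall n, msq w f n <= c%:E * (msq wA fA n + msq wB fB n + msq wC fC n) + d%:E * msq wD fD n) ->
  weighted_norm w f <= a%:E * (weighted_norm wA fA + weighted_norm wB fB + weighted_norm wC fC)
    + b%:E * weighted_norm wD fD.
Proof.
move=> c0 d0 a0 b0 ca db w0 A0 B0 C0 D0 h.
have hs := esum_le4 c0 d0 (fun n => msq_ge0 fA n A0) (fun n => msq_ge0 fB n B0)
  (fun n => msq_ge0 fC n C0) (fun n => msq_ge0 fD n D0) h.
rewrite -!weighted_norm_sqr// in hs.
have := weighted_norm_ge0 w f; have := weighted_norm_ge0 wA fA; have := weighted_norm_ge0 wB fB.
have := weighted_norm_ge0 wC fC; have := weighted_norm_ge0 wD fD.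
move: (weighted_norm w f) (weighted_norm wA fA) (weighted_norm wB fB) (weighted_norm wC fC) (weighted_norm wD fD) hs.
move=> x A B C D hs D'0 C'0 B'0 A'0 x0.
have S0 : 0 <= A + B + C by rewrite !adde_ge0.
have Z0 : 0 <= a%:E * (A + B + C) + b%:E * D by rewrite adde_ge0// mule_ge0// lee_fin.
apply: (lee_sqrE Z0).
have aS : 0 <= a%:E * (A + B + C) by rewrite mule_ge0// lee_fin.
have bD : 0 <= b%:E * D by rewrite mule_ge0// lee_fin.
apply: (le_trans _ (sqrD_le aS bD)); apply: (le_trans hs); apply: leeD.
- rewrite [X in _ <= X]expe2 muleACA -EFinM -expr2 -expe2.
  apply: lee_pmul => //; first by rewrite !adde_ge0// expe_ge0.
  apply: (le_trans _ (sqrD_le _ C'0)); last exact: adde_ge0.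
  by apply: leeD => //; exact: sqrD_le.
- rewrite [X in _ <= X]expe2 muleACA -EFinM -expr2 -expe2.
  by apply: lee_pmul => //; rewrite expe_ge0.
Qed.

(** The bound is pointwise along characteristics; the shift by [b] is undone by
    translation invariance. *)
Lemma mass_le4 (b : R) (g hA hB hC hD : R -> R) (c d : R) : (0 <= c)%R -> (0 <= d)%R ->
  measurable_fun setT g -> measurable_fun setT hA -> measurable_fun setT hB ->
  measurable_fun setT hC -> measurable_fun setT hD ->
  (forall x, 0 <= g x)%R -> (forall x, 0 <= hA x)%R -> (forall x, 0 <= hB x)%R ->
  (forall x, 0 <= hC x)%R -> (forall x, 0 <= hD x)%R ->
  {ae mu, forall x, (g (x - b) <= c * (hA x + hB x + hC x) + d * hD x)%R} ->
  \int[mu]_x (g x)%:E <= c%:E * (\int[mu]_x (hA x)%:E + \int[mu]_x (hB x)%:E + \int[mu]_x (hC x)%:E)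
    + d%:E * \int[mu]_x (hD x)%:E.
Proof.
move=> c0 d0 mg mA mB mC mD g0 A0 B0 C0 D0 h.
have mE (f : R -> R) : measurable_fun setT f -> measurable_fun setT (fun x => (f x)%:E) by exact: measurable_EFinT.
rewrite -(@ge0_integral_shift _ (- b) (fun x => (g x)%:E) (mE _ mg)); last by move=> x; rewrite lee_fin.
have mABC : measurable_fun setT (fun x => hA x + hB x + hC x)%R.
  by apply: measurable_funD => //; exact: measurable_funD.
apply: (@le_trans _ _ (\int[mu]_x (c * (hA x + hB x + hC x) + d * hD x)%:E)).
  apply: ae_ge0_le_integral.
  - exact: measurableT.
  - by move=> x _; rewrite lee_fin.
  - apply: mE; exact: (measurableT_comp mg (measurable_affine_shift (- b))).
  - by move=> x _; rewrite lee_fin addr_ge0// mulr_ge0// !addr_ge0.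
  - apply: mE; apply: measurable_funD; exact: measurable_funM.
  - by apply: ae_imp h => x hx _; rewrite lee_fin.
under eq_integral do rewrite EFinD !EFinM.
rewrite ge0_integralD//; last 4 first.
- by move=> x _; rewrite -EFinM lee_fin mulr_ge0// !addr_ge0.
- by apply: measurable_funeM; exact: mE.
- by move=> x _; rewrite -EFinM lee_fin mulr_ge0.
- by apply: measurable_funeM; exact: mE.
rewrite ge0_integralZl//; last 2 first.
- exact: mE.
- by move=> x _; rewrite lee_fin !addr_ge0.
rewrite ge0_integralZl//; last 2 first.
- exact: mE.
- by move=> x _; rewrite lee_fin.
apply: leeD => //; apply: lee_wpmul2l; first by rewrite lee_fin.
under eq_integral do rewrite !EFinD.
rewrite ge0_integralD//; last 4 first.
- by move=> x _; rewrite -EFinD lee_fin addr_ge0.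
- by apply: emeasurable_funD; exact: mE.
- by move=> x _; rewrite lee_fin.
- exact: mE.
by rewrite ge0_integralD//; first [exact: mE | (by move=> x _; rewrite lee_fin)].
Qed.

End SquaredNorms.

(** * Weights of the Sobolev norms *)

Section Weights.
Context {R : realType}.
Implicit Types a b : R.

Lemma powR_weights (x : R) : 0 < x ->
  [/\ x `^ (2 * - 2^-1) = x^-1, x `^ (2 * 2^-1) = x, x `^ (2 * - 1) = (x ^+ 2)^-1, x `^ (2 * 1) = x ^+ 2 &
   [/\ x `^ (2 * 0) = 1, x `^ (2 * (3 / 2)) = x ^+ 3 & x `^ (2 * 2) = x ^+ 4]].
Proof.
move=> x0; have x0' := ltW x0.
have n2 : (2 : R) != 0 by [].
have mn m : x `^ m%:R = x ^+ m by rewrite powR_mulrn.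
split.
- by rewrite mulrN mulfV// powRN powRr1.
- by rewrite mulfV// powRr1.
- by rewrite mulrN mulr1 powRN mn.
- by rewrite mulr1 mn.
split; first by rewrite mulr0 powRr0.
- by rewrite mulrC divfK// mn.
- by rewrite (_ : 2 * 2 = 4%:R) ?mn//; ring.
Qed.

Lemma jap2_gt0 a b : 0 < jap2 a b.
Proof. by rewrite sqrtr_gt0 -addrA ltr_pwDl// addr_ge0 ?sqr_ge0. Qed.

Lemma jap2_sqr a b : jap2 a b ^+ 2 = 1 + a ^+ 2 + b ^+ 2.
Proof. by rewrite sqr_sqrtr// -addrA addr_ge0// addr_ge0 ?sqr_ge0. Qed.

Lemma jap_le_jap2 a b : jap b <= jap2 a b.
Proof. by apply: ler_wsqrtr; rewrite -addrA lerD2l lerDr sqr_ge0. Qed.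

Lemma measurable_jap : measurable_fun setT (@jap R).
Proof.
apply: continuous_measurable_fun => x; rewrite /jap.
apply: continuous_comp; last exact: sqrt_continuous.
by apply: cvgD; [exact: cvg_cst|exact: exprn_continuous].
Qed.

Lemma measurable_jap2 a : measurable_fun setT (@jap2 R a).
Proof.
apply: continuous_measurable_fun => x; rewrite /jap2.
apply: continuous_comp; last exact: sqrt_continuous.
by apply: cvgD; [exact: cvg_cst|exact: exprn_continuous].
Qed.

End Weights.

(** * Velocities and thermodynamic variables on a mode *)

Section AmplitudeIdentities.
Context {R : realType}.
Variables (gamma M : R).
Hypothesis gamma0 : 0 < gamma.
Hypothesis M0 : 0 < M.
Implicit Types (r th om f : spectrum R) (n : int) (eta : R).
Local Notation sym n eta := (wavenumber n ^+ 2 + eta ^+ 2).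

Let gn : gamma != 0. Proof. by rewrite gt_eqF. Qed.
Let Mn : M != 0. Proof. by rewrite gt_eqF. Qed.

Lemma sqr_norm_Pv_x f n eta : sqr_norm (Pv_x f n eta) = eta ^+ 2 / sym n eta ^+ 2 * sqr_norm (f n eta).
Proof.
rewrite /Pv_x /ddy /inv_lap /sqr_norm.
rewrite (_ : (- _) n eta = - (Complex 0 eta * (- (sym n eta)^-1%:C * f n eta)))//.
by case: (f n eta) => x y /=; rewrite -exprVn; ring.
Qed.

Lemma sqr_norm_Qv_y f n eta : sqr_norm (Qv_y f n eta) = eta ^+ 2 / sym n eta ^+ 2 * sqr_norm (f n eta).
Proof.
rewrite /Qv_y /ddy /inv_lap /sqr_norm.
by case: (f n eta) => x y /=; rewrite -exprVn; ring.
Qed.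

Lemma sqr_norm_ddx_inv_lap f n eta :
  sqr_norm (ddx (inv_lap f) n eta) = wavenumber n ^+ 2 / sym n eta ^+ 2 * sqr_norm (f n eta).
Proof.
rewrite /ddx /inv_lap /sqr_norm.
by case: (f n eta) => x y /=; rewrite -exprVn; ring.
Qed.

Lemma sqr_norm_omega r th om n eta :
  sqr_norm (om n eta) <= 2 * sqr_norm (vorticity_density gamma r th om n eta)
   + 2 * M ^+ 2 * sqr_norm (pressure gamma M r th n eta).
Proof.
rewrite !sqr_norm_rlin.
have e (r1 r2 : R) : rlin r1 r2 (om n eta) = rlin r1 r2 (vorticity_density gamma r th om n eta)
   - M * rlin r1 r2 (pressure gamma M r th n eta).
  by rewrite rlin_vorticity rlin_pressure; field; rewrite gn Mn.
rewrite !e; set a1 := rlin 1 0 _; set a2 := rlin 1 0 _; set a3 := rlin 0 1 _; set a4 := rlin 0 1 _.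
have := sqr_ge0 (a1 + M * a2); have := sqr_ge0 (a3 + M * a4); lra.
Qed.

Lemma sqr_norm_rho r th n eta :
  (gamma / M) ^+ 2 * sqr_norm (r n eta) <= 2 * gamma ^+ 2 * sqr_norm (pressure gamma M r th n eta)
   + 2 * sqr_norm (entropy gamma M r th n eta).
Proof.
rewrite !sqr_norm_rlin.
have e (r1 r2 : R) : (gamma / M) * rlin r1 r2 (r n eta) = gamma * rlin r1 r2 (pressure gamma M r th n eta)
   + rlin r1 r2 (entropy gamma M r th n eta).
  by rewrite rlin_entropy rlin_pressure; field; rewrite gn Mn.
rewrite mulrDr -!exprMn !e.
set a1 := rlin 1 0 _; set a2 := rlin 1 0 _; set a3 := rlin 0 1 _; set a4 := rlin 0 1 _.
have := sqr_ge0 (gamma * a1 - a2); have := sqr_ge0 (gamma * a3 - a4); lra.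
Qed.

Lemma sqr_norm_theta r th n eta :
  (gamma / M) ^+ 2 * sqr_norm (th n eta) <=
   2 * (gamma * (gamma - 1)) ^+ 2 * sqr_norm (pressure gamma M r th n eta)
   + 2 * sqr_norm (entropy gamma M r th n eta).
Proof.
rewrite !sqr_norm_rlin.
have e (r1 r2 : R) : (gamma / M) * rlin r1 r2 (th n eta) = gamma * (gamma - 1) * rlin r1 r2 (pressure gamma M r th n eta)
   - rlin r1 r2 (entropy gamma M r th n eta).
  by rewrite rlin_entropy rlin_pressure; field; rewrite gn Mn.
rewrite mulrDr -!exprMn !e; set g := gamma * (gamma - 1).
set a1 := rlin 1 0 _; set a2 := rlin 1 0 _; set a3 := rlin 0 1 _; set a4 := rlin 0 1 _.
have := sqr_ge0 (g * a1 + a2); have := sqr_ge0 (g * a3 + a4); lra.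
Qed.

Lemma measurable_pressure r th n : real_spectrum r -> real_spectrum th ->
  measurable_fun setT (fun eta => sqr_norm (pressure gamma M r th n eta)).
Proof.
move=> hr ht; under eq_fun do rewrite sqr_norm_rlin !rlin_pressure.
by apply: measurable_funD; apply: measurable_funX; apply: measurable_funM => //;
  apply: measurable_funD; exact: measurable_lin.
Qed.

Lemma measurable_entropy r th n : real_spectrum r -> real_spectrum th ->
  measurable_fun setT (fun eta => sqr_norm (entropy gamma M r th n eta)).
Proof.
move=> hr ht; under eq_fun do rewrite sqr_norm_rlin !rlin_entropy.
have m (r1 r2 : R) : measurable_fun setT (fun eta => ((gamma - 1) * rlin r1 r2 (r n eta) - rlin r1 r2 (th n eta)) / M).
  have m1 := measurable_lin n r1 r2 hr; have m2 := measurable_lin n r1 r2 ht.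
  by apply: measurable_funM => //; apply: measurable_funB => //; exact: measurable_funM.
by apply: measurable_funD; exact: measurable_funX.
Qed.

Lemma measurable_vorticity r th om n : real_spectrum r -> real_spectrum th -> real_spectrum om ->
  measurable_fun setT (fun eta => sqr_norm (vorticity_density gamma r th om n eta)).
Proof.
move=> hr ht ho; under eq_fun do rewrite sqr_norm_rlin !rlin_vorticity.
have m (r1 r2 : R) : measurable_fun setT
    (fun eta => (rlin r1 r2 (r n eta) + rlin r1 r2 (th n eta) + gamma * rlin r1 r2 (om n eta)) / gamma).
  have m1 := measurable_lin n r1 r2 hr; have m2 := measurable_lin n r1 r2 ht; have m3 := measurable_lin n r1 r2 ho.
  apply: measurable_funM => //; apply: measurable_funD; last exact: measurable_funM.
  exact: measurable_funD.
by apply: measurable_funD; exact: measurable_funX.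
Qed.

End AmplitudeIdentities.

(** * Bounds for each mode *)

Section PointwiseModeBounds.
Context {R : realType}.
Local Notation mu := (@lebesgue_measure R).
Variables (gamma M : R) (rho_in alpha_in omega_in theta_in : spectrum R)
  (rho alpha omega theta : R -> spectrum R).
Hypothesis sol : couette_solution gamma M rho_in alpha_in omega_in theta_in rho alpha omega theta.
Hypothesis gamma1 : 1 < gamma.
Hypothesis M0 : 0 < M.

Let gamma0 : 0 < gamma. Proof. exact: lt_trans gamma1. Qed.
Let F := energy_factor M.

(** The squares of the velocity components have the multipliers [eta^2 / sym^2]
    and [k^2 / sym^2], both at most [1 / sym], a power of the weight in the energy
    times [1 / k^2].  The entropy is conserved and enters [rho] and [theta] without
    growth. *)
Lemma mode_bounds t n : 0 <= t -> n != 0 -> {ae mu, forall eta,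
  let k := wavenumber n in let e := eta - k * t in let W := (jap k)^-1 in let J := jap eta in
  let p0 := sqr_norm (pressure gamma M rho_in theta_in n eta) in
  let a0 := sqr_norm (alpha_in n eta) in
  let x0 := sqr_norm (vorticity_density gamma rho_in theta_in omega_in n eta) in
  let s0 := sqr_norm (entropy gamma M rho_in theta_in n eta) in
  let B := 4 * F * jap t * (p0 + (jap2 k eta ^+ 2)^-1 * a0 + jap2 k eta * x0) in
  [/\ sqr_norm (Pv_x (omega t) n e) <=
        (8 * M ^+ 2 * F * (jap t)^-1) * (W * p0 + W * (J ^+ 2)^-1 * a0 + W * J * x0)
        + (16 * (jap t)^-1 ^+ 2) * (W ^+ 2 * J ^+ 2 * x0),
      sqr_norm (Pv_y (omega t) n e) <=
        (32 * M ^+ 2 * F * (jap t)^-1 ^+ 3) * (W * J ^+ 2 * p0 + W * a0 + W * J ^+ 3 * x0)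
        + (64 * (jap t)^-1 ^+ 4) * (W ^+ 2 * J ^+ 4 * x0),
      sqr_norm (Qv_x (alpha t) n e) <= B /\ sqr_norm (Qv_y (alpha t) n e) <= B,
      (gamma / M) ^+ 2 * sqr_norm (rho t n e) <= 2 * gamma ^+ 2 * B + 2 * s0 &
      (gamma / M) ^+ 2 * sqr_norm (theta t n e) <= 2 * (gamma * (gamma - 1)) ^+ 2 * B + 2 * s0]}.
Proof.
move=> t0 n0; have k1 := @wavenumber_ge1 R _ n0.
apply: ae_imp (characteristic_estimate sol gamma1 M0 t0 n0) => eta.
case: (sol_init sol) => -> -> -> ->.
set k := wavenumber n in k1 *; set e := eta - k * t.
set pt := sqr_norm (pressure gamma M (rho t) _ _ _); set at_ := sqr_norm (alpha t _ _).
set p0 := sqr_norm (pressure _ _ _ _ _ _); set a0 := sqr_norm (alpha_in _ _).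
set x0 := sqr_norm (vorticity_density gamma rho_in _ _ _ _); set s0 := sqr_norm (entropy _ _ rho_in _ _ _).
set js := inv_jap (t - _); set j0 := inv_jap (eta / k).
move=> [ex es est].
have k2 : 1 <= k ^+ 2 by rewrite -[k ^+ 2]real_normK ?num_real// exprn_ege1.
have kn : k != 0 by rewrite -normr_gt0 (lt_le_trans _ k1).
have F0 : 0 <= F by apply: (le_trans ler01); exact: energy_factor_ge1.
have nn_ z : 0 <= sqr_norm z :> R by exact: sqr_norm_ge0.
have jsE : js ^+ 2 * (k ^+ 2)^-1 = (k ^+ 2 + e ^+ 2)^-1.
  rewrite -(inv_jap_div_sqr e k2) /js (_ : t - eta / k = - (e / k)); last by rewrite /e; field.
  by rewrite /inv_jap sqrrN.
have jsE4 : k ^+ 2 / (k ^+ 2 + e ^+ 2) ^+ 2 = js ^+ 4 * (k ^+ 2)^-1.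
  by rewrite -exprVn -jsE; field.
have s_gt0 : 0 < k ^+ 2 + e ^+ 2 by rewrite ltr_pwDl ?sqr_ge0// (lt_le_trans _ k2).
have e_le : e ^+ 2 / (k ^+ 2 + e ^+ 2) ^+ 2 <= js ^+ 2 * (k ^+ 2)^-1.
  rewrite jsE ler_pdivrMr ?exprn_gt0// [(k ^+ 2 + e ^+ 2) ^+ 2]expr2 mulrA mulVf ?gt_eqF// mul1r.
  by rewrite lerDr sqr_ge0.
have k_le : k ^+ 2 / (k ^+ 2 + e ^+ 2) ^+ 2 <= js ^+ 2 * (k ^+ 2)^-1.
  rewrite jsE ler_pdivrMr ?exprn_gt0// [(k ^+ 2 + e ^+ 2) ^+ 2]expr2 mulrA mulVf ?gt_eqF// mul1r.
  by rewrite lerDl sqr_ge0.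
have js0 : 0 < js by exact: inv_jap_gt0. have j00 : 0 < j0 by exact: inv_jap_gt0.
have u0 : 0 <= jap (eta / k) by rewrite ltW// jap_gt0.
have tau0 := jap_gt0 t.
have uj : jap (eta / k) * j0 = 1 by rewrite /j0 inv_japE mulfV// gt_eqF// jap_gt0.
have hj : js <= 2 * jap (eta / k) * (jap t)^-1.
  rewrite ler_pdivlMr// mulrC /js inv_japE ler_pdivrMr ?jap_gt0//.
  by apply: (le_trans (jap_peetre t (eta / k))); rewrite mulrA.
have hji : js^-1 <= 2 * jap t * jap (eta / k).
  by rewrite /js inv_japE invrK -mulrA; exact: jap_peetre'.
have kap0 : 0 <= (k ^+ 2)^-1 by rewrite invr_ge0 sqr_ge0.
have kap1 : (k ^+ 2)^-1 <= 1 by rewrite invf_le1// (lt_le_trans _ k2).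
have W0 : 0 <= (jap k)^-1 by rewrite invr_ge0 ltW// jap_gt0.
have uJ := jap_div_le eta k2.
have e0 := sqr_ge0 eta.
have hjk : j0 ^+ 2 * (k ^+ 2)^-1 <= (jap eta ^+ 2)^-1.
  have q1 := sqrD1_gt0 eta; rewrite inv_jap_div_sqr// jap_sqr lef_pV2 ?posrE//; lra.
have hQ : j0 ^+ 2 * (k ^+ 2)^-1 <= 2 * (jap2 k eta ^+ 2)^-1.
  have q2 : 0 < 1 + k ^+ 2 + eta ^+ 2 by lra.
  have q3 : 0 < k ^+ 2 + eta ^+ 2 by lra.
  by rewrite inv_jap_div_sqr// jap2_sqr ler_pdivlMr// mulrC ler_pdivrMr//; lra.
have u2 : jap (eta / k) <= jap2 k eta := le_trans uJ (jap_le_jap2 k eta).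
have estP : js * pt <= F * (j0 * p0 + j0 ^+ 3 * a0 * (k ^+ 2)^-1 + x0 * (k ^+ 2)^-1).
  have at1 : 0 <= at_ by exact: nn_.
  by apply: le_trans est; rewrite lerDl; nn.
have om : sqr_norm (omega t n e) <= 2 * x0 + 2 * M ^+ 2 * pt.
  by have := sqr_norm_omega gamma0 M0 (rho t) (theta t) (omega t) n e; rewrite ex.
have N0 := sqr_ge0 M.
have ti0 : 0 <= (jap t)^-1 by rewrite invr_ge0 ltW.
have hB := bound_Q u0 (ltW tau0) kap0 (ltW j00) (ltW (jap2_gt0 k eta)) (ltW js0) _ F0 _ (nn_ _) (nn_ _) (nn_ _)
  (nn_ _) (nn_ _) uj _ hji u2 hQ kap1 est.
have {}hB : pt + js ^+ 2 * at_ * (k ^+ 2)^-1 <=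
  4 * F * jap t * (p0 + (jap2 k eta ^+ 2)^-1 * a0 + jap2 k eta * x0).
  by apply: hB; rewrite ?invr_ge0 ?sqr_ge0 ?(ltW js0)// mulVf// gt_eqF.
have jsk0 : 0 <= js ^+ 2 * (k ^+ 2)^-1 by rewrite mulr_ge0// sqr_ge0.
have pt0 : 0 <= pt by exact: nn_.
have at0 : 0 <= at_ by exact: nn_.
have hBp : pt <= 4 * F * jap t * (p0 + (jap2 k eta ^+ 2)^-1 * a0 + jap2 k eta * x0).
  by apply: le_trans hB; rewrite lerDl mulr_ge0// mulr_ge0// sqr_ge0.
have hBa : js ^+ 2 * (k ^+ 2)^-1 * at_ <= 4 * F * jap t * (p0 + (jap2 k eta ^+ 2)^-1 * a0 + jap2 k eta * x0).
  by apply: le_trans hB; rewrite mulrAC lerDr.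
split.
- rewrite sqr_norm_Pv_x; apply: (@le_trans _ _ (js ^+ 2 * (k ^+ 2)^-1 * sqr_norm (omega t n e))).
    by apply: ler_wpM2r.
  apply: (bound_Pvx u0 ti0 kap0 W0 (ltW j00) (jap_gt0 eta) (ltW js0) F0 N0 (nn_ _) (nn_ _) (nn_ _) (nn_ _)
    uj hj (inv_sqr_le k2) (jap_inv_le1 k) uJ hjk kap1 estP om).
- rewrite /Pv_y sqr_norm_ddx_inv_lap -/k jsE4.
  apply: (bound_Pvy u0 ti0 kap0 W0 (ltW j00) (jap_gt0 eta) (ltW js0) F0 N0 (nn_ _) (nn_ _) (nn_ _) (nn_ _)
    uj hj (inv_sqr_le k2) (jap_inv_le1 k) uJ kap1 estP om).
- split.
    by rewrite /Qv_x sqr_norm_ddx_inv_lap; apply: (le_trans _ hBa); apply: ler_wpM2r.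
  by rewrite sqr_norm_Qv_y; apply: (le_trans _ hBa); apply: ler_wpM2r.
- apply: (le_trans (sqr_norm_rho gamma0 M0 (rho t) (theta t) n e)); rewrite es lerD2r.
  by apply: ler_wpM2l => //; rewrite mulr_ge0// sqr_ge0.
- apply: (le_trans (sqr_norm_theta gamma0 M0 (rho t) (theta t) n e)); rewrite es lerD2r.
  by apply: ler_wpM2l => //; rewrite mulr_ge0// sqr_ge0.
Qed.

End PointwiseModeBounds.

(** * Summation over the modes *)

Section FinalAssembly.
Context {R : realType}.
Local Notation mu := (@lebesgue_measure R).

Lemma measurable_Hxy_weight (s1 s2 : R) (n : int) :
  measurable_fun setT (fun eta : R => jap (wavenumber n) `^ (2 * s1) * jap eta `^ (2 * s2)).
Proof.
apply: measurable_funM => //; exact: (measurableT_comp (measurable_powR _) measurable_jap).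
Qed.

Lemma measurable_H_weight (s : R) (n : int) :
  measurable_fun setT (fun eta : R => jap2 (wavenumber n) eta `^ (2 * s)).
Proof. exact: (measurableT_comp (measurable_powR _) (measurable_jap2 _)). Qed.

Lemma measurable_Pv_x (f : spectrum R) n : real_spectrum f -> measurable_fun setT (fun eta => sqr_norm (Pv_x f n eta)).
Proof.
move=> rf; under eq_fun do rewrite sqr_norm_Pv_x -exprVn.
apply: measurable_funM; last exact: measurable_sqr_norm.
by apply: measurable_funM; apply: measurable_funX => //; exact: measurable_symbol_inv.
Qed.

Lemma measurable_ddx_inv_lap (f : spectrum R) n : real_spectrum f ->
  measurable_fun setT (fun eta => sqr_norm (ddx (inv_lap f) n eta)).
Proof.
move=> rf; under eq_fun do rewrite sqr_norm_ddx_inv_lap -exprVn.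
apply: measurable_funM; last exact: measurable_sqr_norm.
by apply: measurable_funM => //; apply: measurable_funX; exact: measurable_symbol_inv.
Qed.

Lemma measurable_Qv_y (f : spectrum R) n : real_spectrum f -> measurable_fun setT (fun eta => sqr_norm (Qv_y f n eta)).
Proof.
move=> rf; under eq_fun do rewrite sqr_norm_Qv_y -exprVn.
apply: measurable_funM; last exact: measurable_sqr_norm.
by apply: measurable_funM; apply: measurable_funX => //; exact: measurable_symbol_inv.
Qed.

Local Open Scope ereal_scope.

Lemma msq_zero_mode (f : spectrum R) : measurable_fun setT (fun eta => sqr_norm (f 0%R eta)) ->
  {ae mu, forall eta, sqr_norm (f 0%R eta) = 0%R} -> msq (fun _ _ => 1%R) f 0%R = 0.
Proof.
move=> mf h; rewrite /msq (@ae_eq_integral _ _ _ mu setT (cst 0)) ?integral0//.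
  by apply: measurable_EFinT; exact: measurable_funM.
by apply: ae_imp h => eta e _ /=; rewrite e mulr0.
Qed.

Lemma msq_le4 (t : R) (f fA fB fC fD : spectrum R) (wA wB wC wD : int -> R -> R) (c d : R) :
  (0 <= c)%R -> (0 <= d)%R ->
  (forall n, measurable_fun setT (fun eta => sqr_norm (f n eta))) ->
  (forall n, measurable_fun setT (fun eta => sqr_norm (fA n eta))) ->
  (forall n, measurable_fun setT (fun eta => sqr_norm (fB n eta))) ->
  (forall n, measurable_fun setT (fun eta => sqr_norm (fC n eta))) ->
  (forall n, measurable_fun setT (fun eta => sqr_norm (fD n eta))) ->
  (forall n, measurable_fun setT (wA n)) -> (forall n, measurable_fun setT (wB n)) ->
  (forall n, measurable_fun setT (wC n)) -> (forall n, measurable_fun setT (wD n)) ->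
  (forall n eta, 0 <= wA n eta)%R -> (forall n eta, 0 <= wB n eta)%R ->
  (forall n eta, 0 <= wC n eta)%R -> (forall n eta, 0 <= wD n eta)%R ->
  {ae mu, forall eta, sqr_norm (f 0%R eta) = 0%R} ->
  (forall n, n != 0%R -> {ae mu, forall eta, (sqr_norm (f n (eta - wavenumber n * t)) <=
     c * (wA n eta * sqr_norm (fA n eta) + wB n eta * sqr_norm (fB n eta) + wC n eta * sqr_norm (fC n eta))
     + d * (wD n eta * sqr_norm (fD n eta)))%R}) ->
  forall n, msq (fun _ _ => 1%R) f n <= c%:E * (msq wA fA n + msq wB fB n + msq wC fC n) + d%:E * msq wD fD n.
Proof.
move=> c0 d0 mf mA mB mC mD nA nB nC nD A0 B0 C0 D0 z h n.
have [->|n0] := eqVneq n 0%R.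
  rewrite msq_zero_mode//; apply: adde_ge0; apply: mule_ge0; rewrite ?lee_fin//.
    by apply: adde_ge0; [apply: adde_ge0|]; exact: msq_ge0.
  exact: msq_ge0.
have N0 z' : (0 <= sqr_norm z' :> R)%R by exact: sqr_norm_ge0.
apply: (mass_le4 (b := (wavenumber n * t)%R)) => //.
- exact: measurable_funM.
- exact: measurable_funM.
- exact: measurable_funM.
- exact: measurable_funM.
- exact: measurable_funM.
- by move=> x; rewrite mul1r.
- by move=> x; rewrite mulr_ge0.
- by move=> x; rewrite mulr_ge0.
- by move=> x; rewrite mulr_ge0.
- by move=> x; rewrite mulr_ge0.
- by apply: ae_imp (h n n0) => eta; rewrite mul1r.
Qed.

(** Collects the constants for the last estimate.  The entropy part does not grow
    and is absorbed because [tau >= 1], at the price of the factor [1 / D]. *)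
Lemma combine_growth (gM G D c0 tau C : R) (S Y X1 X2 v r th : \bar R) :
  (0 < gM)%R -> (0 < G)%R -> (0 < D)%R -> (0 <= c0)%R -> (1 <= tau)%R ->
  (c0 * (2 + G ^+ 2) * 2 + 4 / D <= C)%R -> D = (G - 1)%R -> 0 <= S -> 0 <= Y ->
  X1 <= (c0 * tau)%:E * S -> X2 <= (c0 * tau)%:E * S -> v <= X1 + X2 ->
  r <= (gM^-1 * (2 * G) * c0 * tau)%:E * S + (gM^-1 * 2)%:E * Y ->
  th <= (gM^-1 * (2 * (G * D)) * c0 * tau)%:E * S + (gM^-1 * 2)%:E * Y ->
  v + (gM%:E * r + gM%:E * th) <= (C * tau)%:E * (D%:E * Y + S).
Proof.
move=> gM0 G0 D0 c00 tau1 hC DE S0 Y0 hx hy hv hr ht.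
have tau0 : (0 < tau)%R by exact: lt_le_trans tau1.
have C0 : (0 < C)%R.
  apply: lt_le_trans hC; rewrite ltr_wpDl ?divr_gt0//.
  by rewrite mulr_ge0// mulr_ge0// addr_ge0// sqr_ge0.
have Ct : (0 < C * tau)%R by exact: mulr_gt0.
case: S S0 hx hy hr ht => [S| |]//= S0 hx hy hr ht; last first.
  rewrite addey ?gt0_muley ?leey ?lte_fin//.
  by rewrite -ltNye (lt_le_trans (ltNyr 0))// mule_ge0// lee_fin ltW.
case: Y Y0 hr ht => [Y| |]//= Y0 hr ht; last first.
  by rewrite gt0_muley ?lte_fin// addye// gt0_muley ?leey ?lte_fin.
rewrite lee_fin in S0; rewrite lee_fin in Y0.
have gMn : gM != 0%R by rewrite gt_eqF.
have k r' a : r' <= a -> gM%:E * r' <= gM%:E * a by move=> h; apply: lee_wpmul2l; rewrite // lee_fin ltW.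
apply: (le_trans (leeD (le_trans hv (leeD hx hy)) (leeD (k _ _ hr) (k _ _ ht)))).
rewrite -?EFinM -?EFinD -?EFinM -?EFinD lee_fin.
rewrite (_ : (_ + _)%R = (2 * (c0 * tau * S) * (1 + G + G * D) + 4 * Y)%R); last by field.
have s0 : (0 <= tau * S)%R by rewrite mulr_ge0// ltW.
have y0 : (0 <= tau * Y)%R by rewrite mulr_ge0// ltW.
have D1 : (D / D = 1)%R by rewrite divff// gt_eqF.
have b1 : (c0 * (2 + G ^+ 2) * 2 <= C)%R by apply: le_trans hC; rewrite lerDl divr_ge0// ltW.
have b2 : (4 <= C * D)%R.
  rewrite -ler_pdivrMr//; apply: le_trans hC; rewrite lerDr mulr_ge0// mulr_ge0//.
  by rewrite addr_ge0// sqr_ge0.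
have e1 := ler_wpM2r s0 b1; have e2 := ler_wpM2r y0 b2.
have e3 : (0 <= (tau - 1) * Y)%R by rewrite mulr_ge0// subr_ge0.
have e4 : (0 <= c0 * (tau * S))%R by rewrite mulr_ge0.
rewrite DE in e2 *; move: e1 e2 e3 e4; lra.
Qed.

End FinalAssembly.

(** * Decay of the solenoidal part and growth of the acoustic part *)

Section Estimates.
Context {R : realType}.
Local Notation mu := (@lebesgue_measure R).
Variables (gamma M : R) (rho_in alpha_in omega_in theta_in : spectrum R)
  (rho alpha omega theta : R -> spectrum R).
Hypothesis sol : couette_solution gamma M rho_in alpha_in omega_in theta_in rho alpha omega theta.
Hypothesis gamma1 : 1 < gamma.
Hypothesis M0 : 0 < M.
Variable t : R.
Hypothesis t0 : 0 <= t.

Let F := energy_factor M.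
Let F1 : 1 <= F. Proof. exact: energy_factor_ge1. Qed.
Let F0 : 0 <= F. Proof. exact: le_trans F1. Qed.
Let tau0 : 0 < jap t. Proof. exact: jap_gt0. Qed.
Let gamma0 : 0 < gamma. Proof. exact: lt_trans gamma1. Qed.

Let rs s : 0 <= s -> [/\ real_spectrum (rho s), real_spectrum (alpha s), real_spectrum (omega s) & real_spectrum (theta s)].
Proof. by move=> s0; case: (sol_class sol) => [[_ _ h1 _] [_ _ h2 _] [_ _ h3 _] [_ _ h4 _]]; split; auto. Qed.

Let rs_in : [/\ real_spectrum rho_in, real_spectrum alpha_in, real_spectrum omega_in & real_spectrum theta_in].
Proof. by case: (sol_init sol) => <- <- <- <-; exact: rs. Qed.

Let pin := pressure gamma M rho_in theta_in.
Let xin := vorticity_density gamma rho_in theta_in omega_in.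
Let sin_ := entropy gamma M rho_in theta_in.

Let m_p n : measurable_fun setT (fun eta => sqr_norm (pin n eta)).
Proof. by have [h _ _ h'] := rs_in; exact: measurable_pressure. Qed.
Let m_x n : measurable_fun setT (fun eta => sqr_norm (xin n eta)).
Proof. by have [h _ h'' h'] := rs_in; exact: measurable_vorticity. Qed.
Let m_s n : measurable_fun setT (fun eta => sqr_norm (sin_ n eta)).
Proof. by have [h _ _ h'] := rs_in; exact: measurable_entropy. Qed.
Let m_a n : measurable_fun setT (fun eta => sqr_norm (alpha_in n eta)).
Proof. by have [_ h _ _] := rs_in; exact: measurable_sqr_norm. Qed.

Let zero_sqr (f : spectrum R) : zero_mean f -> {ae mu, forall eta, sqr_norm (f 0 eta) = 0}.
Proof. by apply: ae_imp => eta ->; rewrite /sqr_norm /= expr0n addr0. Qed.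

Let Hw0 s1 s2 (n : int) (eta : R) : 0 <= jap (wavenumber n) `^ (2 * s1) * jap eta `^ (2 * s2).
Proof. by rewrite mulr_ge0// powR_ge0. Qed.

Let powR_sqr (x r : R) : (x `^ r) ^+ 2 = x `^ (2 * r).
Proof. by rewrite -powR_mulrn ?powR_ge0// -powRrM mulrC. Qed.

Lemma Pv_x_decay (C : R) : 8 * (1 + F) <= C ->
  (L2_norm (Pv_x (omega t)) <= (C * M / jap t `^ 2^-1)%:E * (Hxy_norm (- 2^-1) 0 pin
     + Hxy_norm (- 2^-1) (- 1) alpha_in + Hxy_norm (- 2^-1) 2^-1 xin) + (C / jap t)%:E * Hxy_norm (- 1) 1 xin)%E.
Proof.
move=> hC; have [_ _ ro _] := rs t0.
have C0 : 0 <= C by apply: le_trans hC; rewrite mulr_ge0// addr_ge0.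
have C2 : (8 * (1 + F)) ^+ 2 <= C ^+ 2 by rewrite lerXn2r ?nnegrE// mulr_ge0// addr_ge0.
have [_ zo] := sol_mean sol t0.
have FF : 0 <= F * F by rewrite mulr_ge0.
have ti := invr_ge0 (jap t).
apply: (norm_le4 (c := 8 * M ^+ 2 * F * (jap t)^-1) (d := 16 * (jap t)^-1 ^+ 2)) => //.
- by rewrite mulr_ge0 ?invr_ge0 ?(ltW tau0)// mulr_ge0// mulr_ge0// sqr_ge0.
- by rewrite mulr_ge0// sqr_ge0.
- by rewrite divr_ge0 ?powR_ge0// mulr_ge0// ltW.
- by rewrite divr_ge0// ltW.
- rewrite expr_div_n powR_sqr mulfV// powRr1 ?(ltW tau0)// ler_wpM2r ?invr_ge0 ?(ltW tau0)//.
  by rewrite exprMn mulrAC ler_wpM2r ?sqr_ge0//; have := F0; move: C2; lra.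
- rewrite expr_div_n exprVn ler_wpM2r ?invr_ge0 ?sqr_ge0//; have := F0; move: C2; lra.
apply: (msq_le4 (t := t)) => //.
- by rewrite mulr_ge0 ?invr_ge0 ?(ltW tau0)// mulr_ge0// mulr_ge0// sqr_ge0.
- by rewrite mulr_ge0// sqr_ge0.
- by move=> n; exact: measurable_Pv_x.
- by move=> n; exact: measurable_Hxy_weight.
- by move=> n; exact: measurable_Hxy_weight.
- by move=> n; exact: measurable_Hxy_weight.
- by move=> n; exact: measurable_Hxy_weight.
- by apply: ae_imp (zero_sqr zo) => eta e; rewrite sqr_norm_Pv_x e mulr0.
move=> n n0; apply: ae_imp (mode_bounds sol gamma1 M0 t0 n0) => eta [h _ _ _ _].
have [w1 w2 w3 w4 [w5 w6 w7]] := powR_weights (jap_gt0 (wavenumber n : R)).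
have [v1 v2 v3 v4 [v5 v6 v7]] := powR_weights (jap_gt0 eta).
by rewrite w1 w3 v5 v3 v2 v4 mulr1 -(exprVn (jap (wavenumber n))).
Qed.

Lemma Pv_y_decay (C : R) : 8 * (1 + F) <= C ->
  (L2_norm (Pv_y (omega t)) <= (C * M / jap t `^ (3 / 2))%:E * (Hxy_norm (- 2^-1) 1 pin
     + Hxy_norm (- 2^-1) 0 alpha_in + Hxy_norm (- 2^-1) (3 / 2) xin) + (C / jap t ^+ 2)%:E * Hxy_norm (- 1) 2 xin)%E.
Proof.
move=> hC; have [_ _ ro _] := rs t0.
have C0 : 0 <= C by apply: le_trans hC; rewrite mulr_ge0// addr_ge0.
have C2 : (8 * (1 + F)) ^+ 2 <= C ^+ 2 by rewrite lerXn2r ?nnegrE// mulr_ge0// addr_ge0.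
have [_ zo] := sol_mean sol t0.
have FF : 0 <= F * F by rewrite mulr_ge0.
have ti : 0 <= (jap t)^-1 by rewrite invr_ge0 ltW.
have [_ _ _ _ [_ t3 _]] := powR_weights tau0.
have c0 : 0 <= 32 * M ^+ 2 * F * (jap t)^-1 ^+ 3.
  by rewrite mulr_ge0 ?exprn_ge0// mulr_ge0// mulr_ge0// sqr_ge0.
have d0 : 0 <= 64 * (jap t)^-1 ^+ 4 by rewrite mulr_ge0// exprn_ge0.
apply: (norm_le4 (c := 32 * M ^+ 2 * F * (jap t)^-1 ^+ 3) (d := 64 * (jap t)^-1 ^+ 4)) => //.
- by rewrite divr_ge0 ?powR_ge0// mulr_ge0// ltW.
- by rewrite divr_ge0// exprn_ge0// ltW.
- rewrite expr_div_n powR_sqr t3 exprVn ler_wpM2r ?invr_ge0 ?exprn_ge0 ?(ltW tau0)//.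
  by rewrite exprMn mulrAC ler_wpM2r ?sqr_ge0//; have := F0; move: C2; lra.
- rewrite expr_div_n -exprM exprVn ler_wpM2r ?invr_ge0 ?exprn_ge0 ?(ltW tau0)//; have := F0; move: C2; lra.
apply: (msq_le4 (t := t)) => //.
- by move=> n; exact: measurable_ddx_inv_lap.
- by move=> n; exact: measurable_Hxy_weight.
- by move=> n; exact: measurable_Hxy_weight.
- by move=> n; exact: measurable_Hxy_weight.
- by move=> n; exact: measurable_Hxy_weight.
- by apply: ae_imp (zero_sqr zo) => eta e; rewrite /Pv_y sqr_norm_ddx_inv_lap e mulr0.
move=> n n0; apply: ae_imp (mode_bounds sol gamma1 M0 t0 n0) => eta [_ h _ _ _].
have [w1 w2 w3 w4 [w5 w6 w7]] := powR_weights (jap_gt0 (wavenumber n : R)).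
have [v1 v2 v3 v4 [v5 v6 v7]] := powR_weights (jap_gt0 eta).
by rewrite w1 w3 v4 v5 v6 v7 mulr1 -exprVn.
Qed.

Let Hw s (n : int) (eta : R) : 0 <= jap2 (wavenumber n) eta `^ (2 * s).
Proof. exact: powR_ge0. Qed.

Let growth (f : spectrum R) (a b : R) : 0 <= a -> 0 <= b ->
  (forall n, measurable_fun setT (fun eta => sqr_norm (f n eta))) ->
  {ae mu, forall eta, sqr_norm (f 0 eta) = 0} ->
  (forall n, n != 0 -> {ae mu, forall eta, sqr_norm (f n (eta - wavenumber n * t)) <=
    a ^+ 2 * (4 * F * jap t * (sqr_norm (pin n eta) + (jap2 (wavenumber n) eta ^+ 2)^-1 * sqr_norm (alpha_in n eta)
     + jap2 (wavenumber n) eta * sqr_norm (xin n eta))) + b ^+ 2 * sqr_norm (sin_ n eta)}) ->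
  (L2_norm f <= (a * (8 * (1 + F)) * jap t `^ 2^-1)%:E * (L2_norm pin + H_norm (- 1) alpha_in + H_norm 2^-1 xin)
    + b%:E * L2_norm sin_)%E.
Proof.
move=> a0 b0 mf zf h.
have FF : 0 <= F * F by rewrite mulr_ge0.
have c0 : 0 <= a ^+ 2 * (4 * F * jap t) by rewrite mulr_ge0 ?sqr_ge0// mulr_ge0 ?(ltW tau0)// mulr_ge0.
apply: (norm_le4 (c := a ^+ 2 * (4 * F * jap t)) (d := b ^+ 2)) => //.
- exact: sqr_ge0.
- by rewrite mulr_ge0 ?powR_ge0// mulr_ge0// mulr_ge0// addr_ge0.
- rewrite exprMn powR_sqr mulfV// powRr1 ?(ltW tau0)// mulrA ler_wpM2r ?(ltW tau0)//.
  by rewrite exprMn ler_wpM2l ?sqr_ge0//; have := F0; lra.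
apply: (msq_le4 (t := t)) => //.
- exact: sqr_ge0.
- by move=> n; exact: measurable_H_weight.
- by move=> n; exact: measurable_H_weight.
move=> n n0; apply: ae_imp (h n n0) => eta.
have [_ w2 w3 _ _] := powR_weights (jap2_gt0 (wavenumber n) eta).
by rewrite w2 w3 !mul1r -(mulrA (a ^+ 2)).
Qed.

Let zero_rlin (f : spectrum R) : {ae mu, forall eta, rmode 0 1 0 (fun=> f) t eta = 0} ->
  {ae mu, forall eta, rmode 0 0 1 (fun=> f) t eta = 0} -> {ae mu, forall eta, sqr_norm (f 0 eta) = 0}.
Proof.
move=> h1 h2; apply: ae_imp (ae_and h1 h2) => eta; rewrite /rmode t0 => -[e1 e2].
by rewrite sqr_norm_rlin e1 e2 expr0n addr0.
Qed.

Let zero_rho : zero_mean rho_in -> {ae mu, forall eta, sqr_norm (rho t 0 eta) = 0}.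
Proof.
move=> z; have [e|tn0] := eqVneq 0 t.
  by rewrite -e; case: (sol_init sol) => -> _ _ _; exact: zero_sqr.
have tp : 0 < t by rewrite lt_neqAle tn0.
by apply: zero_rlin; [exact: (rho_zero_mode sol 1 0 tp z)|exact: (rho_zero_mode sol 0 1 tp z)].
Qed.

Let zero_theta : zero_mean theta_in -> {ae mu, forall eta, sqr_norm (theta t 0 eta) = 0}.
Proof.
move=> z; have [e|tn0] := eqVneq 0 t.
  by rewrite -e; case: (sol_init sol) => _ _ _ ->; exact: zero_sqr.
have tp : 0 < t by rewrite lt_neqAle tn0.
by apply: zero_rlin; [exact: (theta_zero_mode sol 1 0 tp z)|exact: (theta_zero_mode sol 0 1 tp z)].
Qed.

Lemma Q_rho_theta_growth (C : R) : zero_mean rho_in -> zero_mean theta_in ->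
  8 * (1 + F) * (2 + gamma ^+ 2) * 2 + 4 / (gamma - 1) <= C ->
  (L2_norm_vec (Qv_x (alpha t)) (Qv_y (alpha t)) + (gamma / M)%:E * L2_norm (rho t)
    + (gamma / M)%:E * L2_norm (theta t) <=
   (C * jap t `^ 2^-1)%:E * ((gamma - 1)%:E * L2_norm sin_ + L2_norm pin + H_norm (- 1) alpha_in
     + H_norm 2^-1 xin))%E.
Proof.
move=> zr zt hC; have [rr ra _ rt] := rs t0.
have [za _] := sol_mean sol t0.
have gM : 0 < gamma / M by rewrite divr_gt0.
have gMn : gamma / M != 0 by rewrite gt_eqF.
have g10 : 0 < gamma - 1 by rewrite subr_gt0.
have gg : 0 <= gamma * (gamma - 1) by rewrite mulr_ge0// ltW.
have hx : (L2_norm (Qv_x (alpha t)) <= (1 * (8 * (1 + F)) * jap t `^ 2^-1)%:E *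
    (L2_norm pin + H_norm (- 1) alpha_in + H_norm 2^-1 xin) + 0%:E * L2_norm sin_)%E.
  apply: growth => //.
  - by move=> n; exact: measurable_ddx_inv_lap.
  - by apply: ae_imp (zero_sqr za) => eta e; rewrite /Qv_x sqr_norm_ddx_inv_lap e mulr0.
  move=> n n0; apply: ae_imp (mode_bounds sol gamma1 M0 t0 n0) => eta [_ _ [h _] _ _].
  by rewrite expr1n mul1r expr0n mul0r addr0.
have hy : (L2_norm (Qv_y (alpha t)) <= (1 * (8 * (1 + F)) * jap t `^ 2^-1)%:E *
    (L2_norm pin + H_norm (- 1) alpha_in + H_norm 2^-1 xin) + 0%:E * L2_norm sin_)%E.
  apply: growth => //.
  - by move=> n; exact: measurable_Qv_y.
  - by apply: ae_imp (zero_sqr za) => eta e; rewrite sqr_norm_Qv_y e mulr0.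
  move=> n n0; apply: ae_imp (mode_bounds sol gamma1 M0 t0 n0) => eta [_ _ [_ h] _ _].
  by rewrite expr1n mul1r expr0n mul0r addr0.
have resc (x y s g : R) : 0 <= g -> (gamma / M) ^+ 2 * x <= 2 * g ^+ 2 * y + 2 * s -> 0 <= y -> 0 <= s ->
    x <= ((gamma / M)^-1 * (2 * g)) ^+ 2 * y + ((gamma / M)^-1 * 2) ^+ 2 * s.
  move=> g0 h y0 s0; have gM2 : 0 < (gamma / M) ^+ 2 by rewrite exprn_gt0.
  rewrite -(ler_pM2l gM2); apply: (le_trans h).
  have -> : (gamma / M) ^+ 2 * (((gamma / M)^-1 * (2 * g)) ^+ 2 * y + ((gamma / M)^-1 * 2) ^+ 2 * s) =
    4 * (g ^+ 2 * y) + 4 * s by field; rewrite (gt_eqF M0) (gt_eqF gamma0).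
  have : 0 <= g ^+ 2 * y by rewrite mulr_ge0// sqr_ge0.
  rewrite -mulrA; lra.
have By n eta : 0 <= 4 * F * jap t * (sqr_norm (pin n eta) + (jap2 (wavenumber n) eta ^+ 2)^-1 * sqr_norm (alpha_in n eta)
     + jap2 (wavenumber n) eta * sqr_norm (xin n eta)).
  have j0 := ltW (jap2_gt0 (wavenumber n) eta).
  have j2 : 0 <= (jap2 (wavenumber n) eta ^+ 2)^-1 by rewrite invr_ge0 exprn_ge0.
  have := sqr_norm_ge0 (pin n eta); have := sqr_norm_ge0 (alpha_in n eta); have := sqr_norm_ge0 (xin n eta).
  move: (sqr_norm _) (sqr_norm _) (sqr_norm _) => p a x x0 a0 p0.
  have q0 : 0 <= p + (jap2 (wavenumber n) eta ^+ 2)^-1 * a + jap2 (wavenumber n) eta * x.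
    by rewrite addr_ge0 ?addr_ge0// mulr_ge0.
  have FF := F0; have tt := ltW tau0.
  by rewrite mulr_ge0// mulr_ge0// mulr_ge0.
have gi : 0 <= (gamma / M)^-1 by rewrite invr_ge0 ltW.
have hr : (L2_norm (rho t) <= ((gamma / M)^-1 * (2 * gamma) * (8 * (1 + F)) * jap t `^ 2^-1)%:E *
    (L2_norm pin + H_norm (- 1) alpha_in + H_norm 2^-1 xin) + ((gamma / M)^-1 * 2)%:E * L2_norm sin_)%E.
  apply: growth.
  - by rewrite mulr_ge0// mulr_ge0// ltW.
  - by rewrite mulr_ge0.
  - by move=> n; exact: measurable_sqr_norm.
  - exact: zero_rho zr.
  move=> n n0; apply: ae_imp (mode_bounds sol gamma1 M0 t0 n0) => eta [_ _ _ h _].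
  apply: resc (ltW gamma0) h _ _; first exact: By.
  exact: sqr_norm_ge0.
have ht : (L2_norm (theta t) <= ((gamma / M)^-1 * (2 * (gamma * (gamma - 1))) * (8 * (1 + F)) * jap t `^ 2^-1)%:E *
    (L2_norm pin + H_norm (- 1) alpha_in + H_norm 2^-1 xin) + ((gamma / M)^-1 * 2)%:E * L2_norm sin_)%E.
  apply: growth.
  - by rewrite mulr_ge0// mulr_ge0.
  - by rewrite mulr_ge0.
  - by move=> n; exact: measurable_sqr_norm.
  - exact: zero_theta zt.
  move=> n n0; apply: ae_imp (mode_bounds sol gamma1 M0 t0 n0) => eta [_ _ _ _ h].
  apply: resc gg h _ _; first exact: By.
  exact: sqr_norm_ge0.
rewrite mul1r mul0e adde0 in hx; rewrite mul1r mul0e adde0 in hy.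
rewrite -!addeA (addeA (L2_norm pin)).
have Z (w : int -> R -> R) f := weighted_norm_ge0 w f.
have S0 : (0 <= L2_norm pin + H_norm (- 1) alpha_in + H_norm 2^-1 xin)%E by rewrite !adde_ge0// /L2_norm /H_norm Z.
have hv : (L2_norm_vec (Qv_x (alpha t)) (Qv_y (alpha t)) <= L2_norm (Qv_x (alpha t)) + L2_norm (Qv_y (alpha t)))%E
  by exact: L2_norm_vec_le.
have tau1 : 1 <= jap t `^ 2^-1.
  have j1 : 1 <= jap t by rewrite -[leLHS]sqrtr1 ler_wsqrtr// lerDl sqr_ge0.
  have tt := ltW tau0.
  by rewrite powR12_sqrt// -[leLHS]sqrtr1 ler_wsqrtr.
have c0 : 0 <= 8 * (1 + F) by rewrite mulr_ge0// addr_ge0.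
exact: (combine_growth gM gamma0 g10 c0 tau1 hC erefl S0 (Z _ _) hx hy hv hr ht).
Qed.

End Estimates.

Theorem theorem1p1 (R : realType) (gamma M : R) (hgamma : 1 < gamma) (hM : 0 < M) :
  exists C : R, 0 < C /\
  forall (rho_in alpha_in omega_in theta_in : spectrum R)
         (rho alpha omega theta : R -> spectrum R),
    in_Hxy 1 2 rho_in -> in_Hxy 1 2 omega_in -> in_Hxy 1 2 theta_in ->
    in_Hxy (- 2^-1) 0 alpha_in ->
    zero_mean rho_in -> zero_mean omega_in ->
    zero_mean alpha_in -> zero_mean theta_in ->
    couette_solution gamma M rho_in alpha_in omega_in theta_in
      rho alpha omega theta ->
    let pressure_in := ((gamma * M)^-1)%:C *: (rho_in + theta_in) in
    let entropy_in := (M^-1)%:C *: ((gamma - 1)%:C *: rho_in - theta_in) in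
    let xi_in := (gamma^-1)%:C *: (rho_in + theta_in + gamma%:C *: omega_in) in
    forall t : R, 0 <= t ->
    [/\ (L2_norm (Pv_x (omega t)) <=
          (C * M / jap t `^ 2^-1)%:E *
            (Hxy_norm (- 2^-1) 0 pressure_in
             + Hxy_norm (- 2^-1) (- 1) alpha_in
             + Hxy_norm (- 2^-1) 2^-1 xi_in)
          + (C / jap t)%:E * Hxy_norm (- 1) 1 xi_in)%E,
        (L2_norm (Pv_y (omega t)) <=
          (C * M / jap t `^ (3 / 2))%:E *
            (Hxy_norm (- 2^-1) 1 pressure_in
             + Hxy_norm (- 2^-1) 0 alpha_in
             + Hxy_norm (- 2^-1) (3 / 2) xi_in)
          + (C / jap t ^+ 2)%:E * Hxy_norm (- 1) 2 xi_in)%E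
      & (L2_norm_vec (Qv_x (alpha t)) (Qv_y (alpha t))
          + (gamma / M)%:E * L2_norm (rho t)
          + (gamma / M)%:E * L2_norm (theta t) <=
          (C * jap t `^ 2^-1)%:E *
            ((gamma - 1)%:E * L2_norm entropy_in
             + L2_norm pressure_in
             + H_norm (- 1) alpha_in
             + H_norm 2^-1 xi_in))%E].
Proof.
have F1 := energy_factor_ge1 hM.
have g10 : 0 < gamma - 1 by rewrite subr_gt0.
have g2 := sqr_ge0 gamma.
have q0 : 0 < 4 / (gamma - 1) by rewrite divr_gt0.
have h8 : 8 * (1 + energy_factor M) <= 8 * (1 + energy_factor M) * (2 + gamma ^+ 2) * 2 + 4 / (gamma - 1).
  have : 0 <= (energy_factor M - 1) * gamma ^+ 2 by rewrite mulr_ge0// subr_ge0.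
  move: q0 F1 g2; lra.
(* 8 (1 + F) dominates the square roots of the constants 8 F, 16, 32 F and 64 of
   the modes; the factor 2 (2 + gamma^2) sums the acoustic parts of Q[v], rho and
   theta, and 4 / (gamma - 1) pays for the entropy. *)
exists (8 * (1 + energy_factor M) * (2 + gamma ^+ 2) * 2 + 4 / (gamma - 1)).
split; first by apply: lt_le_trans h8; move: F1; lra.
move=> rho_in alpha_in omega_in theta_in rho alpha omega theta _ _ _ _ zr _ _ zt sol p s x t t0; split.
- exact: (Pv_x_decay sol hgamma hM t0 h8).
- exact: (Pv_y_decay sol hgamma hM t0 h8).
- exact: (Q_rho_theta_growth sol hgamma hM t0 zr zt (lexx _)).
Qed.
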